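(* Let $n\ge2$. The connectedness locus $\mathcal{C}\subset\mathcal{M}$ is contained in a compact subset of the extended moduli space $\widehat{\mathcal{M}}$. Hence the closure $\overline{\mathcal{C}}\subset\widehat{\mathcal{M}}$ is compact.
   Context: A rational map $f:\widehat{\mathbb{C}}\to\widehat{\mathbb{C}}$ of degree $n\ge2$ is bicritical if it has exactly two critical points. $\mathcal{M}$ denotes the set of conjugacy classes $(f)$ of degree $n$ bicritical maps under Möbius conjugation. Every bicritical map is conjugate to one of the form $f(z)=(az^n+b)/(cz^n+d)$ with $ad-bc\ne0$; the quantities $X=bc/(ad-bc)$ and $Y=\big(a^{n+1}b^{n-1}+c^{n-1}d^{n+1}\big)/(ad-bc)^n$ depend only on $(f)$, and $(X,Y)$ identifies $\mathcal{M}$ with $\mathbb{C}^2$. Let $\lambda_1,\dots,\lambda_{n+1}$ be the multipliers at the $n+1$ fixed points of $f$ (counted with multiplicity) and $\sigma_k$ their $k$-th elementary symmetric function. Then $\sigma_{n+1}=n^{n+1}X^{n-1}$, and $(X,\sigma_n)$ is also a global holomorphic coordinate system identifying $\mathcal{M}$ with $\mathbb{C}^2$. Put $L_0=\{(f)\in\mathcal{M}: X(f)=0\}$. The extended moduli space $\widehat{\mathcal{M}}=\mathcal{M}\sqcup L_\infty$, where $L_\infty$ is a copy of $\mathbb{C}$ with coordinate $\hat\sigma_1$, is the complex manifold covered by two charts, each with image $\mathbb{C}^2$: the chart $\mathcal{M}$ with coordinates $(X,\sigma_n)$, and the chart $(\mathcal{M}\smallsetminus L_0)\cup L_\infty$ with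 coordinates $(\hat X,\hat\sigma_1)$, where $\hat X=0$ on $L_\infty$, and on $\mathcal{M}\smallsetminus L_0$ one has $\hat X=1/X$ and $\hat\sigma_1=\sigma_n/(n^{n+1}X^{n-1})$ $(=\sum_i 1/\lambda_i)$. The connectedness locus $\mathcal{C}\subset\mathcal{M}$ is the set of $(f)$ with connected Julia set. *)

(* Defs.v *)
From HB Require Import structures.
From mathcomp Require Import all_boot all_order all_algebra.
From mathcomp Require Import all_classical all_reals all_analysis.
From mathcomp Require Export complex.

Set Implicit Arguments.
Unset Strict Implicit.
Unset Printing Implicit Defensive.

Import Order.TTheory GRing.Theory Num.Theory.
Import numFieldNormedType.Exports.

Local Open Scope classical_set_scope.
Local Open Scope ring_scope.

(* [C] plays the role of the field of complex numbers. The definitions use    *)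
(* only the [numClosedFieldType] structure (so that the topology on [C] is    *)
(* the canonical one, given by the norm); they are meant for [C := R[i]] with *)
(* [R : realType].                                                            *)

Section RiemannSphere.
Variable C : numClosedFieldType.

(* [Some z] is the finite point [z], [None] is the point at infinity. *)
Definition sphere := one_point_compactification C.

HB.instance Definition _ := Topological.on sphere.
HB.instance Definition _ := Pointed.on sphere.

(* The chordal distance. It is real, but is written here as an element of     *)
(* [C]; in [C], [0 < e] forces [e] to be real.                                *)
Definition chord (x y : sphere) : C :=
  match x, y with
  | Some z, Some w =>
      2 * `|z - w| / (sqrtC (1 + `|z| ^+ 2) * sqrtC (1 + `|w| ^+ 2))
  | Some z, None | None, Some z => 2 / sqrtC (1 + `|z| ^+ 2)
  | None, None => 0
  end.

(* Local holomorphic coordinate near [z]: [x |-> x] if [z] is finite and      *)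
(* [x |-> 1/x] if [z] is infinity. [sphere_param z] is its inverse. The value *)
(* at the one point outside the coordinate domain is irrelevant.              *)
Definition sphere_coord (z x : sphere) : C :=
  match z, x with
  | Some _, Some w => w
  | None, Some w => w^-1
  | _, None => 0
  end.

Definition sphere_param (z : sphere) (w : C) : sphere :=
  match z with
  | Some _ => Some w
  | None => if w == 0 then None else Some w^-1
  end.

Definition local_rep (f : sphere -> sphere) (z : sphere) : C -> C :=
  fun w => sphere_coord (f z) (f (sphere_param z w)).

Definition local_deriv (f : sphere -> sphere) (z : sphere) : C :=
  (local_rep f z)^`()%classic (sphere_coord z z).

Definition critical_points (f : sphere -> sphere) : set sphere :=
  [set z | local_deriv f z = 0].

(* The map [x |-> p(x) / q(x)]. At infinity its value is the ratio of the     *)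
(* coefficients of degree [max (deg p) (deg q)].                              *)
Definition ratfun (p q : {poly C}) (x : sphere) : sphere :=
  match x with
  | Some z => if q.[z] == 0 then None else Some (p.[z] / q.[z])
  | None =>
      let d := (maxn (size p) (size q)).-1 in
      if q`_d == 0 then None else Some (p`_d / q`_d)
  end.

Definition rational_map (n : nat) (f : sphere -> sphere) : Prop :=
  exists p q : {poly C},
    [/\ coprimep p q, (maxn (size p) (size q)).-1 = n & f = ratfun p q].

Definition bicritical (n : nat) (f : sphere -> sphere) : Prop :=
  rational_map n f /\
  exists c1 c2 : sphere, c1 <> c2 /\ critical_points f = [set c1; c2].

(* The Moebius transformations are the rational maps of degree 1; as they are *)
(* bijective, the equation says that [g = phi \o f \o phi^-1].                *)
Definition conjugate (f g : sphere -> sphere) : Prop :=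
  exists2 phi, rational_map 1 phi & g \o phi = phi \o f.

(* For [f z = z], [local_rep f z] is the map [f] read in one and the same     *)
(* coordinate in source and target.                                           *)
Definition multiplier (f : sphere -> sphere) (z : sphere) : C :=
  local_deriv f z.

(* [m] is the multiplicity of [z] as a fixed point of [f]: the order of       *)
(* vanishing at [z] of [f(w) - w] in a local coordinate [w], and [0] if [z]   *)
(* is not fixed.                                                              *)
Definition fixed_multiplicity (f : sphere -> sphere) (z : sphere) (m : nat) :=
  if f z == z then
    exists2 l : C, l != 0 &
      (local_rep f z w - w) / (w - sphere_coord z z) ^+ m @[w --> (sphere_coord z z)^'] --> l
  else m = 0%N.

Definition fixed_point_list (f : sphere -> sphere) (s : seq sphere) : Prop :=
  forall z, fixed_multiplicity f z (count_mem z s).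

Definition elem_sym (k : nat) (s : seq C) : C :=
  \sum_(A : {set 'I_(size s)} | #|A| == k) \prod_(i in A) s`_i.

Definition normal_on (U : set sphere) (F : set (sphere -> sphere)) : Prop :=
  forall u : nat -> sphere -> sphere, (forall k, F (u k)) ->
  exists (v : nat -> nat) (g : sphere -> sphere),
    {homo v : i j / (i < j)%N} /\
    forall K : set sphere, compact K -> K `<=` U ->
    forall e : C, 0 < e ->
    \forall k \near \oo, forall z, K z -> chord (u (v k) z) (g z) < e.

Definition fatou_set (f : sphere -> sphere) : set sphere :=
  [set z | exists U : set sphere,
    [/\ open U, U z & normal_on U (range (fun k => iter k f))]].

Definition julia_set (f : sphere -> sphere) : set sphere := ~` fatou_set f.

End RiemannSphere.

Section Moduli.
Variables (C : numClosedFieldType) (n : nat).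

Record moduli := Moduli {
  conj_class : set (sphere C -> sphere C) ;
  conj_classP : exists2 f, bicritical n f & conj_class = conjugate f }.

HB.instance Definition _ := gen_eqMixin moduli.
HB.instance Definition _ := gen_choiceMixin moduli.

Definition normal_form (a b c d : C) : sphere C -> sphere C :=
  ratfun (a *: 'X^n + b%:P) (c *: 'X^n + d%:P).

(* [moduliX] and [sigma] are selected by [xget] as the value taken by the     *)
(* representatives of the class: every class does have a representative in    *)
(* normal form, and the values do not depend on the representative.           *)
Definition moduliX (m : moduli) : C :=
  xget 0 [set x | exists a b c d : C,
    [/\ a * d - b * c != 0, conj_class m (normal_form a b c d)
      & x = b * c / (a * d - b * c)]].

Definition sigma (k : nat) (m : moduli) : C :=
  xget 0 [set x | exists f s,
    [/\ conj_class m f, fixed_point_list f s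
      & x = elem_sym k [seq multiplier f z | z <- s]]].

Definition moduli_L0 : set moduli := [set m | moduliX m = 0].

(* [inl m] is the class [m]; [inr s] is the point of the line at infinity     *)
(* whose coordinate [hat sigma_1] is [s].                                     *)
Definition ext_moduli : Type := (moduli + C)%type.

HB.instance Definition _ := Choice.on ext_moduli.

Definition chart1 (m : moduli) : C * C := (moduliX m, sigma n m).

Definition chart2_dom : set ext_moduli :=
  [set x | if x is inl m then ~ moduli_L0 m else True].

Definition chart2 (x : ext_moduli) : C * C :=
  match x with
  | inl m => ((moduliX m)^-1,
              sigma n m / (n%:R ^+ n.+1 * moduliX m ^+ n.-1))
  | inr s => (0, s)
  end.

(* The manifold topology: [U] is open iff its trace on the domain of each     *)
(* chart is open. As each chart is a bijection from its domain onto [C * C],  *)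
(* the open subsets of the domain are the preimages of the open subsets of    *)
(* [C * C].                                                                   *)
Definition ext_open (U : set ext_moduli) : Prop :=
  (exists2 V : set (C * C), open V & inl @^-1` U = chart1 @^-1` V) /\
  (exists2 V : set (C * C), open V &
     chart2_dom `&` U = chart2_dom `&` chart2 @^-1` V).

Lemma ext_openT : ext_open setT.
Proof. by split; exists setT => //; exact: openT. Qed.

Lemma ext_openI : setI_closed ext_open.
Proof.
move=> A B [[V1 oV1 AV1] [V2 oV2 AV2]] [[W1 oW1 BW1] [W2 oW2 BW2]]; split.
  by exists (V1 `&` W1); [exact: openI|rewrite !preimage_setI AV1 BW1].
exists (V2 `&` W2); first exact: openI.
by rewrite preimage_setI setIIr AV2 BW2 -setIIr.
Qed.

Lemma ext_open_bigU (I : Type) (f : I -> set ext_moduli) :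
  (forall i, ext_open (f i)) -> ext_open (\bigcup_i f i).
Proof.
move=> of_; split.
  have /choice[V hV] i : exists V : set (C * C),
      open V /\ inl @^-1` f i = chart1 @^-1` V.
    by have [[V oV fV] _] := of_ i; exists V.
  exists (\bigcup_i V i); first by apply: bigcup_open => i _; case: (hV i).
  rewrite !preimage_bigcup; apply: eq_bigcupr => i _.
  by case: (hV i).
have /choice[V hV] i : exists V : set (C * C),
    open V /\ chart2_dom `&` f i = chart2_dom `&` chart2 @^-1` V.
  by have [_ [V oV fV]] := of_ i; exists V.
exists (\bigcup_i V i); first by apply: bigcup_open => i _; case: (hV i).
rewrite preimage_bigcup !setI_bigcupr; apply: eq_bigcupr => i _.
by case: (hV i).
Qed.

HB.instance Definition _ :=
  isOpenTopological.Build ext_moduli ext_openT ext_openI ext_open_bigU.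

Definition connectedness_locus : set moduli :=
  [set m | exists2 f, conj_class m f & connected (julia_set f)].

Definition ext_connectedness_locus : set ext_moduli :=
  inl @` connectedness_locus.

End Moduli.

Arguments connectedness_locus C n : clear implicits.
Arguments ext_connectedness_locus C n : clear implicits.

(* Main.v *)
(* A class other than those of z^n and z^-n is represented by                  *)

(* Everything rests on one estimate, |sigma_n| <= B (1 + |X|^(n-1)) on the connectedness locus
   ([sigma_bound]). Its weight is dictated by the change of charts: division by |X|^(n-1) yields an
   estimate of the same shape in 1/X and hat sigma_1. The estimate therefore defines a closed set
   [ext_bounded] of the extended moduli space, covered by one polydisc in each chart and hence
   compact ([compact_ext_bounded]).

   Apart from z^n and z^-n, whose invariants are explicit, every class is represented by a map
   [cv_map] with critical values e and b = e - k, normalised by |e|^(n+1) |b|^(n-1) <= 1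
   ([representative_cases]). Then X = b/k and sigma_n = n^n (N - (n+1) k b^(n-1)) / k^n, where N = 1
   + e^(n+1) b^(n-1) + 2 e b^(n-1) ([sigma_value_numerator]), so the claim becomes |N| <= K |k|
   (|k|^(n-1) + |b|^(n-1)) ([cv_numerator_bound]). If |e| > 2, the normalisation forces |b| <= 1 and
   |k| >= 1, and a crude bound is enough; the same goes for |k| >= 1. The delicate case is k small:
   N reduces to (1 + e^n)^2 at k = 0, so |1 + e^n|^2 = O(|k|) is required. Dynamics supplies it.
   When it fails and |e| <= 2, a disc about e is mapped into itself, its complement in the plane
   carries contracting inverse branches near the n-th roots of -1, and the Julia set falls apart
   ([cv_map_disconnected]).

   The rest identifies the abstract coordinates: the normal form of a bicritical map is found from
   its Wronskian ([bicritical_normal_form]), X and the multipliers are conjugacy invariants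
   ([conjugate_invariantX], [fixed_list_multipliers]), sigma_n is evaluated with Newton's identities
   ([sigma_normal_form]), and the charts are onto ([chart1_surjective]), which lets compactness pass
   from pairs of complex numbers to the extended moduli space. *)
(* F(z) = e - k / (1 + z^n), of critical values e and b = e - k, where         *)
(* |e|^(n+1) |b|^(n-1) <= 1 after exchanging 0 and oo.  If |e| <= 2 and |k| is *)
(* small compared with |1 + e^n|^2, then F maps a disc around e = F(oo) into   *)
(* itself, so that the Julia set lies close to the n roots of -1; the inverse  *)
(* branch of F near each root has a fixed point, which is repelling for F,     *)
(* hence the Julia set is disconnected.  On the connectedness locus            *)
(* |1 + e^n|^2 is therefore at most a multiple of |k| when |e| <= 2, and       *)
(* computing sigma_n of F from the equation z^(n+1) - e z^n + z - b = 0 of its *)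
(* fixed points yields |sigma_n| <= B (1 + |X|^(n-1)).  In the other chart the *)
(* same inequality reads n^(n+1) |hat sigma_1| <= B (1 + |hat X|^(n-1)), so it *)
(* defines a closed subset of the extended moduli space, which is covered by   *)
(* one compact polydisc in each chart.                                         *)
Require Import Defs.
From mathcomp Require Import all_boot all_order all_algebra.
From mathcomp Require Import all_classical all_reals all_analysis.
From mathcomp Require Import ring lra zify.

Set Implicit Arguments.
Unset Strict Implicit.
Unset Printing Implicit Defensive.

Import Order.TTheory GRing.Theory Num.Theory.
Import numFieldNormedType.Exports.

Local Open Scope classical_set_scope.
Local Open Scope ring_scope.

(* Stands for the pair [R], [R[i]]: kept abstract, the arithmetic of [R[i]] is *)
(* never unfolded by conversion.                                              *)
Record complex_model := ComplexModel {
  creal : realType ;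
  cnum : numClosedFieldType ;
  ofR : {rmorphism creal -> cnum} ;
  ler_ofR : forall r s, (ofR r <= ofR s) = (r <= s) ;
  real_ofR : forall z, z \is Num.real -> exists r, z = ofR r }.

Arguments ofR {c}.

(** * The modulus with values in the real field *)

Section Modulus.
Variable M : complex_model.
Local Notation R := (creal M).
Local Notation C := (cnum M).
Implicit Types (x y z : C) (r s : R).

Lemma ltr_ofR r s : (ofR r < ofR s :> C) = (r < s).
Proof. by rewrite !lt_def ler_ofR (inj_eq (fmorph_inj _)). Qed.

Lemma ofR_inj : injective (@ofR M).
Proof. exact: fmorph_inj. Qed.

Lemma ofR_ge0 r : (0 <= ofR r :> C) = (0 <= r).
Proof. by rewrite -(rmorph0 (@ofR M)) ler_ofR. Qed.

Lemma ofR_gt0 r : (0 < ofR r :> C) = (0 < r).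
Proof. by rewrite -(rmorph0 (@ofR M)) ltr_ofR. Qed.

(** The norm of [C] has values in [C]; its real preimage is used so that estimates take place in an
    ordered field, within reach of [lra] and [nra]. *)
Definition cabs z : R := projT1 (cid (real_ofR (normr_real z))).

Lemma normC_cabs z : `|z| = ofR (cabs z).
Proof. by rewrite /cabs; case: cid. Qed.

Lemma cabs_ge0 z : 0 <= cabs z.
Proof. by rewrite -ofR_ge0 -normC_cabs normr_ge0. Qed.

Lemma cabs0 : cabs 0 = 0.
Proof. by apply: ofR_inj; rewrite -normC_cabs normr0 rmorph0. Qed.

Lemma cabs1 : cabs 1 = 1.
Proof. by apply: ofR_inj; rewrite -normC_cabs normr1 rmorph1. Qed.

Lemma cabs_eq0 z : (cabs z == 0) = (z == 0).
Proof.
by rewrite -(inj_eq ofR_inj) -normC_cabs rmorph0 normr_eq0.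
Qed.

Lemma cabs_gt0 z : (0 < cabs z) = (z != 0).
Proof. by rewrite lt_def cabs_eq0 cabs_ge0 andbT. Qed.

Lemma cabsM : {morph cabs : x y / x * y}.
Proof.
by move=> x y; apply: ofR_inj; rewrite rmorphM -!normC_cabs normrM.
Qed.

Lemma cabsX n : {morph cabs : x / x ^+ n}.
Proof.
by move=> x; apply: ofR_inj; rewrite rmorphXn -!normC_cabs normrX.
Qed.

Lemma cabsV : {morph cabs : x / x^-1}.
Proof.
move=> x; have [->|x0] := eqVneq x 0; first by rewrite invr0 cabs0 invr0.
by apply: ofR_inj; rewrite fmorphV -!normC_cabs normfV.
Qed.

Lemma cabsN z : cabs (- z) = cabs z.
Proof. by apply: ofR_inj; rewrite -!normC_cabs normrN. Qed.

Lemma cabsB x y : cabs (x - y) = cabs (y - x).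
Proof. by rewrite -cabsN opprB. Qed.

Lemma cabsD x y : cabs (x + y) <= cabs x + cabs y.
Proof. by rewrite -(@ler_ofR M) rmorphD -!normC_cabs ler_normD. Qed.

Lemma cabs_sub_ge x y : cabs x - cabs y <= cabs (x - y).
Proof. by have := cabsD (x - y) y; rewrite subrK; lra. Qed.

Lemma cabs_sum I (s : seq I) (F : I -> C) :
  cabs (\sum_(i <- s) F i) <= \sum_(i <- s) cabs (F i).
Proof.
elim/big_rec2: _ => [|i u v _ uv]; first by rewrite cabs0.
by apply: le_trans (cabsD _ _) _; rewrite lerD2l.
Qed.

Lemma cabs_prod I (s : seq I) (F : I -> C) :
  cabs (\prod_(i <- s) F i) = \prod_(i <- s) cabs (F i).
Proof. by elim/big_rec2: _ => [|i u v _ <-]; rewrite ?cabs1 ?cabsM. Qed.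

Lemma cabs_real (r : R) : cabs (ofR r) = `|r|.
Proof.
apply: ofR_inj; rewrite -normC_cabs.
case: (lerP 0 r) => r0; first by rewrite (ger0_norm r0) ger0_norm ?ofR_ge0.
by rewrite (ltr0_norm r0) ltr0_norm ?rmorphN // -oppr_gt0 -rmorphN ofR_gt0 oppr_gt0.
Qed.

Lemma cabs_nat n : cabs n%:R = n%:R.
Proof. by rewrite -(rmorph_nat (@ofR M)) cabs_real normr_nat. Qed.

Lemma cabs_ball (z w : C) (e : R) :
  (ball z (ofR e) w) <-> cabs (z - w) < e.
Proof. by rewrite -ball_normE /ball_ /= normC_cabs ltr_ofR. Qed.

Lemma cgt0_real (e : C) : 0 < e -> exists2 r : R, 0 < r & e = ofR r.
Proof.
move=> e0; have [r er] := real_ofR (gtr0_real e0).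
by exists r; rewrite // -ofR_gt0 -er.
Qed.

Lemma nbhs_cabsP (z : C) (A : set C) :
  nbhs z A <-> exists2 e : R, 0 < e & forall w, cabs (w - z) < e -> A w.
Proof.
split=> [/nbhs_ballP[_ /= /cgt0_real [e e0 ->] zA]|[e e0 zA]].
  by exists e => // w wz; apply: zA; apply/cabs_ball; rewrite cabsB.
apply/nbhs_ballP; exists (ofR e); first by rewrite /= ofR_gt0.
by move=> w /cabs_ball; rewrite cabsB; apply: zA.
Qed.

(** After x - y is factored out, each of the n terms of the cofactor is at most B^(n-1). *)
Lemma cabs_powB (x y : C) (B : R) n : cabs x <= B -> cabs y <= B ->
  cabs (x ^+ n - y ^+ n) <= n%:R * B ^+ n.-1 * cabs (x - y).
Proof.
move=> xB yB; rewrite subrXX cabsM mulrC ler_wpM2r ?cabs_ge0 //.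
apply: le_trans (cabs_sum _ _) _.
have B0 : 0 <= B by apply: le_trans xB; apply: cabs_ge0.
have : \sum_(i < n) cabs (x ^+ (n.-1 - i) * y ^+ i) <= \sum_(i < n) B ^+ n.-1.
  apply: ler_sum => i _; rewrite cabsM !cabsX.
  have -> : B ^+ n.-1 = B ^+ (n.-1 - i) * B ^+ i.
    by rewrite -exprD subnK // -ltnS (leq_trans (ltn_ord i)) // leqSpred.
  by apply: ler_pM; rewrite ?exprn_ge0 ?cabs_ge0 // lerXn2r // nnegrE cabs_ge0.
by rewrite sumr_const card_ord -[X in _ <= X]mulr_natl.
Qed.

End Modulus.

(** * The sphere in homogeneous coordinates *)

Section Homogeneous.
Variable M : complex_model.
Local Notation R := (creal M).
Local Notation C := (cnum M).
Local Notation S := (sphere C).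
Implicit Types (x y z : S) (u v a b c d : C).

(** The point [u : v] of the projective line. The meaningless pair (0, 0) is sent to infinity, so
    statements about [hpt] assume one coordinate nonzero. *)
Definition hpt u v : S := if v == 0 then None else Some (u / v).
Definition hx z : C := if z is Some w then w else 1.
Definition hy z : C := if z is Some _ then 1 else 0.

Lemma hpt_coords z : hpt (hx z) (hy z) = z.
Proof.
by case: z => [w|]; rewrite /hpt /hx /hy ?eqxx // oner_eq0 divr1.
Qed.

Lemma hcoords_neq0 z : (hx z != 0) || (hy z != 0).
Proof. by case: z => [w|] /=; rewrite oner_eq0 ?orbT. Qed.

Lemma hptZ k u v : k != 0 -> hpt (k * u) (k * v) = hpt u v.
Proof.
move=> k0; rewrite /hpt mulf_eq0 (negbTE k0) /=; case: eqP => // _.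
by rewrite -mulf_div divff // mul1r.
Qed.

Lemma coords_hpt u v : (u != 0) || (v != 0) ->
  exists2 k, k != 0 & hx (hpt u v) = k * u /\ hy (hpt u v) = k * v.
Proof.
rewrite /hpt; have [->|v0] := eqVneq v 0.
  rewrite orbF => u0; exists u^-1; first by rewrite invr_eq0.
  by rewrite mulr0 mulVf.
by move=> _; exists v^-1; rewrite ?invr_eq0 // mulVf // mulrC.
Qed.

Lemma eq_hpt a b c d : (a != 0) || (b != 0) -> (c != 0) || (d != 0) ->
  (hpt a b = hpt c d) <-> a * d = c * b.
Proof.
rewrite /hpt; have [->|b0] := eqVneq b 0; have [->|d0] := eqVneq d 0;
  rewrite ?orbF ?orbT => ab cd.
- by rewrite !mulr0.
- by split=> // /eqP; rewrite mulr0 mulf_eq0 (negbTE ab) (negbTE d0).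
- by split=> // /esym/eqP; rewrite mulr0 mulf_eq0 (negbTE b0) (negbTE cd).
split=> [[/eqP]|e]; first by rewrite eqr_div // => /eqP.
by congr Some; apply/eqP; rewrite eqr_div //; apply/eqP.
Qed.

Definition hnorm u v : R := Num.sqrt (cabs u ^+ 2 + cabs v ^+ 2).

Lemma hnorm_sqr u v : hnorm u v ^+ 2 = cabs u ^+ 2 + cabs v ^+ 2.
Proof. by rewrite sqr_sqrtr // addr_ge0 ?sqr_ge0. Qed.

Lemma hnorm_ge0 u v : 0 <= hnorm u v.
Proof. exact: sqrtr_ge0. Qed.

Lemma hnorm_gt0 u v : (0 < hnorm u v) = (u != 0) || (v != 0).
Proof.
rewrite lt_def hnorm_ge0 andbT sqrtr_eq0 -ltNge.
apply/idP/idP => [|/orP[u0|v0]].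
- apply: contraLR; rewrite negb_or !negbK => /andP[/eqP -> /eqP ->].
  by rewrite cabs0 expr0n addr0 ltxx.
- by rewrite ltr_wpDr ?sqr_ge0 // exprn_gt0 // cabs_gt0.
- by rewrite ltr_wpDl ?sqr_ge0 // exprn_gt0 // cabs_gt0.
Qed.

Lemma hnormZ k u v : hnorm (k * u) (k * v) = cabs k * hnorm u v.
Proof.
rewrite /hnorm !cabsM !exprMn -mulrDr sqrtrM ?sqr_ge0 // sqrtr_sqr.
by rewrite ger0_norm ?cabs_ge0.
Qed.

Lemma cabs_le_hnorm u v : cabs u <= hnorm u v.
Proof.
rewrite -[leLHS](ger0_norm (cabs_ge0 u)) -sqrtr_sqr ler_wsqrtr //.
by rewrite lerDl sqr_ge0.
Qed.

Lemma hnormC u v : hnorm u v = hnorm v u.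
Proof. by rewrite /hnorm addrC. Qed.

Lemma cabs_le_hnormr u v : cabs v <= hnorm u v.
Proof. by rewrite hnormC cabs_le_hnorm. Qed.

Lemma hnorm_le u v : hnorm u v <= cabs u + cabs v.
Proof.
rewrite -ler_sqr ?nnegrE ?hnorm_ge0 ?addr_ge0 ?cabs_ge0 // hnorm_sqr sqrrD.
by have := mulr_ge0 (cabs_ge0 u) (cabs_ge0 v); lra.
Qed.

(** Twice the normalised wedge product of coordinate vectors. It is invariant under rescaling of
    either vector, which makes one formula cover the four cases of [chord]. *)
Definition cdist x y : R :=
  2 * cabs (hx x * hy y - hx y * hy x) / (hnorm (hx x) (hy x) * hnorm (hx y) (hy y)).

Lemma cdist_hpt a b c d : (a != 0) || (b != 0) -> (c != 0) || (d != 0) ->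
  cdist (hpt a b) (hpt c d) = 2 * cabs (a * d - c * b) / (hnorm a b * hnorm c d).
Proof.
move=> ab cd; rewrite /cdist.
have [k k0 [-> ->]] := coords_hpt ab; have [l l0 [-> ->]] := coords_hpt cd.
have -> : k * a * (l * d) - l * c * (k * b) = (k * l) * (a * d - c * b) by ring.
rewrite !hnormZ !cabsM.
have nab : hnorm a b != 0 by rewrite gt_eqF // hnorm_gt0.
have ncd : hnorm c d != 0 by rewrite gt_eqF // hnorm_gt0.
have nk : cabs k != 0 by rewrite cabs_eq0.
have nl : cabs l != 0 by rewrite cabs_eq0.
by field; rewrite nab ncd nk nl.
Qed.

Lemma sqrtC_ofR (r : R) : 0 <= r -> sqrtC (ofR r) = ofR (Num.sqrt r).
Proof.
move=> r0; rewrite -[in LHS](sqr_sqrtr r0) rmorphXn sqrCK //.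
by rewrite ofR_ge0 sqrtr_ge0.
Qed.

Lemma chord_cdist x y : chord x y = ofR (cdist x y).
Proof.
have E w : sqrtC (1 + `|w| ^+ 2) = ofR (hnorm w 1).
  rewrite normC_cabs; transitivity (sqrtC (ofR (1 + cabs w ^+ 2) : C)).
    by rewrite rmorphD rmorph1 rmorphXn.
  by rewrite sqrtC_ofR ?addr_ge0 ?sqr_ge0 // /hnorm cabs1 expr1n addrC.
have h10 : hnorm 1 0 = 1.
  by rewrite /hnorm cabs1 cabs0 expr1n expr0n /= addr0 sqrtr1.
case: x y => [z|] [w|]; rewrite /cdist /= ?h10 ?mulr1 ?mul1r ?mulr0.
- by rewrite !E normC_cabs !fmorph_div !rmorphM rmorph_nat.
- by rewrite sub0r cabsN cabs1 mulr1 E fmorph_div rmorph_nat.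
- by rewrite subr0 cabs1 mulr1 E fmorph_div rmorph_nat.
- by rewrite subrr cabs0 mulr0 mul0r rmorph0.
Qed.

Lemma chord_lt x y (e : R) : (chord x y < ofR e) = (cdist x y < e).
Proof. by rewrite chord_cdist ltr_ofR. Qed.

Lemma hnorm_coords z : 0 < hnorm (hx z) (hy z).
Proof. by rewrite hnorm_gt0 hcoords_neq0. Qed.

Lemma cdist_ge0 x y : 0 <= cdist x y.
Proof.
by rewrite /cdist divr_ge0 ?mulr_ge0 ?hnorm_ge0 ?cabs_ge0 // ler0n.
Qed.

Lemma cdistC x y : cdist x y = cdist y x.
Proof. by rewrite /cdist cabsB [X in _ / X]mulrC. Qed.

Lemma cdistxx x : cdist x x = 0.
Proof. by rewrite /cdist subrr cabs0 mulr0 mul0r. Qed.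

Lemma cdist_eq0 x y : cdist x y = 0 -> x = y.
Proof.
move=> /eqP; rewrite /cdist mulf_eq0 invr_eq0 orbC gt_eqF /=; last first.
  by rewrite mulr_gt0 ?hnorm_coords.
rewrite mulf_eq0 pnatr_eq0 /= cabs_eq0 subr_eq0 => /eqP e.
by rewrite -[x]hpt_coords -[y]hpt_coords; apply/eq_hpt; rewrite ?hcoords_neq0.
Qed.

Lemma cauchy_schwarz2 a b c d :
  cabs (a * c + b * d) <= hnorm a b * hnorm c d.
Proof.
rewrite -ler_sqr ?nnegrE ?mulr_ge0 ?hnorm_ge0 ?cabs_ge0 // exprMn !hnorm_sqr.
have h : cabs (a * c + b * d) <= cabs a * cabs c + cabs b * cabs d.
  by rewrite -!cabsM cabsD.
apply: (@le_trans _ _ ((cabs a * cabs c + cabs b * cabs d) ^+ 2)).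
  by rewrite ler_sqr ?nnegrE ?addr_ge0 ?mulr_ge0 ?cabs_ge0.
have := sqr_ge0 (cabs a * cabs d - cabs b * cabs c); nra.
Qed.

Lemma cabs_conj u : cabs (u^*)%R = cabs u.
Proof. by apply: ofR_inj; rewrite -!normC_cabs norm_conjC. Qed.

(* For unit vectors this is [x ^ z = <x, y> (y ^ z) + (x ^ y) <z, y>^*]: the   *)
(* chordal distance is twice the absolute value of the wedge product.         *)
Lemma cdist_triangle y x z : cdist x z <= cdist x y + cdist y z.
Proof.
rewrite /cdist.
move: (hx x) (hy x) (hnorm_coords x) => x1 x2 nx.
move: (hx y) (hy y) (hnorm_coords y) => y1 y2 ny.
move: (hx z) (hy z) (hnorm_coords z) => z1 z2 nz.
have key : cabs (x1 * z2 - z1 * x2) * hnorm y1 y2 ^+ 2 <=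
   hnorm x1 x2 * hnorm y1 y2 * cabs (y1 * z2 - z1 * y2) +
   cabs (x1 * y2 - y1 * x2) * (hnorm y1 y2 * hnorm z1 z2).
  have -> : hnorm y1 y2 ^+ 2 = cabs (y1 * (y1^*)%R + y2 * (y2^*)%R).
    rewrite hnorm_sqr -!normCK !normC_cabs -!rmorphXn -rmorphD /= cabs_real.
    by rewrite ger0_norm // addr_ge0 ?sqr_ge0.
  rewrite -cabsM.
  have -> : (x1 * z2 - z1 * x2) * (y1 * (y1^*)%R + y2 * (y2^*)%R) =
    (x1 * (y1^*)%R + x2 * (y2^*)%R) * (y1 * z2 - z1 * y2) +
    (x1 * y2 - y1 * x2) * ((y1^*)%R * z1 + (y2^*)%R * z2) by ring.
  apply: le_trans (cabsD _ _) _; rewrite !cabsM; apply: lerD.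
    rewrite ler_wpM2r ?cabs_ge0 //; apply: le_trans (cauchy_schwarz2 _ _ _ _) _.
    by rewrite /hnorm !cabs_conj.
  rewrite ler_wpM2l ?cabs_ge0 //; apply: le_trans (cauchy_schwarz2 _ _ _ _) _.
  by rewrite /hnorm !cabs_conj.
move: key; move: (cabs (x1 * z2 - _)) (cabs (x1 * y2 - _)) (cabs (y1 * _ - _)).
move: (hnorm x1 x2) (hnorm y1 y2) (hnorm z1 z2) nx ny nz => p q r p0 q0 r0 a b c.
move=> key; rewrite -subr_ge0.
have -> : 2 * b / (p * q) + 2 * c / (q * r) - 2 * a / (p * r) =
   2 * (p * q * c + b * (q * r) - a * q ^+ 2) / (p * q ^+ 2 * r).
  by field; rewrite !gt_eqF.
apply: divr_ge0; first by apply: mulr_ge0; rewrite ?ler0n // subr_ge0.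
by rewrite ltW // !mulr_gt0 // exprn_gt0.
Qed.

Lemma cdist_le u v : cdist (Some u) (Some v) <= 2 * cabs (u - v).
Proof.
rewrite /cdist /= !mulr1 ler_pdivrMr; last by rewrite mulr_gt0 // hnorm_gt0 oner_eq0 orbT.
rewrite -[leLHS]mulr1 ler_wpM2l ?mulr_ge0 ?cabs_ge0 ?ler0n //.
by rewrite -[leLHS]mulr1 ler_pM ?ler01 // -[leLHS](@cabs1 M) cabs_le_hnormr.
Qed.

Lemma cdist_infty u : cdist (Some u) None = 2 / hnorm u 1.
Proof.
rewrite /cdist /= mulr0 mul1r sub0r cabsN cabs1 mulr1; congr (_ / _).
by rewrite /hnorm cabs1 cabs0 expr0n expr1n /= addr0 sqrtr1 mulr1.
Qed.

End Homogeneous.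


(** * Binary forms, normal forms and Moebius transformations *)

Section Forms.
Variable M : complex_model.
Local Notation R := (creal M).
Local Notation C := (cnum M).
Local Notation S := (sphere C).
Implicit Types (z : S) (u v a b c d : C).

(** The homogenisation of [p] in degree n; with it [ratfun] needs no separate treatment at
    infinity. *)
Definition hform n (p : {poly C}) u v : C := \sum_(i < n.+1) p`_i * u ^+ i * v ^+ (n - i).

Lemma hform_v1 n (p : {poly C}) u : (size p <= n.+1)%N -> hform n p u 1 = p.[u].
Proof.
move=> pn; rewrite (horner_coef_wide _ pn).
by apply: eq_bigr => i _; rewrite expr1n mulr1.
Qed.

Lemma hform_v0 n (p : {poly C}) : hform n p 1 0 = p`_n.
Proof.
rewrite /hform big_ord_recr /= big1 => [|i _].
  by rewrite add0r subnn expr0 expr1n !mulr1.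
by rewrite expr0n subn_eq0 leqNgt ltn_ord mulr0.
Qed.

Lemma hformZ n (p : {poly C}) k u v : hform n p (k * u) (k * v) = k ^+ n * hform n p u v.
Proof.
rewrite mulr_sumr; apply: eq_bigr => i _; rewrite !exprMn.
have -> : k ^+ n = k ^+ i * k ^+ (n - i) by rewrite -exprD subnKC // -ltnS.
ring.
Qed.

Lemma ratfun_hpt n (p q : {poly C}) z : (maxn (size p) (size q)).-1 = n ->
  ratfun p q z = hpt (hform n p (hx z) (hy z)) (hform n q (hx z) (hy z)).
Proof.
move=> e; have /andP[pn qn] : (size p <= n.+1)%N && (size q <= n.+1)%N.
  by rewrite -geq_max -e leqSpred.
case: z => [w|] /=; rewrite /ratfun /hpt /=; first by rewrite !hform_v1.
by rewrite !hform_v0 e.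
Qed.

Lemma hform_XnC n a b u v : (0 < n)%N ->
  hform n (a *: 'X^n + b%:P) u v = a * u ^+ n + b * v ^+ n.
Proof.
move=> n0; rewrite /hform big_ord_recr -(big_mkord xpredT (fun i =>
  (a *: 'X^n + b%:P)`_i * u ^+ i * v ^+ (n - i))) /=.
rewrite big_ltn // big_nat big1 => [|i /andP[i0 iltn]].
  rewrite !coefD !coefZ !coefXn !coefC !eqxx subn0 subnn eq_sym (gtn_eqF n0) /= ?expr0; ring.
by rewrite coefD coefZ coefXn coefC (ltn_eqF iltn) (gtn_eqF i0) mulr0 addr0 !mul0r.
Qed.

Lemma size_XnC n a b c d : (0 < n)%N -> a * d - b * c != 0 ->
  (maxn (size (a *: 'X^n + b%:P)) (size (c *: 'X^n + d%:P))).-1 = n.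
Proof.
move=> n0 D.
have le a' b' : (size (a' *: 'X^n + b'%:P : {poly C})%R <= n.+1)%N.
  rewrite (leq_trans (size_polyD _ _)) // geq_max.
  rewrite (leq_trans (size_scale_leq _ _)) ?size_polyXn //=.
  by rewrite (leq_trans (size_polyC_leq1 _)).
have ge a' b' : a' != 0 -> (n < size (a' *: 'X^n + b'%:P : {poly C})%R)%N.
  move=> a0; apply: contraTT a0; rewrite -leqNgt negbK => /leq_sizeP/(_ n (leqnn _)).
  by rewrite coefD coefZ coefXn eqxx coefC gtn_eqF // mulr1 addr0 => ->.
have /orP[a0|c0] : (a != 0) || (c != 0).
  apply: contraNT D; rewrite negb_or !negbK => /andP[/eqP -> /eqP ->].
  by rewrite mul0r mulr0 subrr.
- have /eqP -> : size (a *: 'X^n + b%:P : {poly C}) == n.+1 by rewrite eqn_leq le ge.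
  by rewrite (maxn_idPl _).
- have /eqP -> : size (c *: 'X^n + d%:P : {poly C}) == n.+1 by rewrite eqn_leq le ge.
  by rewrite (maxn_idPr _).
Qed.

(** A common divisor also divides the combination in which X^n cancels, the nonzero constant ad -
    bc. *)
Lemma coprimep_XnC n a b c d : a * d - b * c != 0 ->
  coprimep (a *: 'X^n + b%:P) (c *: 'X^n + d%:P).
Proof.
move=> D; apply/coprimepP => e ep eq.
have : e %| (a * d - b * c)%:P.
  have -> : (a * d - b * c)%:P =
      a%:P * (c *: 'X^n + d%:P) - c%:P * (a *: 'X^n + b%:P).
    by rewrite -!mul_polyC polyCB !polyCM; ring.
  by rewrite dvdp_sub // dvdp_mull.
have E : (a * d - b * c)%:P %= 1 by rewrite polyC_eqp1.
by rewrite (eqp_dvdr _ E) dvdp1 size_poly_eq1.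
Qed.

Lemma normal_form_rational n a b c d : (0 < n)%N -> a * d - b * c != 0 ->
  rational_map n (normal_form n a b c d).
Proof.
move=> n0 D; exists (a *: 'X^n + b%:P), (c *: 'X^n + d%:P).
by split=> //; [exact: coprimep_XnC|exact: size_XnC].
Qed.

Lemma normal_formE n a b c d z : (0 < n)%N -> a * d - b * c != 0 ->
  normal_form n a b c d z =
  hpt (a * hx z ^+ n + b * hy z ^+ n) (c * hx z ^+ n + d * hy z ^+ n).
Proof.
move=> n0 D; rewrite /normal_form (ratfun_hpt z (size_XnC n0 D)).
by rewrite !hform_XnC.
Qed.

Lemma det_neq0 a b c d u v : a * d - b * c != 0 -> (u != 0) || (v != 0) ->
  (a * u + b * v != 0) || (c * u + d * v != 0).
Proof.
move=> D; apply: contraTT; rewrite !negb_or !negbK => /andP[/eqP e1 /eqP e2].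
apply/andP; split.
  have : (a * d - b * c) * u == 0.
    have -> : (a * d - b * c) * u = d * (a * u + b * v) - b * (c * u + d * v) by ring.
    by rewrite e1 e2 !mulr0 subrr.
  by rewrite mulf_eq0 (negbTE D).
have : (a * d - b * c) * v == 0.
  have -> : (a * d - b * c) * v = a * (c * u + d * v) - c * (a * u + b * v) by ring.
  by rewrite e1 e2 !mulr0 subrr.
by rewrite mulf_eq0 (negbTE D).
Qed.

Lemma expn_neq0 n u v : (u != 0) || (v != 0) -> (u ^+ n != 0) || (v ^+ n != 0).
Proof. by case/orP => h; rewrite (expf_neq0 n h) ?orbT. Qed.

Lemma normal_form_hpt n a b c d u v : (0 < n)%N -> a * d - b * c != 0 ->
  (u != 0) || (v != 0) ->
  normal_form n a b c d (hpt u v) =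
  hpt (a * u ^+ n + b * v ^+ n) (c * u ^+ n + d * v ^+ n).
Proof.
move=> n0 D uv; rewrite (normal_formE _ n0 D).
have [k k0 [-> ->]] := coords_hpt uv.
by rewrite !exprMn -[RHS](@hptZ _ (k ^+ n)) ?expf_neq0 //; congr hpt; ring.
Qed.

Lemma normal_formZ n k a b c d : (0 < n)%N -> k != 0 -> a * d - b * c != 0 ->
  normal_form n (k * a) (k * b) (k * c) (k * d) = normal_form n a b c d.
Proof.
move=> n0 k0 D; apply/funext => z; rewrite !normal_formE //; last first.
  have -> : k * a * (k * d) - k * b * (k * c) = k ^+ 2 * (a * d - b * c) by ring.
  by rewrite mulf_neq0 ?expf_neq0.
by rewrite -[RHS](@hptZ _ k) //; congr hpt; ring.
Qed.

Definition mob a b c d : S -> S := normal_form 1 a b c d.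

Lemma mob_hpt a b c d u v : a * d - b * c != 0 -> (u != 0) || (v != 0) ->
  mob a b c d (hpt u v) = hpt (a * u + b * v) (c * u + d * v).
Proof. exact: normal_form_hpt. Qed.

Lemma mobE a b c d z : a * d - b * c != 0 ->
  mob a b c d z = hpt (a * hx z + b * hy z) (c * hx z + d * hy z).
Proof. exact: normal_formE. Qed.

Lemma mob_comp a b c d a' b' c' d' : a * d - b * c != 0 -> a' * d' - b' * c' != 0 ->
  (a * a' + b * c') * (c * b' + d * d') - (a * b' + b * d') * (c * a' + d * c') != 0
  /\ mob a b c d \o mob a' b' c' d' =
     mob (a * a' + b * c') (a * b' + b * d') (c * a' + d * c') (c * b' + d * d').
Proof.
move=> D D'.
have E : (a * a' + b * c') * (c * b' + d * d') - (a * b' + b * d') * (c * a' + d * c')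
   = (a * d - b * c) * (a' * d' - b' * c') by ring.
have N : (a * a' + b * c') * (c * b' + d * d') - (a * b' + b * d') * (c * a' + d * c')
   != 0 by rewrite E mulf_neq0.
split=> //; apply/funext => z; rewrite /= (mobE z D') mob_hpt ?det_neq0 ?hcoords_neq0 //.
rewrite mobE //; congr hpt; ring.
Qed.

Lemma mob_scalar k : k != 0 -> mob k 0 0 k = id.
Proof.
move=> k0; have D : k * k - 0 * 0 != 0 by rewrite mul0r subr0 mulf_neq0.
apply/funext => z; rewrite (mobE _ D) !mul0r addr0 add0r.
by rewrite hptZ // hpt_coords.
Qed.

Lemma mob_id : mob 1 0 0 1 = id.
Proof. by apply: mob_scalar; rewrite oner_neq0. Qed.

Lemma mobVK a b c d : a * d - b * c != 0 ->
  [/\ d * a - (- b) * (- c) != 0,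
      mob d (- b) (- c) a \o mob a b c d = id &
      mob a b c d \o mob d (- b) (- c) a = id].
Proof.
move=> D; have D' : d * a - (- b) * (- c) != 0 by rewrite mulrNN mulrC.
split; first exact: D'.
  rewrite (mob_comp D' D).2.
  transitivity (mob (a * d - b * c) 0 0 (a * d - b * c)).
    congr mob.
    ring.
    ring.
    ring.
    ring.
  exact: mob_scalar.
rewrite (mob_comp D D').2; transitivity (mob (a * d - b * c) 0 0 (a * d - b * c)).
  congr mob; ring.
exact: mob_scalar.
Qed.

Lemma poly_size2 (p : {poly C}) : (size p <= 2)%N -> p = p`_1 *: 'X^1 + (p`_0)%:P.
Proof.
move=> s; apply/polyP => -[|[|i]]; rewrite coefD coefZ coefXn coefC /=.
- by rewrite mulr0 add0r.
- by rewrite mulr1 addr0.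
- by rewrite mulr0 addr0 nth_default // (leq_trans s).
Qed.

(** A vanishing determinant would make numerator and denominator proportional, against coprimality
    in degree 1. *)
Lemma rational_map1P (phi : S -> S) : rational_map 1 phi <->
  exists a b c d, a * d - b * c != 0 /\ phi = mob a b c d.
Proof.
split=> [[p [q [cop s ->]]]|[a [b [c [d [D ->]]]]]]; last exact: normal_form_rational.
have /andP[sp sq] : (size p <= 2)%N && (size q <= 2)%N.
  by rewrite -geq_max (leq_trans (leqSpred _)) ?s.
exists p`_1, p`_0, q`_1, q`_0; split; last first.
  by rewrite {1}(poly_size2 sp) {1}(poly_size2 sq).
apply/negP; rewrite subr_eq0 => /eqP e.
have [q1|q1] := eqVneq q`_1 0.
  have p1 : p`_1 != 0.
    apply/eqP => p1; move: s; rewrite (poly_size2 sp) (poly_size2 sq) p1 q1 !scale0r !add0r.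
    have := size_polyC_leq1 p`_0; have := size_polyC_leq1 q`_0.
    by case: (size _) => [|[|?]] // _; case: (size _) => [|[|?]].
  have q0 : q = 0.
    move/eqP: e; rewrite q1 mulr0 mulf_eq0 (negbTE p1) /= => /eqP q0.
    by rewrite {1}(poly_size2 sq) q1 q0 scale0r add0r polyC0.
  move: cop; rewrite q0 coprimep0 -size_poly_eq1 => /eqP sp1.
  by move: p1; rewrite nth_default ?eqxx // sp1.
have qp : q %| p.
  have -> : p = (p`_1 / q`_1)%:P * q; last exact: dvdp_mull.
  apply/polyP => -[|[|i]]; rewrite coefCM.
  - by rewrite mulrAC e mulfK.
  - by rewrite mulfVK.
  - have -> : q`_i.+2 = 0 by rewrite nth_default // (leq_trans sq).
    by rewrite mulr0 nth_default // (leq_trans sp).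
have := (coprimepP _ _ cop) q qp (dvdpp q); rewrite -size_poly_eq1 => /eqP sq1.
by move: q1; rewrite nth_default ?eqxx // sq1.
Qed.

End Forms.

(** * Compactness of discs in the plane *)

Section SphereTopology.
Variable M : complex_model.
Local Notation R := (creal M).
Local Notation C := (cnum M).
Local Notation S := (sphere C).
Implicit Types (u v : C).

Lemma cabs_continuous : continuous (@cabs M : C -> R).
Proof.
move=> u A /nbhs_ballP[e /= e0 eA]; apply/nbhs_cabsP; exists e => // v vu.
apply: eA; rewrite -ball_normE /ball_ /=.
have h1 := cabs_sub_ge u v; have h2 := cabs_sub_ge v u.
by rewrite cabsB in h1; rewrite ltr_norml; apply/andP; split; lra.
Qed.

Lemma compact_cabs_bounded (K : set C) : compact K ->
  exists r : R, forall u, K u -> cabs u <= r.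
Proof.
move=> cK; have : compact (@cabs M @` K).
  apply: continuous_compact cK; apply: continuous_subspaceT.
  exact: cabs_continuous.
move=> /compact_bounded[r [_ /(_ (r + 1))]]; rewrite ltrDl ltr01 => /(_ isT) h.
exists (r + 1) => u Ku; have := h (cabs u) (imageP _ Ku) => /=.
by rewrite ger0_norm ?cabs_ge0.
Qed.

(** Real coordinates, through which the compactness of real squares reaches [C]. *)
Definition cofR2 (p : R * R) : C := ofR p.1 + 'i * ofR p.2.

Lemma cabs_i : cabs ('i : C) = 1.
Proof. by apply: ofR_inj; rewrite -normC_cabs normCi rmorph1. Qed.

Lemma cabs_cofR2 p : cabs (cofR2 p) <= `|p.1| + `|p.2|.
Proof. by apply: le_trans (cabsD _ _) _; rewrite cabsM cabs_i mul1r !cabs_real. Qed.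

Lemma cofR2B p q : cofR2 p - cofR2 q = cofR2 (p - q).
Proof. by rewrite /cofR2 !raddfB /=; ring. Qed.

Lemma cofR2_continuous : continuous cofR2.
Proof.
move=> p A /nbhs_cabsP[e e0 eA]; apply/nbhs_ballP; exists (e / 2); first by rewrite /= divr_gt0.
move=> q [/= b1 b2]; apply: eA; rewrite cofR2B.
apply: le_lt_trans (cabs_cofR2 _) _.
move: b1 b2; rewrite -!ball_normE /ball_ /= ![`|p.1 - _|]distrC ![`|p.2 - _|]distrC.
lra.
Qed.

Lemma cofR2_surj u : exists p, [/\ u = cofR2 p, `|p.1| <= cabs u & `|p.2| <= cabs u].
Proof.
have [r er] := real_ofR (Creal_Re u); have [s es] := real_ofR (Creal_Im u).
exists (r, s); split; rewrite /cofR2 /=.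
- by rewrite -er -es -Crect.
- by rewrite -(@ler_ofR M) -cabs_real -!normC_cabs -er leif_normC_Re_Creal.
- rewrite -(@ler_ofR M) -cabs_real -!normC_cabs -es.
  have := leif_normC_Re_Creal ('i * u); rewrite ReMil normrN normrM normCi mul1r.
  by move=> h; rewrite h.
Qed.

Lemma closed_disc (w : C) (r : R) : closed [set u | cabs (u - w) <= r].
Proof.
move=> u clu; apply/ler_addgt0Pl => e e0.
have [v [/= vr vu]] : [set u | cabs (u - w) <= r] `&` [set v | cabs (v - u) < e] !=set0.
  by apply: clu; apply/nbhs_cabsP; exists e.
have := cabsD (u - v) (v - w); rewrite addrA subrK => h.
by apply: le_trans h _; rewrite cabsB; lra.
Qed.

Lemma compact_disc (w : C) (r : R) : compact [set u | cabs (u - w) <= r].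
Proof.
pose M' := r + cabs w.
apply: (@subclosed_compact _ _ (cofR2 @` (`[- M', M']%classic `*` `[- M', M']%classic))).
- exact: closed_disc.
- apply: continuous_compact; first exact/continuous_subspaceT/cofR2_continuous.
  by apply: compact_setX; exact: segment_compact.
move=> u /= h; have [[s t] [eu h1 h2]] := cofR2_surj u.
exists (s, t) => //=; have h3 := cabs_sub_ge u w.
have h4 : cabs u <= M' by rewrite /M'; lra.
by rewrite !in_itv /= -!ler_norml; split; [apply: le_trans h4|apply: le_trans h4].
Qed.

End SphereTopology.

(** * The chordal metric and Lipschitz maps of the sphere *)

Section ChordalMetric.
Variable M : complex_model.
Local Notation R := (creal M).
Local Notation C := (cnum M).
Local Notation S := (sphere C).
Implicit Types (x y z : S) (u v a b c d : C).

Lemma hnorm1_gt0 u : 0 < hnorm u 1.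
Proof. by rewrite hnorm_gt0 oner_neq0 orbT. Qed.

Lemma hnorm1_le u : hnorm u 1 <= cabs u + 1.
Proof. by have := hnorm_le u 1; rewrite cabs1. Qed.

Lemma cdist_finite u v :
  cdist (Some u) (Some v) = 2 * cabs (u - v) / (hnorm u 1 * hnorm v 1).
Proof. by rewrite /cdist /= !mulr1. Qed.

(** The chordal distance induces the topology of the one-point compactification. At a finite z, with
    B = |z| + 1 and t = |u - z|, the distance is at least 2t / ((t + B) B), which increases with t,
    so a small distance makes t small. At infinity, complements of compact sets are compared with
    complements of discs. *)
Lemma nbhs_cdistP z (A : set S) :
  nbhs z A <-> exists2 e : R, 0 < e & forall w, cdist w z < e -> A w.
Proof.
split; case: z => [z|].
- move=> /nbhs_cabsP[e e0 eA].
  pose B := cabs z + 1.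
  have B0 : 0 < B by rewrite /B; have := cabs_ge0 z; lra.
  have eB : 0 < (e + B) * B by rewrite mulr_gt0 // addr_gt0.
  have zB : hnorm z 1 <= B := hnorm1_le z.
  exists (2 * e / ((e + B) * B)); first by rewrite divr_gt0 // mulr_gt0.
  case=> [u|].
    rewrite cdist_finite => h; apply: eA; rewrite ltNge; apply/negP => eu.
    move: h; rewrite ltNge => /negP; apply.
    have uB : hnorm u 1 <= cabs (u - z) + B.
      have := hnorm1_le u; have := cabsD (u - z) z; rewrite subrK /B; lra.
    set t := cabs (u - z) in eu uB *.
    apply: (@le_trans _ _ (2 * t / ((t + B) * B))); last first.
      rewrite ler_wpM2l ?mulr_ge0 ?cabs_ge0 ?ler0n // lef_pV2 ?posrE //.
      - by apply: ler_pM; rewrite ?hnorm_ge0.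
      - by rewrite mulr_gt0 // addr_gt0 // (lt_le_trans e0).
      - by rewrite mulr_gt0 // hnorm1_gt0.
    rewrite ler_pdivrMr // mulrAC ler_pdivlMr; last first.
      by rewrite mulr_gt0 // addr_gt0 // (lt_le_trans e0).
    by rewrite -!mulrA ler_wpM2l ?ler0n //; have := ltW e0; nra.
  rewrite cdistC cdist_infty => h; exfalso; move: h; apply/negP; rewrite -leNgt.
  rewrite ler_pdivrMr // mulrAC ler_pdivlMr ?hnorm1_gt0 // -!mulrA ler_wpM2l ?ler0n //.
  apply: (@le_trans _ _ (e * B)); first by rewrite ler_wpM2l // ltW.
  by rewrite mulrDl lerDl mulr_ge0 ?ltW.
- move=> [K [cK _] KA]; have [r Kr] := compact_cabs_bounded cK.
  have r0 : 0 < `|r| + 1 by rewrite ltr_wpDl.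
  exists (2 / (`|r| + 1)); first by rewrite divr_gt0.
  case=> [u|] h; last by apply: KA; right.
  apply: KA; left; exists u => // Ku; move: h; apply/negP; rewrite -leNgt cdist_infty.
  rewrite ler_wpM2l ?ler0n // lef_pV2 ?posrE ?hnorm1_gt0 //.
  by apply: le_trans (hnorm1_le _) _; rewrite lerD2r (le_trans (Kr _ Ku)) // ler_norm.
- move=> [e e0 eA]; apply/nbhs_cabsP; exists (e / 2); first by rewrite divr_gt0.
  by move=> u uz; apply: eA; apply: le_lt_trans (cdist_le _ _) _; lra.
- move=> [e e0 eA]; exists [set u | cabs (u - 0) <= 2 / e].
    by split; [exact: compact_disc|exact: closed_disc].
  move=> w [[u /= /negP h <-]|->]; last by apply: eA; rewrite cdistxx.
  apply: eA; rewrite cdist_infty; move: h; rewrite -ltNge subr0 => h.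
  rewrite ltr_pdivrMr ?hnorm1_gt0 //; move: h; rewrite ltr_pdivrMr // => h.
  by have := cabs_le_hnorm u 1; nra.
Qed.

(** A Lipschitz bound gives continuity and also preserves uniform convergence, so it is the form in
    which normality is transported below. *)
Definition chordal_lipschitz (f : S -> S) :=
  exists2 L : R, 0 < L & forall x y, cdist (f x) (f y) <= L * cdist x y.

Lemma chordal_lipschitz_continuous f : chordal_lipschitz f -> continuous f.
Proof.
move=> [L L0 fL] x A /nbhs_cdistP[e e0 eA]; apply/nbhs_cdistP.
exists (e / L); first by rewrite divr_gt0.
move=> w; rewrite ltr_pdivlMr // mulrC => wx; apply: eA.
exact: le_lt_trans (fL _ _) wx.
Qed.

Lemma chordal_lipschitz_comp f g :
  chordal_lipschitz f -> chordal_lipschitz g -> chordal_lipschitz (f \o g).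
Proof.
move=> [L L0 fL] [K K0 gK]; exists (L * K); first by rewrite mulr_gt0.
move=> x y; apply: le_trans (fL _ _) _; rewrite -mulrA ler_wpM2l ?gK //; exact: ltW.
Qed.

Lemma chordal_lipschitz_iter f k : chordal_lipschitz f -> chordal_lipschitz (iter k f).
Proof.
move=> fL; elim: k => [|k IH]; first by exists 1 => // x y; rewrite mul1r.
exact: chordal_lipschitz_comp fL IH.
Qed.

Lemma hnorm_linear_le a b c d u v :
  hnorm (a * u + b * v) (c * u + d * v) <=
  (cabs a + cabs b + cabs c + cabs d) * hnorm u v.
Proof.
apply: le_trans (hnorm_le _ _) _.
have h1 := cabsD (a * u) (b * v); have h2 := cabsD (c * u) (d * v).
rewrite !cabsM in h1 h2.
have := cabs_le_hnorm u v; have := cabs_le_hnormr u v.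
have := cabs_ge0 a; have := cabs_ge0 b; have := cabs_ge0 c; have := cabs_ge0 d.
move: h1 h2; nra.
Qed.

(** The wedge product is multiplied by the determinant, while the adjugate matrix bounds the norm of
    a vector by K / |ad - bc| times the norm of its image. The two norms in the distance give
    K^2. *)
Lemma mob_lipschitz a b c d : a * d - b * c != 0 -> chordal_lipschitz (mob a b c d).
Proof.
move=> D; pose K := cabs d + cabs (- b) + cabs (- c) + cabs a.
have D0 : 0 < cabs (a * d - b * c) by rewrite cabs_gt0.
have K1 u v : cabs (a * d - b * c) * hnorm u v <=
    K * hnorm (a * u + b * v) (c * u + d * v).
  rewrite -hnormZ; apply: le_trans (hnorm_linear_le _ _ _ _ _ _).
  by rewrite le_eqVlt; apply/orP; left; apply/eqP; congr hnorm; ring.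
have K0 : 0 < K.
  have := K1 1 0; have : 0 < hnorm (1 : C) 0 by rewrite hnorm_gt0 oner_neq0.
  move=> h2 h3; rewrite lt_def; apply/andP; split.
    by apply: contraTneq h3 => ->; rewrite mul0r -ltNge mulr_gt0.
  by rewrite /K !addr_ge0 ?cabs_ge0.
exists (K ^+ 2 / cabs (a * d - b * c)); first by rewrite divr_gt0 // exprn_gt0.
move=> x y; rewrite !mobE // cdist_hpt ?det_neq0 ?hcoords_neq0 // /cdist.
have := K1 (hx x) (hy x); have := K1 (hx y) (hy y).
have : 0 < hnorm (a * hx x + b * hy x) (c * hx x + d * hy x).
  by rewrite hnorm_gt0 det_neq0 // hcoords_neq0.
have : 0 < hnorm (a * hx y + b * hy y) (c * hx y + d * hy y).
  by rewrite hnorm_gt0 det_neq0 // hcoords_neq0.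
have -> : (a * hx x + b * hy x) * (c * hx y + d * hy y) -
   (a * hx y + b * hy y) * (c * hx x + d * hy x) =
   (a * d - b * c) * (hx x * hy y - hx y * hy x) by ring.
rewrite cabsM; have := cabs_ge0 (hx x * hy y - hx y * hy x).
have := hnorm_coords x; have := hnorm_coords y; move: D0 K0.
move: (cabs (a * d - b * c)) (cabs (hx x * hy y - _)) K {K1}.
move: (hnorm (hx x) (hy x)) (hnorm (hx y) (hy y)).
move: (hnorm (a * hx x + _) _) (hnorm (a * hx y + _) _) => p q p' q' e w K.
move=> e0 K0 q'0 p'0 w0 q0 p0 h1 h2.
have -> : K ^+ 2 / e * (2 * w / (p' * q')) = 2 * w * K ^+ 2 / (e * (p' * q')).
  by field; rewrite !gt_eqF.
rewrite ler_pdivrMr ?mulr_gt0 // mulrAC ler_pdivlMr ?mulr_gt0 //.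
have : (e * p') * (e * q') <= (K * p) * (K * q) by apply: ler_pM; rewrite // mulr_ge0 ?ltW.
have w2 : 0 <= 2 * w by rewrite mulr_ge0.
by move=> h; have := ler_wpM2l w2 h; lra.
Qed.

(** The norm is at most twice the larger of the two moduli. *)
Lemma hnorm_expn n u v : hnorm u v ^+ n <= 2 ^+ n * hnorm (u ^+ n) (v ^+ n).
Proof.
have h0 := hnorm_ge0 u v.
wlog vu : u v h0 / cabs v <= cabs u => [hw|].
  case: (lerP (cabs v) (cabs u)) => [|/ltW] vu; first exact: hw.
  by rewrite hnormC [hnorm (u ^+ n) _]hnormC; apply: hw => //; rewrite hnormC.
apply: (@le_trans _ _ ((2 * cabs u) ^+ n)).
  rewrite lerXn2r ?nnegrE ?mulr_ge0 ?cabs_ge0 //.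
  by apply: le_trans (hnorm_le _ _) _; lra.
by rewrite exprMn ler_wpM2l ?exprn_ge0 ?ler0n // -cabsX cabs_le_hnorm.
Qed.

(** The wedge product of the powers is a difference of n-th powers of x1 y2 and y1 x2, both at most
    the product of the norms, so [cabs_powB] applies. The factor 4^n comes from two uses of
    [hnorm_expn]. *)
Lemma power_lipschitz n : (0 < n)%N ->
  chordal_lipschitz (fun z => hpt (hx z ^+ n) (hy z ^+ n)).
Proof.
move=> n0; exists (n%:R * 4 ^+ n); first by rewrite mulr_gt0 ?exprn_gt0 ?ltr0n.
move=> x y; rewrite cdist_hpt ?expn_neq0 ?hcoords_neq0 // /cdist.
have := hnorm_expn n (hx x) (hy x); have := hnorm_expn n (hx y) (hy y).
have : 0 < hnorm (hx x ^+ n) (hy x ^+ n) by rewrite hnorm_gt0 expn_neq0 ?hcoords_neq0.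
have : 0 < hnorm (hx y ^+ n) (hy y ^+ n) by rewrite hnorm_gt0 expn_neq0 ?hcoords_neq0.
have : cabs (hx x ^+ n * hy y ^+ n - hx y ^+ n * hy x ^+ n) <=
    n%:R * (hnorm (hx x) (hy x) * hnorm (hx y) (hy y)) ^+ n.-1 *
    cabs (hx x * hy y - hx y * hy x).
  rewrite -!exprMn; apply: cabs_powB; rewrite cabsM.
    by rewrite ler_pM ?cabs_ge0 ?cabs_le_hnorm ?cabs_le_hnormr.
  by rewrite mulrC ler_pM ?cabs_ge0 ?cabs_le_hnorm ?cabs_le_hnormr.
have := hnorm_coords x; have := hnorm_coords y.
have := cabs_ge0 (hx x * hy y - hx y * hy x).
move: (cabs (hx x * _ - _)) (cabs (hx x ^+ n * _ - _)).
move: (hnorm (hx x) (hy x)) (hnorm (hx y) (hy y)).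
move: (hnorm (hx x ^+ n) _) (hnorm (hx y ^+ n) _) => p' q' p q w wn.
move=> w0 q0 p0 h q'0 p'0 hq hp.
rewrite ler_pdivrMr ?mulr_gt0 //.
have -> : n%:R * 4 ^+ n * (2 * w / (p * q)) * (p' * q') =
   2 * n%:R * w / (p * q) * ((2 ^+ n * p') * (2 ^+ n * q')).
  by rewrite (_ : 4 = 2 * 2 :> R) ?exprMn; [ring|rewrite -natrM].
apply: (@le_trans _ _ (2 * n%:R * w / (p * q) * (p ^+ n * q ^+ n))).
  have -> : 2 * n%:R * w / (p * q) * (p ^+ n * q ^+ n) = 2 * (n%:R * (p * q) ^+ n.-1 * w).
    by rewrite -exprMn -[n in X in _ * X = _](prednK n0) exprS; field; rewrite !gt_eqF.
  by rewrite ler_wpM2l.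
rewrite ler_wpM2l //; first by rewrite divr_ge0 ?mulr_ge0 ?(ltW p0) ?(ltW q0) ?ler0n.
by rewrite ler_pM // exprn_ge0 // ltW.
Qed.

Lemma normal_form_lipschitz n a b c d : (0 < n)%N -> a * d - b * c != 0 ->
  chordal_lipschitz (normal_form n a b c d).
Proof.
move=> n0 D.
have -> : normal_form n a b c d = mob a b c d \o (fun z => hpt (hx z ^+ n) (hy z ^+ n)).
  apply/funext => z; rewrite /= normal_formE // mob_hpt //.
  by rewrite expn_neq0 // hcoords_neq0.
exact: chordal_lipschitz_comp (mob_lipschitz D) (power_lipschitz n0).
Qed.

End ChordalMetric.

(** * Conjugacy and its effect on Fatou and Julia sets *)

Section Conjugacy.
Variable M : complex_model.
Local Notation C := (cnum M).
Local Notation S := (sphere C).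
Implicit Types (x y z : S) (u v a b c d : C) (f g h phi psi : S -> S).

Lemma conjugate_mob f g a b c d : a * d - b * c != 0 ->
  g \o mob a b c d = mob a b c d \o f -> conjugate f g.
Proof.
by move=> D e; exists (mob a b c d) => //; apply/rational_map1P; exists a, b, c, d.
Qed.

Lemma conjugate_refl f : conjugate f f.
Proof.
apply: (@conjugate_mob f f 1 0 0 1); last by rewrite mob_id.
by rewrite mulr1 mul0r subr0 oner_neq0.
Qed.

Lemma conjugate_sym f g : conjugate f g -> conjugate g f.
Proof.
move=> [_ /rational_map1P[a [b [c [d [D ->]]]]] e].
have [D' K1 K2] := mobVK D.
apply: (conjugate_mob D'); apply/funext => z.
have /(congr1 (fun k => k (mob d (- b) (- c) a z))) /= := e.
rewrite -[mob a b c d _]/((mob a b c d \o mob d (- b) (- c) a) z) K2 => ->.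
by rewrite -[LHS]/(id _) -K1.
Qed.

Lemma conjugate_trans f g h : conjugate f g -> conjugate g h -> conjugate f h.
Proof.
move=> [_ /rational_map1P[a [b [c [d [D ->]]]]] e].
move=> [_ /rational_map1P[a' [b' [c' [d' [D' ->]]]]] e'].
have [D'' E] := mob_comp D' D; apply: (conjugate_mob D''); rewrite -E.
by rewrite compA e' -compA e.
Qed.

Lemma conjugate_iter f g phi k : g \o phi = phi \o f ->
  iter k g \o phi = phi \o iter k f.
Proof.
move=> e; apply/funext => z /=; elim: k => //= k ->.
exact: (congr1 (fun F => F (iter k f z)) e).
Qed.

(** A sequence of iterates of g is phi composed with iterates of f composed with psi. The limit l
    for f gives phi o l o psi, and the Lipschitz constant of phi keeps the convergence uniform on
    compact sets. *)
Lemma fatou_conjugate f g phi psi : chordal_lipschitz phi -> chordal_lipschitz psi ->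
  psi \o phi = id -> phi \o psi = id -> g \o phi = phi \o f ->
  forall z, fatou_set f z -> fatou_set g (phi z).
Proof.
move=> Lphi Lpsi K1 K2 e z [U [oU Uz nU]].
have k1 x : psi (phi x) = x by exact: (congr1 (fun F => F x) K1).
have k2 x : phi (psi x) = x by exact: (congr1 (fun F => F x) K2).
exists (psi @^-1` U); split; last 1 first.
- move=> u hu; have uN k : exists m, u k = iter m g.
    by have [m _ <-] := hu k; exists m.
  have [m um] := choice uN.
  have [k|v [l [hv hl]]] := nU (fun k => iter (m k) f); first by exists (m k).
  exists v, (phi \o l \o psi); split=> // K cK KU e' /cgt0_real[eps eps0 ->].
  have [L L0 phiL] := Lphi.
  have cK' : compact (psi @` K).
    apply: continuous_compact cK; apply: continuous_subspaceT.
    exact: chordal_lipschitz_continuous.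
  have K'U : psi @` K `<=` U by move=> _ [x Kx <-]; exact: KU.
  have eL : 0 < ofR (eps / L) :> C by rewrite ofR_gt0 divr_gt0.
  have := hl _ cK' K'U _ eL; apply: filterS => k hk x Kx /=.
  have := hk (psi x) (imageP _ Kx); rewrite !chord_lt ltr_pdivlMr // mulrC => hk'.
  rewrite um -[in iter _ _ x](k2 x) -[iter _ _ _]/((iter (m (v k)) g \o phi) (psi x)).
  by rewrite (conjugate_iter _ e); apply: le_lt_trans (phiL _ _) hk'.
- have cpsi := chordal_lipschitz_continuous Lpsi.
  by move/continuousP : cpsi; apply.
- by rewrite /= k1.
Qed.

Lemma julia_conjugate f g : conjugate f g ->
  exists2 phi, chordal_lipschitz phi & julia_set g = phi @` julia_set f.
Proof.
move=> [_ /rational_map1P[a [b [c [d [D ->]]]]] e].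
have [D' K1 K2] := mobVK D.
have L1 := mob_lipschitz D; have L2 := mob_lipschitz D'.
exists (mob a b c d) => //.
have k1 x : mob d (- b) (- c) a (mob a b c d x) = x by exact: (congr1 (fun F => F x) K1).
have k2 x : mob a b c d (mob d (- b) (- c) a x) = x by exact: (congr1 (fun F => F x) K2).
have e' : f \o mob d (- b) (- c) a = mob d (- b) (- c) a \o g.
  apply/funext => z /=; have /(congr1 (fun F => F (mob d (- b) (- c) a z))) /= := e.
  by rewrite k2 => ->; rewrite k1.
apply/seteqP; split=> [x Jx|_ [x Jx <-]].
  exists (mob d (- b) (- c) a x) => //; apply: contra_not Jx => Fx.
  by rewrite -(k2 x); exact: (fatou_conjugate L1 L2 K1 K2 e).
by apply: contra_not Jx => Fx; rewrite -(k1 x); exact: (fatou_conjugate L2 L1 K2 K1 e').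
Qed.

Lemma julia_connected_conjugate f g : conjugate f g ->
  connected (julia_set f) -> connected (julia_set g).
Proof.
move=> /julia_conjugate[phi Lphi ->] cJ; apply: connected_continuous_connected cJ _.
exact/continuous_subspaceT/chordal_lipschitz_continuous.
Qed.

End Conjugacy.

(** * Disconnected Julia sets *)

Section Contractions.
Variable M : complex_model.
Local Notation R := (creal M).
Local Notation C := (cnum M).
Local Notation S := (sphere C).
Implicit Types (x y z : S) (u v a d : C) (f g : S -> S) (h : C -> C).

Lemma half_pow_small (eps B : R) : 0 < eps ->
  exists N, forall m, (N <= m)%N -> 2^-1 ^+ m * B < eps.
Proof.
move=> e0; have := @cvg_geometric R `|B| 2^-1.
rewrite gtr0_norm ?invr_gt0 // invf_lt1 // ltr1n => /(_ isT) /cvgr0Pnorm_lt /(_ eps e0).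
move=> [N _ hN]; exists N => m /hN /=; rewrite normrM normr_id ger0_norm ?exprn_ge0 ?invr_ge0 // => h.
by apply: le_lt_trans h; rewrite mulrC ler_wpM2r ?exprn_ge0 ?invr_ge0 // ler_norm.
Qed.

Section ContractionOn.
Variables (X : set C) (h : C -> C).
Hypothesis hX : forall u, X u -> X (h u).
Hypothesis hhalf : forall u v, X u -> X v -> cabs (h u - h v) <= 2^-1 * cabs (u - v).

Lemma iter_stable u k : X u -> X (iter k h u).
Proof. by move=> Xu; elim: k => //= k; exact: hX. Qed.

Lemma iter_half u v k : X u -> X v ->
  cabs (iter k h u - iter k h v) <= 2^-1 ^+ k * cabs (u - v).
Proof.
move=> Xu Xv; elim: k => [|k IH]; first by rewrite expr0 mul1r.
rewrite exprS -mulrA; apply: le_trans (hhalf _ _) _; try exact: iter_stable.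
by rewrite ler_wpM2l // invr_ge0.
Qed.

(** Banach's theorem by compactness: with d = |h(u) - u| the orbit stays in the disc of radius 2d
    about u, and a cluster point is fixed because the k-th step has length at most 2^-k d. *)
Lemma contraction_fixpoint u : X u -> closed X -> exists2 p, X p & h p = p.
Proof.
move=> Xu cX; pose d := cabs (h u - u).
have d0 : 0 <= d by exact: cabs_ge0.
have step k : cabs (iter k.+1 h u - iter k h u) <= 2^-1 ^+ k * d.
  by rewrite iterSr; apply: iter_half => //; exact: hX.
have bnd k : cabs (iter k h u - u) <= 2 * d * (1 - 2^-1 ^+ k).
  elim: k => [|k IH]; first by rewrite /= subrr cabs0 expr0 subrr mulr0.
  have := cabsD (iter k.+1 h u - iter k h u) (iter k h u - u).
  rewrite addrA subrK => H; apply: le_trans H _; move: (step k) IH; rewrite exprS; lra.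
pose D := [set v | cabs (v - u) <= 2 * d].
have DI k : D (iter k h u).
  rewrite /D /=; apply: le_trans (bnd k) _.
  have : 0 <= (2^-1 : R) ^+ k by rewrite exprn_ge0 // invr_ge0.
  by move: (2^-1 ^+ k) => t t0; nra.
have cF := @compact_disc M u (2 * d) ((fun k => iter k h u) @ \oo) _.
have [|p [Dp clp]] := cF; first by exists 0%N => // k _; exact: DI.
have near_p (eps : R) N : 0 < eps -> exists2 k, (N <= k)%N & cabs (iter k h u - p) < eps.
  move=> e0.
  have [||v [[k /= Nk kv] /= ve]] := clp (range (fun k => iter (N + k) h u)) [set v | cabs (v - p) < eps].
  - exists N => // k /= Nk; exists (k - N)%N => //; by rewrite subnKC.
  - by apply/nbhs_cabsP; exists eps.
  - by exists (N + k)%N; rewrite ?leq_addr // kv.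
have Xp : X p.
  apply: cX => B /nbhs_cabsP[eps e0 eB]; have [k _ kp] := near_p _ 0%N e0.
  by exists (iter k h u); split; [exact: iter_stable|exact: eB].
exists p => //; apply/eqP; rewrite -subr_eq0 -cabs_eq0 eq_le cabs_ge0 andbT.
apply/ler_addgt0Pl => eps e0; rewrite addr0.
have e3 : 0 < eps / 3 by rewrite divr_gt0.
have [N hN] := half_pow_small d e3.
have [k /hN Nk kp] := near_p _ N e3.
have h1 := hhalf Xp (iter_stable k Xu); have h2 := step k.
rewrite (cabsB p) in h1.
have -> : h p - p = (h p - h (iter k h u)) + (iter k.+1 h u - iter k h u) + (iter k h u - p).
  by rewrite /=; ring.
have h3 := cabsD (h p - h (iter k h u) + (iter k.+1 h u - iter k h u)) (iter k h u - p).
have h4 := cabsD (h p - h (iter k h u)) (iter k.+1 h u - iter k h u).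
lra.
Qed.

End ContractionOn.

Lemma homo_ltn_leq (v : nat -> nat) : {homo v : i j / (i < j)%N} -> forall k, (k <= v k)%N.
Proof.
by move=> hv; elim=> // k IH; apply: leq_ltn_trans IH (hv _ _ (ltnSn k)).
Qed.

Lemma cdist_half_pow p u k (d : R) : cabs (u - p) <= 2^-1 ^+ k * d ->
  cdist (Some u) (Some p) <= 2^-1 ^+ k * (2 * d).
Proof. by move=> h; apply: le_trans (cdist_le _ _) _; lra. Qed.

(* [h] is a contracting inverse branch of [f]: all iterates of [f] map a       *)
(* neighbourhood of [p] shrinking to [p] onto sets containing both [p] and [y]. *)
Lemma repelling_julia f (X : set C) h p (y : C) : chordal_lipschitz f ->
  (forall u, X u -> X (h u)) ->
  (forall u v, X u -> X v -> cabs (h u - h v) <= 2^-1 * cabs (u - v)) ->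
  (forall u, X u -> f (Some (h u)) = Some u) ->
  X p -> h p = p -> X y -> y != p -> julia_set f (Some p).
Proof.
move=> fL hX hh fh Xp hp Xy yp [U [oU Up nU]].
have [k|v [g [hv hg]]] := nU (fun k => iter k f); first by exists k.
have hk k : iter k f (Some (iter k h y)) = Some y.
  elim: k => //= k IH; rewrite -iterS iterSr fh //; exact: iter_stable.
have pk k : iter k f (Some p) = Some p.
  by elim: k => //= k ->; rewrite -[in LHS]hp fh.
have hpk k : iter k h p = p by elim: k => //= k ->.
have near_p k : cabs (iter k h y - p) <= 2^-1 ^+ k * cabs (y - p).
  by have := iter_half hX hh k Xy Xp; rewrite hpk.
have [r r0 rU] : exists2 r : R, 0 < r & forall u, cabs (u - p) < r -> U (Some u).
  have /nbhs_cabsP : nbhs p (Some @^-1` U) by exact: (open_nbhs_nbhs (conj oU Up)).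
  by [].
pose K := Some @` [set u | cabs (u - p) <= r / 2] : set S.
have cK : compact K.
  apply: continuous_compact; last exact: compact_disc.
  exact/continuous_subspaceT/one_point_compactification_some_continuous.
have KU : K `<=` U by move=> _ [u /= up <-]; apply: rU; lra.
pose d := cdist (Some y) (Some p).
have d0 : 0 < d.
  rewrite lt_def cdist_ge0 andbT; apply: contra_neq yp => /cdist_eq0 [].
  by [].
have e3 : 0 < ofR (d / 3) :> C by rewrite ofR_gt0 divr_gt0.
(* The value of the limit [g] at a point x near p is compared with two iterates. The exponent v k
   takes x to y. The exponent v N is fixed, hence so is its Lipschitz constant, and it leaves x near
   p. With tolerance d/3 this contradicts the distance d from y to p. *)
have [N _ hN] := hg K cK KU _ e3.
have [L L0 NL] := chordal_lipschitz_iter (v N) fL.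
have [N1 hN1] := half_pow_small (L * (2 * cabs (y - p))) (divr_gt0 d0 (ltr0n R 3)).
have [N2 hN2] := half_pow_small (cabs (y - p)) (divr_gt0 r0 (ltr0n R 2)).
pose k := (N + N1 + N2)%N.
have [kN kN1 kN2] : [/\ (N <= v k)%N, (N1 <= v k)%N & (N2 <= v k)%N].
  by have := homo_ltn_leq hv k; rewrite /k; split; lia.
pose x := Some (iter (v k) h y) : S.
have Kx : K x by exists (iter (v k) h y) => //=; apply: le_trans (near_p _) (ltW (hN2 _ kN2)).
have Nk : (N <= k)%N by rewrite /k; lia.
have := hN k Nk x Kx; rewrite hk chord_lt => a1.
have := hN N (leqnn N) x Kx; rewrite chord_lt cdistC => a2.
have a3 := NL x (Some p); rewrite pk in a3.
have a4 : L * cdist x (Some p) < d / 3.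
  apply: (le_lt_trans _ (hN1 _ kN1)); rewrite [leRHS]mulrCA ler_wpM2l ?(ltW L0) //.
  exact: cdist_half_pow (near_p _).
have t1 := cdist_triangle (g x) (Some y) (Some p).
have t2 := cdist_triangle (iter (v N) f x) (g x) (Some p).
move: t1; rewrite -/d; lra.
Qed.

(** Normality concerns arbitrary sequences of iterates, so their exponents either repeat one value
    infinitely often or tend to infinity. *)
Lemma subsequence_dichotomy (m : nat -> nat) :
  (exists (v : nat -> nat) j, {homo v : i j / (i < j)%N} /\ forall k, m (v k) = j) \/
  (forall N, \forall k \near \oo, (N <= m k)%N).
Proof.
have [[j hj]|nj] := pselect (exists j, forall N, exists2 k, (N <= k)%N & m k = j).
  left; have /choice[s hs] : forall N, exists k, (N <= k)%N /\ m k = j.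
    by move=> N; have [k] := hj N; exists k.
  pose v := fix v k := if k is k'.+1 then s (v k').+1 else s 0%N.
  exists v, j; split; last by case=> [|k] /=; exact: (hs _).2.
  apply: homo_ltn; first exact: ltn_trans.
  by move=> k /=; exact: (hs _).1.
right; elim=> [|N IH]; first by exists 0%N.
have /existsNP[N1 hN1] : ~ forall N1, exists2 k, (N1 <= k)%N & m k = N.
  by move=> h; apply: nj; exists N.
apply: filter_app IH; exists N1 => // k /= Nk; rewrite leq_eqVlt => /orP[/eqP e|//].
by exfalso; apply: hN1; exists k.
Qed.

(** Iterates converge uniformly to the attracting fixed point in the disc. The neighbourhood of z is
    the preimage of the open disc under f, so that z may be infinity. A sequence of exponents with a
    constant subsequence converges trivially. *)
Lemma attracting_fatou f (g : C -> C) w0 (r : R) z : chordal_lipschitz f ->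
  (forall u, cabs (u - w0) <= r -> f (Some u) = Some (g u)) ->
  (forall u, cabs (u - w0) <= r -> cabs (g u - w0) <= r) ->
  (forall u v, cabs (u - w0) <= r -> cabs (v - w0) <= r ->
    cabs (g u - g v) <= 2^-1 * cabs (u - v)) ->
  (exists2 u, f z = Some u & cabs (u - w0) < r) -> fatou_set f z.
Proof.
move=> fL fg gr gh [u0 fz u0r]; pose D := [set u | cabs (u - w0) <= r].
have cf := chordal_lipschitz_continuous fL.
have gX u : D u -> D (g u) by exact: gr.
have r0 : 0 < r by apply: le_lt_trans u0r; exact: cabs_ge0.
have [p Dp gp] : exists2 p, D p & g p = p.
  exact: (contraction_fixpoint gX gh (ltW u0r)) (@closed_disc M _ _).
have fk k u : D u -> iter k f (Some u) = Some (iter k g u).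
  by move=> Du; elim: k => //= k ->; rewrite fg //; exact: (iter_stable gX k Du).
exists (f @^-1` (Some @` [set u | cabs (u - w0) < r])); split.
- move/continuousP : cf; apply; apply: one_point_compactification_open_some.
  rewrite openE => u /= ur; apply/nbhs_cabsP; exists (r - cabs (u - w0)); first by rewrite subr_gt0.
  move=> v vu; have := cabsD (v - u) (u - w0); rewrite addrA subrK /=; lra.
- by exists u0.
- move=> s hs; have /choice[m sm] : forall k, exists m, s k = iter m f.
    by move=> k; have [m _ <-] := hs k; exists m.
  have [[v [j [hv mv]]]|minf] := subsequence_dichotomy m.
    exists v, (iter j f); split=> // K _ _ e e0; exists 0%N => // k _ x _.
    by rewrite sm mv chord_cdist cdistxx rmorph0.
  exists id, (fun=> Some p); split=> // K cK KU _ /cgt0_real[e e0 ->].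
  have [N hN] := half_pow_small (2 * (2 * r)) e0.
  apply: filterS (minf N.+1) => k mk x Kx; rewrite sm chord_lt.
  have [u /= ur fx] := KU x Kx.
  (* The first iterate brings x into the disc; only the remaining m k - 1 iterates contract. *)
  rewrite -(prednK (leq_trans (ltn0Sn N) mk)) iterSr -fx fk; last exact: ltW.
  apply: (le_lt_trans _ (hN (m k).-1 _)); last by rewrite -ltnS prednK // (leq_trans _ mk).
  have gpk i : iter i g p = p by elim: i => //= i ->.
  apply: cdist_half_pow; have := iter_half gX gh (m k).-1 (ltW ur : D u) Dp.
  rewrite gpk => /le_trans; apply.
  rewrite ler_wpM2l ?exprn_ge0 ?invr_ge0 //.
  have := cabsD (u - w0) (w0 - p); rewrite addrA subrK (cabsB w0) /=.
  by move: Dp; rewrite /D /=; lra.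
Qed.

End Contractions.

(** * Powers near points of modulus one *)

Section Roots.
Variable M : complex_model.
Local Notation R := (creal M).
Local Notation C := (cnum M).
Implicit Types (u v w x y : C).

(** On a disc of this radius about a point of modulus 1, the map z^n expands distances at least n/2
    times ([power_expand]). *)
Definition root_radius n : R := (n%:R * 4 ^+ n.+1)^-1.

Lemma root_radius_gt0 n : (0 < n)%N -> 0 < root_radius n.
Proof. by move=> n0; rewrite invr_gt0 mulr_gt0 ?exprn_gt0 ?ltr0n. Qed.

Lemma root_radius_le1 n : (0 < n)%N -> root_radius n <= 1.
Proof.
move=> n0; rewrite invf_le1 ?mulr_gt0 ?exprn_gt0 ?ltr0n //.
by rewrite -natrX -natrM ler1n muln_gt0 n0 expn_gt0.
Qed.

(** In the factorisation of x^n - y^n each of the n terms of the cofactor is within 1/2 of 1, so the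
    cofactor is within n/2 of n. *)
Lemma power_expand_at1 n x y : (0 < n)%N ->
  cabs (x - 1) <= root_radius n -> cabs (y - 1) <= root_radius n ->
  n%:R / 2 * cabs (x - y) <= cabs (x ^+ n - y ^+ n).
Proof.
move=> n0; have t1 := root_radius_le1 n0; have t0 := root_radius_gt0 n0.
have le2 u : cabs (u - 1) <= root_radius n -> cabs u <= 2.
  by have := cabs_sub_ge u 1; rewrite cabs1; lra.
have two_ge1 : 1 <= 2 :> R by rewrite ler1n.
have pow1 u i : (i < n)%N -> cabs (u - 1) <= root_radius n ->
    cabs (u ^+ i - 1) <= n%:R * 2 ^+ n * root_radius n.
  move=> ltin hu; rewrite -(expr1n _ i).
  apply: le_trans (@cabs_powB _ u 1 2 _ (le2 _ hu) _) _; first by rewrite cabs1.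
  apply: ler_pM; rewrite ?mulr_ge0 ?exprn_ge0 ?ler0n ?cabs_ge0 //.
  by rewrite ler_pM ?exprn_ge0 ?ler0n ?ler_nat 1?ltnW // ler_weXn2l // (leq_trans (leq_pred _)) // ltnW.
move=> hx hy.
have term i : (i < n)%N -> cabs (x ^+ (n.-1 - i) * y ^+ i - 1) <= 2^-1.
  move=> ltin.
  have -> : x ^+ (n.-1 - i) * y ^+ i - 1 = (x ^+ (n.-1 - i) - 1) * y ^+ i + (y ^+ i - 1) by ring.
  apply: le_trans (cabsD _ _) _; rewrite cabsM.
  have h1 := pow1 x (n.-1 - i)%N (leq_ltn_trans (leq_subr _ _) (ltac:(by rewrite prednK) : (n.-1 < n)%N)) hx.
  have h2 := pow1 y i ltin hy.
  have h3 : cabs (y ^+ i) <= 2 ^+ n.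
    rewrite cabsX; apply: (@le_trans _ _ (2 ^+ i)); last by rewrite ler_weXn2l // ltnW.
    by rewrite lerXn2r ?nnegrE ?cabs_ge0 ?le2.
  have n20 : 0 <= n%:R * 2 ^+ n * root_radius n.
    by rewrite !mulr_ge0 ?exprn_ge0 ?ler0n // ltW.
  have h4 := ler_pM (cabs_ge0 _) (cabs_ge0 _) h1 h3.
  apply: le_trans (lerD h4 h2) _.
  have n1 : n%:R != 0 :> R by rewrite pnatr_eq0 -lt0n.
  have p1 : 1 <= 2 ^+ n :> R by rewrite -natrX ler1n expn_gt0.
  have -> : n%:R * 2 ^+ n * root_radius n = (4 * 2 ^+ n)^-1.
    rewrite /root_radius (_ : 4 = 2 * 2) ?[in LHS]exprMn; last by rewrite -natrM.
    rewrite !exprS; field; rewrite n1 andbT; apply/eqP => h; lra.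
  rewrite -[X in _ + X]mulr1 -mulrDr mulrC ler_pdivrMr; last by lra.
  lra.
rewrite subrXX cabsM mulrC ler_wpM2l ?cabs_ge0 //.
have : cabs (\sum_(i < n) x ^+ (n.-1 - i) * y ^+ i - n%:R) <= n%:R / 2.
  have -> : \sum_(i < n) x ^+ (n.-1 - i) * y ^+ i - n%:R =
            \sum_(i < n) (x ^+ (n.-1 - i) * y ^+ i - 1).
    by rewrite sumrB sumr_const card_ord.
  apply: le_trans (cabs_sum _ _) _.
  apply: (@le_trans _ _ (\sum_(i < n) 2^-1)); first by apply: ler_sum => i _; apply: term.
  by rewrite sumr_const card_ord -[leLHS]mulr_natl.
have := cabs_sub_ge n%:R (\sum_(i < n) x ^+ (n.-1 - i) * y ^+ i).
by rewrite cabs_nat cabsB; lra.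
Qed.

Lemma cabs_unit n w : (0 < n)%N -> cabs (w ^+ n) = 1 -> cabs w = 1.
Proof.
by move=> n0; rewrite cabsX => /eqP; rewrite pexpr_eq1 ?cabs_ge0 // => /eqP.
Qed.

Lemma power_expand n w x y : (0 < n)%N -> cabs w = 1 ->
  cabs (x - w) <= root_radius n -> cabs (y - w) <= root_radius n ->
  n%:R / 2 * cabs (x - y) <= cabs (x ^+ n - y ^+ n).
Proof.
move=> n0 w1; have w0 : w != 0 by rewrite -cabs_eq0 w1 oner_neq0.
have E u : u = w * (u / w) by rewrite mulrCA divff // mulr1.
have D u : cabs (u - w) = cabs (u / w - 1).
  have -> : u - w = w * (u / w - 1) by rewrite mulrBr mulr1 -E.
  by rewrite cabsM w1 mul1r.
rewrite !D => hx hy; have := power_expand_at1 n0 hx hy.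
by rewrite -mulrBl !expr_div_n -mulrBl !cabsM !cabsV !cabsX w1 expr1n invr1 !mulr1.
Qed.

(** The distances from 1 to the n roots of X^n - (1 + s) have product |s| < t^n, so they cannot all
    exceed t. *)
Lemma root_near1 n s (t : R) : (0 < n)%N -> 0 <= t -> cabs s < t ^+ n ->
  exists2 r : C, r ^+ n = 1 + s & cabs (r - 1) <= t.
Proof.
move=> n0 t0 st; pose p := 'X^n - (1 + s)%:P : {poly C}.
have [r pr] := closed_field_poly_normal p.
have mp : lead_coef p = 1 by exact/eqP/monicXnsubC.
have sp : size p = n.+1 by rewrite size_XnsubC.
rewrite mp scale1r in pr.
have sr : size r = n.
  by apply: succn_inj; rewrite -sp pr size_prod_XsubC.
have [/hasP[w wr tw]|/hasPn h] := boolP (has (fun w => cabs (w - 1) <= t) r).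
  exists w => //; apply/eqP; rewrite -subr_eq0.
  have : root p w by rewrite pr root_prod_XsubC.
  by rewrite rootE /p !hornerE.
exfalso; have : p.[1] = - s by rewrite /p !hornerE expr1n; ring.
rewrite pr horner_prod => /(congr1 (@cabs M)); rewrite cabsN cabs_prod => e.
move: st; rewrite -e ltNge => /negP; apply.
rewrite -sr.
elim: r h {pr sr e} => [|w r IH] h; first by rewrite big_nil.
rewrite big_cons /= exprS; apply: ler_pM; rewrite ?exprn_ge0 //.
  have := h w (mem_head _ _); rewrite -ltNge !hornerE cabsB; exact: ltW.
by apply: IH => v vr; apply: h; rewrite inE vr orbT.
Qed.

(** A root z of 1 + X + ... + X^(n-1) is an n-th root of unity, and it differs from 1, where this
    polynomial takes the value n. *)
Lemma two_roots n : (2 <= n)%N ->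
  exists w1 w2 : C, [/\ w1 ^+ n = -1, w2 ^+ n = -1 & w1 != w2].
Proof.
move=> n2; have n0 : (0 < n)%N by exact: ltnW.
pose w : C := n.-root (-1); have wn : w ^+ n = -1 by exact: rootCK.
pose p := \poly_(i < n) (1 : C).
have sp : size p = n by rewrite size_poly_eq ?oner_neq0.
have /closed_rootP[z pz] : size p != 1%N by rewrite sp gtn_eqF.
have zn : z ^+ n = 1.
  apply/eqP; rewrite -subr_eq0 subrX1; apply/eqP.
  have -> : \sum_(i < n) z ^+ i = p.[z].
    by rewrite horner_poly; apply: eq_bigr => i _; rewrite mul1r.
  by rewrite (rootP pz) mulr0.
have z1 : z != 1.
  apply: contraTneq pz => ->; rewrite rootE horner_poly.
  under eq_bigr do rewrite expr1n mulr1.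
  by rewrite sumr_const card_ord pnatr_eq0 -lt0n.
have w0 : w != 0.
  apply/eqP => w0; move: wn; rewrite w0 expr0n gtn_eqF //= => /esym/eqP.
  by rewrite oppr_eq0 oner_eq0.
exists w, (w * z); split; rewrite ?exprMn ?wn ?zn ?mulr1 //.
by rewrite -subr_eq0 -{1}[w]mulr1 -mulrBr mulf_neq0 // subr_eq0 eq_sym.
Qed.

End Roots.

(** * A disconnected Julia set when k is small against |1 + e^n|^2 *)

Section Disconnected.
Variable M : complex_model.
Local Notation R := (creal M).
Local Notation C := (cnum M).
Local Notation S := (sphere C).
Implicit Types (u v w x y e d : C) (z : S).

(* [e] and [e - d] are the critical values of [z |-> e - d / (1 + z^n)]. *)
Definition cv_map n e d : S -> S := normal_form n e (e - d) 1 1.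

Lemma det_cv_map e d : e * 1 - (e - d) * 1 = d.
Proof. ring. Qed.

Lemma cv_map_finite n e d u : 1 + u ^+ n != 0 ->
  cv_map n e d (Some u) = Some (e - d / (1 + u ^+ n)).
Proof.
move=> h; rewrite /cv_map /normal_form /ratfun !(hornerD, hornerZ, hornerXn, hornerC) mul1r.
rewrite addrC in h; rewrite (negbTE h); congr Some.
by field; rewrite addrC h.
Qed.

Lemma cv_map_infty n e d : (0 < n)%N -> d != 0 -> cv_map n e d None = Some e.
Proof.
move=> n0 d0; have D : e * 1 - (e - d) * 1 != 0 by rewrite det_cv_map.
rewrite /cv_map normal_formE // /= expr1n expr0n gtn_eqF //= !mulr0 !addr0 !mulr1 /hpt.
by rewrite oner_eq0 divr1.
Qed.

Lemma cv_map_lipschitz n e d : (0 < n)%N -> d != 0 -> chordal_lipschitz (cv_map n e d).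
Proof. by move=> n0 d0; apply: normal_form_lipschitz; rewrite ?det_cv_map. Qed.

(** A Lipschitz constant of z^n on |z| <= 3, a disc containing the discs about e used below. *)
Definition disc_lip n : R := n%:R * 3 ^+ n.-1.
(** The expansion of z^n puts distinct n-th roots of -1 at distance more than three times this
    radius. *)
Definition sep_radius n : R := root_radius M n / 3.
(** Chosen so that [small_d] becomes 2|d| <= t^n r^2 (see [dr]), which serves the attracting disc
    and the inverse branches alike. *)
Definition cv_const n : R := 8 * disc_lip n ^+ 2 / sep_radius n ^+ n.

Section FixedParameters.
Variables (n : nat) (e d : C).
Hypotheses (n2 : (2 <= n)%N) (d0 : d != 0) (e2 : cabs e <= 2).
Hypothesis small_d : cv_const n * cabs d <= cabs (1 + e ^+ n) ^+ 2.

Let n0 : (0 < n)%N. Proof. exact: ltnW. Qed.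
Let L := disc_lip n.
Let t := sep_radius n.
Let T := cabs (1 + e ^+ n).
(** On the disc of radius r about e, z^n varies from e^n by at most L r = T/2, so |1 + z^n| stays at
    least T/2. *)
Let r := T / (2 * L).

Let t0 : 0 < t. Proof. by rewrite divr_gt0 // root_radius_gt0. Qed.
Let t1 : t <= 1 / 3.
Proof. by rewrite ler_wpM2r ?invr_ge0 // root_radius_le1. Qed.
Let tn0 : 0 < t ^+ n. Proof. exact: exprn_gt0. Qed.
Let tn1 : t ^+ n <= 1. Proof. by rewrite exprn_ile1 ?(ltW t0) // (le_trans t1) // ler_pdivrMr // mul1r ler1n. Qed.

Let p31 : 1 <= 3 ^+ n.-1 :> R. Proof. by rewrite -natrX ler1n expn_gt0. Qed.
Let L2 : 2 <= L.
Proof.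
have h : 2 <= n%:R :> R by rewrite ler_nat.
by rewrite /L /disc_lip -[leLHS]mulr1; apply: ler_pM.
Qed.

Let L0 : 0 < L. Proof. by apply: lt_le_trans L2. Qed.

Let dgt0 : 0 < cabs d. Proof. by rewrite cabs_gt0. Qed.

Let dT : 8 * L ^+ 2 * cabs d <= t ^+ n * T ^+ 2.
Proof.
move: small_d; rewrite /cv_const -/L -/t -/T mulrAC ler_pdivrMr //.
by rewrite [X in _ <= X]mulrC.
Qed.

Let T0 : 0 < T.
Proof.
rewrite lt_def cabs_ge0 andbT; apply: contraTneq dT => ->.
by rewrite expr0n /= mulr0 -ltNge (mulr_gt0 _ dgt0) // (mulr_gt0 _ (exprn_gt0 2 L0)).
Qed.

Let T2L : T <= 2 * L.
Proof.
have h1 : T <= 1 + 2 ^+ n.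
  apply: le_trans (cabsD _ _) _; rewrite cabs1 lerD2l cabsX lerXn2r ?nnegrE ?cabs_ge0 //.
have h2 : 2 ^+ n <= 2 * 3 ^+ n.-1 :> R.
  rewrite -[in leLHS](prednK n0) exprS ler_wpM2l ?ler0n // lerXn2r ?nnegrE ?ler0n //.
  by rewrite ler_nat.
have h3 : 2 <= n%:R :> R by rewrite ler_nat.
have h4 : 2 * 3 ^+ n.-1 <= n%:R * 3 ^+ n.-1 :> R.
  by rewrite ler_wpM2r // (le_trans _ p31).
by move: h1 h2 h4 p31; rewrite /L /disc_lip; lra.
Qed.

Let L20 : 0 < 2 * L. Proof. exact: (mulr_gt0 _ L0). Qed.
Let r0 : 0 < r. Proof. by rewrite divr_gt0. Qed.
Let r1 : r <= 1. Proof. by rewrite ler_pdivrMr ?L20 // mul1r. Qed.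
Let Tr : T = 2 * L * r. Proof. by rewrite /r mulrCA divff ?mulr1 // gt_eqF. Qed.

(* both powers of [T] in the hypothesis are used: [8 L^2 |d| <= 2 L T r t^n] *)
Let dr : 2 * cabs d <= t ^+ n * r ^+ 2.
Proof.
have h : 8 * L ^+ 2 * cabs d <= t ^+ n * (4 * L ^+ 2 * r ^+ 2).
  rewrite (_ : 4 * L ^+ 2 * r ^+ 2 = T ^+ 2); first exact: dT.
  by rewrite [in RHS]Tr; ring.
rewrite -(ler_pM2l (exprn_gt0 2 L0)); move: h.
by move: (L ^+ 2) (t ^+ n) (r ^+ 2) => p q s; lra.
Qed.

Let disc_cabs u : cabs (u - e) <= r -> cabs u <= 3.
Proof. by move=> h; have := cabs_sub_ge u e; move: e2 r1 h; lra. Qed.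

Let pow_lip u v : cabs u <= 3 -> cabs v <= 3 -> cabs (u ^+ n - v ^+ n) <= L * cabs (u - v).
Proof. exact: cabs_powB. Qed.

Let disc_den u : cabs (u - e) <= r -> T / 2 <= cabs (1 + u ^+ n).
Proof.
move=> h; have := pow_lip (disc_cabs h) (le_trans e2 _ : cabs e <= 3).
have -> : u ^+ n - e ^+ n = (1 + u ^+ n) - (1 + e ^+ n) by ring.
have := cabs_sub_ge (1 + e ^+ n) (1 + u ^+ n); rewrite cabsB -/T => h1 h2.
have h3 : L * cabs (u - e) <= L * r by rewrite ler_wpM2l // ltW.
have := h2 (ltac:(by rewrite ler_nat)); move: Tr h1 h3; lra.
Qed.

Let G u := e - d / (1 + u ^+ n).

Let G_disc u : cabs (u - e) <= r -> cabs (G u - e) < r.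
Proof.
move=> /disc_den h; have -> : G u - e = - (d / (1 + u ^+ n)) by rewrite /G; ring.
rewrite cabsN cabsM cabsV ltr_pdivrMr; last by apply: lt_le_trans h; rewrite divr_gt0.
apply: (@lt_le_trans _ _ (r * (T / 2))); last by rewrite ler_wpM2l // ltW.
have : t ^+ n * r ^+ 2 <= 1 * r ^+ 2 by rewrite ler_wpM2r ?sqr_ge0.
have : 0 < r ^+ 2 by rewrite exprn_gt0.
move: dr Tr L2; rewrite expr2; move: r0; nra.
Qed.

Let G_contr u v : cabs (u - e) <= r -> cabs (v - e) <= r ->
  cabs (G u - G v) <= 2^-1 * cabs (u - v).
Proof.
move=> hu hv; have du := disc_den hu; have dv := disc_den hv.
have T20 : 0 < T / 2 by rewrite divr_gt0.
have u0 : 0 < cabs (1 + u ^+ n) by apply: lt_le_trans du.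
have v0 : 0 < cabs (1 + v ^+ n) by apply: lt_le_trans dv.
have -> : G u - G v = d * (u ^+ n - v ^+ n) / ((1 + u ^+ n) * (1 + v ^+ n)).
  by rewrite /G; field; rewrite -!cabs_eq0 !gt_eqF.
rewrite !cabsM cabsV ler_pdivrMr ?cabsM ?mulr_gt0 //.
have h1 := pow_lip (disc_cabs hu) (disc_cabs hv).
have h2 : T / 2 * (T / 2) <= cabs (1 + u ^+ n) * cabs (1 + v ^+ n) by apply: ler_pM; rewrite // ltW.
apply: (@le_trans _ _ (cabs d * (L * cabs (u - v)))); first by rewrite ler_wpM2l ?cabs_ge0.
apply: (@le_trans _ _ (2^-1 * cabs (u - v) * (T / 2 * (T / 2)))); last first.
  by rewrite ler_wpM2l // mulr_ge0 ?cabs_ge0 // invr_ge0.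
have -> : cabs d * (L * cabs (u - v)) = (cabs d * L) * cabs (u - v) by ring.
have -> : 2^-1 * cabs (u - v) * (T / 2 * (T / 2)) = (T ^+ 2 / 8) * cabs (u - v) by field.
rewrite ler_wpM2r ?cabs_ge0 // ler_pdivlMr //.
have h3 : t ^+ n * T ^+ 2 <= 1 * T ^+ 2 by rewrite ler_wpM2r ?sqr_ge0.
have h4 : L * cabs d <= L ^+ 2 * cabs d.
  by rewrite ler_wpM2r ?cabs_ge0 // expr2; move: L2 => l2; nra.
by move: dT; lra.
Qed.

Lemma cv_map_fatou z : (exists2 u, cv_map n e d z = Some u & cabs (u - e) < r) ->
  fatou_set (cv_map n e d) z.
Proof.
apply: (@attracting_fatou M (cv_map n e d) G e r) => //.
- exact: cv_map_lipschitz.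
- move=> u /disc_den h; rewrite cv_map_finite // -cabs_eq0 gt_eqF //.
  by apply: lt_le_trans h; rewrite divr_gt0.
- by move=> u /G_disc /ltW.
Qed.

(** Where |1 + u^n| >= t^n, the image is at distance at most |d| / t^n < r from e, that is, in the
    attracting disc; infinity goes to e itself. *)
Lemma cv_map_julia z : julia_set (cv_map n e d) z ->
  exists2 u, z = Some u & cabs (u ^+ n + 1) < t ^+ n.
Proof.
move=> Jz; case: z Jz => [u|] Jz; last first.
  exfalso; apply: Jz; apply: cv_map_fatou; exists e; first exact: cv_map_infty.
  by rewrite subrr cabs0.
exists u => //; rewrite ltNge; apply/negP => h; apply: Jz; apply: cv_map_fatou.
rewrite addrC in h; have q0 : 0 < cabs (1 + u ^+ n) by apply: lt_le_trans h.
exists (G u); first by rewrite cv_map_finite // -cabs_eq0 gt_eqF.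
have -> : G u - e = - (d / (1 + u ^+ n)) by rewrite /G; ring.
rewrite cabsN cabsM cabsV ltr_pdivrMr //.
apply: (@lt_le_trans _ _ (r * t ^+ n)); last by rewrite ler_wpM2l // ltW.
have : 0 < t ^+ n * r by rewrite mulr_gt0.
by move: dr; rewrite expr2; move: r1 dgt0; nra.
Qed.

(** Solving F(v) = u gives v^n = -(1 + d/(u - e)), and h(u) is a solution near w, chosen by
    [root_near1], for u outside the open disc of radius r about e. There |1 + h(u)^n| <= |d|/r <
    T/2, which a point of the disc cannot satisfy, so h preserves this set. It contracts because z^n
    does not shrink distances near w while d/(u - e) has Lipschitz constant |d|/r^2 <= 1/2. Its
    fixed point is in the Julia set by [repelling_julia]. *)
Lemma inverse_branch w : w ^+ n = -1 ->
  exists p, [/\ julia_set (cv_map n e d) (Some p) & cabs (p - w) <= t].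
Proof.
move=> wn; pose X := [set u | r <= cabs (u - e)].
have w1 : cabs w = 1 by apply: (cabs_unit n0); rewrite wn cabsN cabs1.
have s_small u : X u -> cabs (d / (u - e)) <= cabs d / r.
  move=> Xu; rewrite cabsM cabsV ler_wpM2l ?cabs_ge0 // lef_pV2 ?posrE //.
  exact: lt_le_trans Xu.
have dr1 : cabs d / r < t ^+ n.
  rewrite ltr_pdivrMr //; have : 0 < t ^+ n * r by rewrite mulr_gt0.
  by move: dr r1; rewrite expr2; nra.
have dr2 : cabs d / r < T / 2.
  rewrite ltr_pdivrMr //; have : t ^+ n * r ^+ 2 <= 1 * r ^+ 2 by rewrite ler_wpM2r ?sqr_ge0.
  have : 0 < r ^+ 2 by rewrite exprn_gt0.
  by move: dr Tr L2; rewrite expr2; move: r0; nra.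
have /choice[h hP] : forall u, exists v, X u ->
    v ^+ n = - (1 + d / (u - e)) /\ cabs (v - w) <= t.
  move=> u; have [Xu|nXu] := pselect (X u); last by exists 0.
  have [v vn v1] := root_near1 n0 (ltW t0) (le_lt_trans (s_small u Xu) dr1).
  exists (w * v) => _; rewrite exprMn wn vn mulN1r; split=> //.
  by rewrite -{2}[w]mulr1 -mulrBr cabsM w1 mul1r.
have h1 u : X u -> 1 + h u ^+ n = - (d / (u - e)).
  by move=> Xu; rewrite (hP u Xu).1; ring.
have h3 u : X u -> cabs (h u) <= 3.
  by move=> Xu; have := cabs_sub_ge (h u) w; have := (hP u Xu).2; rewrite w1; move: t1; lra.
have hX u : X u -> X (h u).
  move=> Xu; rewrite /X /= leNgt; apply/negP => /ltW /disc_den.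
  rewrite h1 // cabsN; apply/negP; rewrite -ltNge.
  exact: le_lt_trans (s_small u Xu) dr2.
have ue u : X u -> u - e != 0.
  by move=> Xu; rewrite -cabs_eq0 gt_eqF // (lt_le_trans r0).
have hc u v : X u -> X v -> cabs (h u - h v) <= 2^-1 * cabs (u - v).
  move=> Xu Xv.
  have tr : t <= root_radius M n by rewrite ler_pdivrMr // ler_peMr ?ler1n // ltW // root_radius_gt0.
  have := power_expand n0 w1 (le_trans (hP u Xu).2 tr) (le_trans (hP v Xv).2 tr).
  rewrite (hP u Xu).1 (hP v Xv).1.
  have -> : - (1 + d / (u - e)) - - (1 + d / (v - e)) = d * (u - v) / ((u - e) * (v - e)).
    by field; rewrite !ue.
  rewrite !cabsM cabsV cabsM => H.
  have q : r * r <= cabs (u - e) * cabs (v - e) by apply: ler_pM; rewrite // ltW.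
  have q0 : 0 < cabs (u - e) * cabs (v - e) by apply: lt_le_trans q; rewrite mulr_gt0.
  have H2 : cabs d * cabs (u - v) / (cabs (u - e) * cabs (v - e)) <= 2^-1 * cabs (u - v).
    rewrite ler_pdivrMr //.
    apply: (@le_trans _ _ (2^-1 * cabs (u - v) * (r * r))); last first.
      by rewrite ler_wpM2l // mulr_ge0 ?cabs_ge0 // invr_ge0.
    have -> : 2^-1 * cabs (u - v) * (r * r) = (2^-1 * r ^+ 2) * cabs (u - v) by ring.
    rewrite ler_wpM2r ?cabs_ge0 //.
    have : t ^+ n * r ^+ 2 <= 1 * r ^+ 2 by rewrite ler_wpM2r ?sqr_ge0.
    by move: dr; lra.
  apply: le_trans H2; apply: le_trans H.
  have n21 : 1 <= n%:R / 2 :> R by rewrite ler_pdivlMr // mul1r ler_nat.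
  by rewrite ler_peMl ?cabs_ge0.
have cX : closed X.
  move=> u clu; rewrite /X /=; apply/ler_addgt0Pl => eps eps0.
  have [|v [/= Xv vu]] := clu [set v | cabs (v - u) < eps].
    by apply/nbhs_cabsP; exists eps.
  by have := cabsD (v - u) (u - e); rewrite addrA subrK; move: Xv; rewrite /X /=; lra.
have Xe : X (e + ofR r) by rewrite /X /= addrAC subrr add0r cabs_real ger0_norm // (ltW r0).
(* A second point of X, in case e + r is the fixed point: [repelling_julia] asks for a point other
   than p. *)
have Xe2 : X (e + ofR (2 * r)).
  by rewrite /X /= addrAC subrr add0r cabs_real ger0_norm; move: r0; lra.
have [p Xp hp] := contraction_fixpoint hX hc Xe cX.
exists p; split; last by rewrite -hp; exact: (hP p Xp).2.
have [y Xy yp] : exists2 y, X y & y != p.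
  have [pe|] := eqVneq (e + ofR r) p; last by exists (e + ofR r).
  exists (e + ofR (2 * r)) => //; rewrite -pe (inj_eq (addrI _)) (inj_eq (@ofR_inj M)).
  by rewrite gt_eqF //; move: r0; lra.
apply: (repelling_julia (cv_map_lipschitz e n0 d0) hX hc _ Xp hp Xy yp).
move=> u Xu; have nz : d / (u - e) != 0 by rewrite mulf_neq0 ?invr_eq0 ?ue.
rewrite cv_map_finite h1 ?oppr_eq0 //; congr Some.
by field; rewrite d0 ue.
Qed.

(** No point of the Julia set lies on the circle of radius t about w: by expansion |u - w| <= |u^n +
    1| < t^n <= t. *)
Lemma near_root w u : w ^+ n = -1 -> cabs (u ^+ n + 1) < t ^+ n ->
  cabs (u - w) <= t -> cabs (u - w) < t.
Proof.
move=> wn un uw; have w1 : cabs w = 1 by apply: (cabs_unit n0); rewrite wn cabsN cabs1.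
have rr0 : 0 < root_radius M n by rewrite root_radius_gt0.
have tr : t <= root_radius M n by rewrite ler_pdivrMr // ler_peMr ?ler1n // ltW.
have := power_expand n0 w1 (le_trans uw tr) (_ : cabs (w - w) <= _).
rewrite subrr cabs0 wn opprK => /(_ (ltW rr0)) h.
apply: (@le_lt_trans _ _ (n%:R / 2 * cabs (u - w))).
  by rewrite ler_peMl ?cabs_ge0 // ler_pdivlMr // mul1r ler_nat.
apply: le_lt_trans h (lt_le_trans un _).
rewrite -[leRHS]expr1 ler_wiXn2l // ?(ltW t0) //; move: t1; lra.
Qed.

(** By [near_root] the open and the closed disc of radius t about w1 have the same trace on the
    Julia set, which is thus open and closed in it. This trace contains the fixed point near w1 and
    misses the one near w2. *)
Lemma cv_map_disconnected : ~ connected (julia_set (cv_map n e d)).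
Proof.
have [w1 [w2 [w1n w2n w12]]] := @two_roots M n n2.
have a1 : cabs w1 = 1 by apply: (cabs_unit n0); rewrite w1n cabsN cabs1.
have [p1 [J1 c1]] := inverse_branch w1n.
have [p2 [J2 c2]] := inverse_branch w2n.
have rr : root_radius M n = 3 * t by rewrite /t /sep_radius; field.
have rr0 : 0 < root_radius M n by rewrite root_radius_gt0.
have far : 3 * t < cabs (w2 - w1).
  rewrite -rr ltNge; apply/negP => h.
  have := power_expand n0 a1 h (_ : cabs (w1 - w1) <= _).
  rewrite subrr cabs0 w1n w2n subrr cabs0 => /(_ (ltW rr0)).
  rewrite leNgt mulr_gt0 ?divr_gt0 ?ltr0n //.
  by rewrite cabs_gt0 subr_eq0 eq_sym.
pose U := Some @` [set u | cabs (u - w1) < t] : set S.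
pose V := [set z | ~ (Some @` [set u | cabs (u - w1) <= t]) z] : set S.
have oU : open U.
  apply: one_point_compactification_open_some; rewrite openE => u /= ut.
  apply/nbhs_cabsP; exists (t - cabs (u - w1)); first by rewrite subr_gt0.
  by move=> v vu /=; have := cabsD (v - u) (u - w1); rewrite addrA subrK; lra.
have oV : open V.
  rewrite openE; case=> [u|] Vu.
    have ut : t < cabs (u - w1) by rewrite ltNge; apply/negP => h; apply: Vu; exists u.
    suff h : nbhs u [set v | t < cabs (v - w1)].
      by apply: filterS h => v /= vt [v' /= v't [vv]]; move: vt; rewrite -vv ltNge v't.
    apply/nbhs_cabsP; exists (cabs (u - w1) - t); first by rewrite subr_gt0.
    by move=> v vu /=; have := cabsD (u - v) (v - w1); rewrite addrA subrK (cabsB u); move: vu; lra.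
  exists [set u | cabs (u - w1) <= t]; first by split; [exact: compact_disc|exact: closed_disc].
  by move=> z [[u /= ut <-]|->] [v /= vt //] [vu]; apply: ut; rewrite -vu.
have pU : U (Some p1).
  have [_ [<-] h] := cv_map_julia J1; exists p1 => //=; exact: (near_root w1n h c1).
have npU : ~ U (Some p2).
  move=> [v /= vt [vp]]; have := cabsD (w2 - p2) (p2 - w1).
  by rewrite addrA subrK (cabsB w2) -vp; move: far vt c2; rewrite -vp; lra.
move=> /(_ (julia_set (cv_map n e d) `&` U)) cJ; apply: npU.
have [] // : (julia_set (cv_map n e d) `&` U) (Some p2).
rewrite cJ //; first by exists (Some p1).
- by exists U.
- exists (~` V); first by rewrite closedC.
  apply/seteqP; split=> z [Jz]; rewrite /V /= => h; split=> //.
    by apply; case: h => u /= ut <-; exists u => //=; exact: ltW.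
  move: h => /contrapT [u /= ut uz]; exists u => //=.
  move: Jz; rewrite -uz => /cv_map_julia[_ [<-] h]; exact: (near_root w1n h ut).
Qed.

End FixedParameters.
End Disconnected.

(** * Local forms and critical points *)

Section LocalAnalysis.
Variable M : complex_model.
Local Notation R := (creal M).
Local Notation C := (cnum M).
Implicit Types (u v w z l : C) (p q : {poly C}) (f g : C -> C).

Global Instance nbhsC_filter z : Filter (nbhs z).
Proof. exact: nbhs_filter. Qed.

Global Instance dnbhsC_filter z : ProperFilter z^'.
Proof. exact: Proper_dnbhs_numFieldType. Qed.

Lemma dnbhs_cabsP z (A : set C) :
  z^' A <-> exists2 e : R, 0 < e & forall w, w != z -> cabs (w - z) < e -> A w.
Proof.
split=> [/nbhs_cabsP[e e0 eA]|[e e0 eA]]; first by exists e => // w wz we; exact: eA.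
by apply/nbhs_cabsP; exists e => // w we wz; exact: eA.
Qed.

Lemma dnbhs_of_nbhs z (A : set C) : nbhs z A -> z^' A.
Proof. by move=> /nbhs_cabsP[e e0 eA]; apply/dnbhs_cabsP; exists e => // w _; exact: eA. Qed.

Lemma cvg_dnbhs f z l : f w @[w --> z] --> l -> f w @[w --> z^'] --> l.
Proof. by move=> h A /h; exact: dnbhs_of_nbhs. Qed.

Section CvgArith.
Variables (T : Type) (F : set_system T).
Context {FF : Filter F}.
Implicit Types (h k : T -> C) (a b : C).

Lemma cvgC_cst a : (fun=> a) @ F --> a.
Proof. exact: (@cvg_cst C a T F FF). Qed.

Lemma cvgCD h k a b : h @ F --> a -> k @ F --> b -> (fun t => h t + k t) @ F --> a + b.
Proof. exact: (@cvgD _ _ T F FF h k a b). Qed.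

Lemma cvgCB h k a b : h @ F --> a -> k @ F --> b -> (fun t => h t - k t) @ F --> a - b.
Proof. exact: (@cvgB _ _ T F FF h k a b). Qed.

Lemma cvgCM h k a b : h @ F --> a -> k @ F --> b -> (fun t => h t * k t) @ F --> a * b.
Proof. exact: (@cvgM _ T F FF h k a b). Qed.

Lemma cvgCV h a : a != 0 -> h @ F --> a -> (fun t => (h t)^-1) @ F --> a^-1.
Proof. exact: (@cvgV _ T F FF h a). Qed.

Lemma cvgCX h a n : h @ F --> a -> (fun t => h t ^+ n) @ F --> a ^+ n.
Proof.
move=> ha; elim: n => [|n IH]; first exact: cvgC_cst.
have -> : (fun t => h t ^+ n.+1) = (fun t => h t * h t ^+ n).
  by apply/funext => t; rewrite exprS.
by rewrite exprS; exact: cvgCM.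
Qed.

End CvgArith.

Definition evalp p : C -> C := fun w => p.[w].

Lemma cvg_poly p z : evalp p w @[w --> z] --> evalp p z.
Proof.
elim/poly_ind: p => [|p c IH].
  have -> : evalp 0 = (fun=> 0) by apply/funext => w; rewrite /evalp horner0.
  exact: cvgC_cst.
have -> : evalp (p * 'X + c%:P) = (fun w => evalp p w * w + c).
  by apply/funext => w; rewrite /evalp hornerMXaddC.
apply: cvgCD; last exact: cvgC_cst.
by apply: cvgCM; [exact: IH|by []].
Qed.

Lemma near_neq0 f z l : l != 0 -> f w @[w --> z] --> l -> \forall w \near z, f w != 0.
Proof.
move=> l0 fl; have : nbhs l [set w | cabs (w - l) < cabs l].
  by apply/nbhs_cabsP; exists (cabs l); rewrite ?cabs_gt0.
move=> /fl h; apply: (@filterS _ (nbhs z) _ _ _ _ h) => w /=; apply: contraTneq => ->.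
by rewrite sub0r cabsN ltxx.
Qed.

Lemma near_poly_neq0 p z : p.[z] != 0 -> \forall w \near z, p.[w] != 0.
Proof. by move=> pz; exact: (@near_neq0 (evalp p) z _ pz (@cvg_poly p z)). Qed.

Lemma derive1_cvg f z l : (f w - f z) / (w - z) @[w --> z^'] --> l -> (f^`())%classic z = l.
Proof.
move=> h; rewrite /derive1; apply: cvg_lim => //.
move=> A /h /dnbhs_cabsP[e e0 eA]; apply/dnbhs_cabsP; exists e => // k k0.
rewrite subr0 => ke; have kz : k + z != z by rewrite -subr_eq0 addrK.
have h1 := eA _ kz; rewrite addrK in h1; have h2 := h1 ke; rewrite /= addrK mulrC in h2.
exact: h2.
Qed.

Lemma poly_taylor1 p z :
  exists2 p1 : {poly C}, p = p1 * ('X - z%:P) + p.[z]%:P & p1.[z] = p^`().[z].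
Proof.
have /factor_theorem[p1 e] : root (p - p.[z]%:P) z by rewrite rootE !hornerE subrr.
exists p1; first by rewrite -e subrK.
have /(congr1 (fun q => q^`().[z])) := e.
by rewrite derivB derivC subr0 derivM derivXsubC !hornerE subrr mulr0 add0r.
Qed.

Lemma frac_ratio_cvg (u v : {poly C}) z f : v.[z] != 0 ->
  (forall w, v.[w] != 0 -> f w = u.[w] / v.[w]) ->
  (f w - f z) / (w - z) @[w --> z^'] -->
    (u^`().[z] * v.[z] - u.[z] * v^`().[z]) / v.[z] ^+ 2.
Proof.
move=> vz fE; have [u1 eu du] := poly_taylor1 u z; have [v1 ev dv] := poly_taylor1 v z.
have : (evalp u1 w * evalp v z - evalp u z * evalp v1 w) / (evalp v w * evalp v z) @[w --> z^'] -->
    (evalp u1 z * evalp v z - evalp u z * evalp v1 z) / (evalp v z * evalp v z).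
  apply: cvg_dnbhs; apply: cvgCM.
    by apply: cvgCB; apply: cvgCM; (exact: cvgC_cst || exact: cvg_poly).
  by apply: cvgCV; rewrite ?mulf_neq0 //; apply: cvgCM; (exact: cvgC_cst || exact: cvg_poly).
rewrite -du -dv expr2; apply: cvg_trans; apply: near_eq_cvg.
have /nbhs_cabsP[e e0 he] := near_poly_neq0 vz.
apply/dnbhs_cabsP; exists e => // w wz /he vw.
have Eu : u.[w] = u1.[w] * (w - z) + u.[z] by rewrite {1}eu !(hornerD, hornerM, hornerN, hornerC, hornerX).
have Ev : v.[w] = v1.[w] * (w - z) + v.[z] by rewrite {1}ev !(hornerD, hornerM, hornerN, hornerC, hornerX).
have wz0 : w - z != 0 by rewrite subr_eq0.
have K : u.[w] * v.[z] - u.[z] * v.[w] = (u1.[w] * v.[z] - u.[z] * v1.[w]) * (w - z).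
  by rewrite Eu Ev; ring.
rewrite /evalp !fE //.
have -> : u.[w] / v.[w] - u.[z] / v.[z] = (u.[w] * v.[z] - u.[z] * v.[w]) / (v.[w] * v.[z]).
  by field; rewrite vw vz.
by rewrite K mulrAC mulfK.
Qed.

Lemma frac_deriv (u v : {poly C}) z f : v.[z] != 0 ->
  (forall w, v.[w] != 0 -> f w = u.[w] / v.[w]) ->
  (f^`())%classic z = (u^`().[z] * v.[z] - u.[z] * v^`().[z]) / v.[z] ^+ 2.
Proof. by move=> vz fE; apply: derive1_cvg; exact: frac_ratio_cvg. Qed.

Lemma cvgC_unique z l l' f : f @ z^' --> l -> f @ z^' --> l' -> l = l'.
Proof.
move=> h h'; apply: (@cvg_unique C _ (f @ z^') _ l l') => //; exact: norm_hausdorff.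
Qed.

Lemma cvgC_near f g z l : (exists2 e : R, 0 < e & forall w, w != z -> cabs (w - z) < e ->
  f w = g w) -> f @ z^' --> l -> g @ z^' --> l.
Proof.
move=> [e e0 fg] h A /h /dnbhs_cabsP[e1 e10 h1]; apply/dnbhs_cabsP.
exists (Num.min e e1); first by rewrite lt_min e0.
by move=> w wz; rewrite lt_min => /andP[we we1]; rewrite /= -fg //; exact: h1.
Qed.

(** Uniqueness of the order of vanishing: for k different from m the ratio or its inverse tends to
    0. *)
Lemma pow_ratio_cvg z l k m : l != 0 ->
  (w - z) ^+ k / (w - z) ^+ m @[w --> z^'] --> l -> k = m.
Proof.
move=> l0 h.
have lim0 j : (0 < j)%N -> (w - z) ^+ j @[w --> z^'] --> (0 : C).
  move=> j0; apply: cvg_dnbhs; have -> : (0 : C) = (z - z) ^+ j.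
    by rewrite subrr expr0n gtn_eqF.
  by apply: cvgCX; apply: cvgCB; [|exact: cvgC_cst].
have [lt|lt|//] := ltngtP k m.
- exfalso; have h1 : (w - z) ^+ (m - k) @[w --> z^'] --> l^-1.
    apply: (cvgC_near _ (cvgCV l0 h)); exists 1; first exact: ltr01.
    move=> w wz _; rewrite invf_div -exprB ?(ltnW lt) //.
    by rewrite unitfE subr_eq0.
  have := cvgC_unique h1 (lim0 _ _); rewrite subn_gt0 => /(_ lt) /eqP.
  by rewrite invr_eq0 (negbTE l0).
- exfalso; have h1 : (w - z) ^+ (k - m) @[w --> z^'] --> l.
    apply: (cvgC_near _ h); exists 1; first exact: ltr01.
    by move=> w wz _; rewrite -exprB ?(ltnW lt) // unitfE subr_eq0.
  have := cvgC_unique h1 (lim0 _ _); rewrite subn_gt0 => /(_ lt) /eqP.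
  by rewrite (negbTE l0).
Qed.

End LocalAnalysis.

(** * Derivatives and critical points in local coordinates *)

Section LocalForms.
Variable M : complex_model.
Local Notation R := (creal M).
Local Notation C := (cnum M).
Local Notation S := (sphere C).
Implicit Types (u v w a b c d : C) (z : S) (p q P Q : {poly C}) (f : S -> S).

(** The numerator of the derivative of p/q. *)
Definition wronskian p q := p^`() * q - p * q^`().

Lemma sphere_paramK z w : sphere_coord z (sphere_param z w) = w.
Proof.
case: z => [z|] //=; have [->|w0] := eqVneq w 0; first by [].
by rewrite invrK.
Qed.

Lemma sphere_param_coord z : sphere_param z (sphere_coord z z) = z.
Proof. by case: z => [z|] //=; rewrite eqxx. Qed.

Lemma local_rep_hpt f z P Q :
  (forall w, f (sphere_param z w) = hpt P.[w] Q.[w]) ->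
  let z0 := sphere_coord z z in
  (Q.[z0] != 0 -> forall w, Q.[w] != 0 -> local_rep f z w = P.[w] / Q.[w]) /\
  (Q.[z0] = 0 -> forall w, P.[w] != 0 -> local_rep f z w = Q.[w] / P.[w]).
Proof.
move=> fE z0; have fz : f z = hpt P.[z0] Q.[z0] by rewrite -fE sphere_param_coord.
split=> [Qz w Qw|Qz w Pw]; rewrite /local_rep fE fz /hpt.
  by rewrite (negbTE Qz) (negbTE Qw).
rewrite Qz eqxx; have [->|Qw] := eqVneq Q.[w] 0; first by rewrite mul0r.
by rewrite /= invf_div.
Qed.

(** If the value at z is infinite, the coordinate 1/x turns P/Q into Q/P, which only changes the
    sign of the Wronskian. *)
Lemma local_deriv_hpt f z P Q :
  (forall w, f (sphere_param z w) = hpt P.[w] Q.[w]) ->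
  let z0 := sphere_coord z z in
  (P.[z0] != 0) || (Q.[z0] != 0) ->
  (local_deriv f z = 0 <-> (wronskian P Q).[z0] = 0).
Proof.
move=> fE z0; have [h1 h2] := local_rep_hpt fE.
have [Qz|Qz] := eqVneq Q.[z0] 0; rewrite ?orbF => PQ.
  rewrite /local_deriv (frac_deriv PQ (h2 Qz)) -/z0.
  rewrite /wronskian !(hornerD, hornerM, hornerN); split=> /eqP; rewrite ?mulf_eq0.
    rewrite invr_eq0 expf_eq0 /= (negbTE PQ) orbF Qz mul0r subr0 mulr0 sub0r.
    by move=> /eqP e; rewrite mulrC e oppr0.
  rewrite Qz mulr0 sub0r oppr_eq0 mul0r subr0 mulrC => /eqP ->.
  by rewrite mul0r.
rewrite /local_deriv (frac_deriv Qz (h1 Qz)) -/z0.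
rewrite /wronskian !(hornerD, hornerM, hornerN); split=> [/eqP|->]; last by rewrite mul0r.
by rewrite mulf_eq0 invr_eq0 expf_eq0 /= (negbTE Qz) orbF => /eqP.
Qed.

(** This is w^n p(1/w), for the coordinate w = 1/x at infinity. *)
Definition revpoly n p : {poly C} := \poly_(i < n.+1) p`_(n - i).

Lemma horner_revpoly n p w : (revpoly n p).[w] = hform n p 1 w.
Proof.
rewrite /revpoly horner_poly /hform (reindex_inj rev_ord_inj) /=.
apply: eq_bigr => i _; rewrite expr1n mulr1 subSS subKn // -ltnS //.
Qed.

Lemma ratfun_param_finite p q u w :
  ratfun p q (sphere_param (Some u) w) = hpt p.[w] q.[w].
Proof. by []. Qed.

Lemma ratfun_param_infty n p q w : (maxn (size p) (size q)).-1 = n ->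
  ratfun p q (sphere_param None w) = hpt (revpoly n p).[w] (revpoly n q).[w].
Proof.
move=> e; rewrite !horner_revpoly.
have -> : sphere_param None w = hpt 1 w by rewrite /hpt div1r.
have [k k0 [h1 h2]] : exists2 k, k != 0 & hx (hpt 1 w) = k * 1 /\ hy (hpt 1 w) = k * w.
  by apply: coords_hpt; rewrite oner_neq0.
by rewrite (ratfun_hpt _ e) h1 h2 !hformZ hptZ // expf_neq0.
Qed.

Lemma wronskian_XnC n a b c d :
  wronskian (a *: 'X^n + b%:P) (c *: 'X^n + d%:P) = (n%:R * (a * d - b * c)) *: 'X^(n.-1).
Proof.
rewrite /wronskian !derivD !derivZ !derivXn !derivC !addr0.
rewrite -(mulr_natl 'X^(n.-1) n) -!mul_polyC !polyCM polyCB !polyCM polyC_natr.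
case: n => [|n] /=; [ring|rewrite exprS; ring].
Qed.

Lemma normal_form_param_infty n a b c d w : (0 < n)%N -> a * d - b * c != 0 ->
  normal_form n a b c d (sphere_param None w) =
  hpt (b *: 'X^n + a%:P).[w] (d *: 'X^n + c%:P).[w].
Proof.
move=> n0 D; have -> : sphere_param None w = hpt 1 w by rewrite /hpt div1r.
rewrite normal_form_hpt ?oner_neq0 // expr1n !mulr1.
by rewrite !(hornerD, hornerZ, hornerXn, hornerC) ![_ + a]addrC ![_ + c]addrC.
Qed.

Lemma horner_XnC_neq0 n a b c d w : a * d - b * c != 0 ->
  ((a *: 'X^n + b%:P).[w] != 0) || ((c *: 'X^n + d%:P).[w] != 0).
Proof.
move=> D; rewrite !(hornerD, hornerZ, hornerXn, hornerC) -[b]mulr1 -[d]mulr1.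
by apply: det_neq0; rewrite ?mulr1 ?oner_neq0 ?orbT.
Qed.

(** Up to sign the Wronskian is n (ad - bc) w^(n-1) both in the coordinate w = x and in w = 1/x. *)
Lemma critical_points_normal_form n a b c d : (2 <= n)%N -> a * d - b * c != 0 ->
  critical_points (normal_form n a b c d) = [set Some 0; None].
Proof.
move=> n2 D; have n0 : (0 < n)%N by exact: ltnW.
have n1 : (n.-1 != 0)%N by rewrite -lt0n -ltnS prednK.
have nz : n%:R * (a * d - b * c) != 0 by rewrite mulf_neq0 // pnatr_eq0 -lt0n.
have D' : b * c - a * d != 0 by rewrite -oppr_eq0 opprB.
apply/seteqP; split=> [[u|]|_ [->|->]] /=; last 2 first.
- apply/(local_deriv_hpt (ratfun_param_finite _ _ 0)); first exact: horner_XnC_neq0.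
  by rewrite wronskian_XnC hornerZ hornerXn expr0n (negbTE n1) mulr0.
- apply/(local_deriv_hpt (fun w => normal_form_param_infty w n0 D)).
    by apply: horner_XnC_neq0; rewrite -oppr_eq0 opprB mulrC [d * a]mulrC.
  by rewrite wronskian_XnC hornerZ hornerXn expr0n (negbTE n1) mulr0.
- move=> /(local_deriv_hpt (ratfun_param_finite _ _ u)) h.
  have := h (horner_XnC_neq0 _ _ D); rewrite wronskian_XnC hornerZ hornerXn /= => /eqP.
  by rewrite mulf_eq0 (negbTE nz) expf_eq0 lt0n n1 /= => /eqP ->; left.
by right.
Qed.

Lemma normal_form_bicritical n a b c d : (2 <= n)%N -> a * d - b * c != 0 ->
  bicritical n (normal_form n a b c d).
Proof.
move=> n2 D; split; first by apply: normal_form_rational => //; exact: ltnW.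
by exists (Some 0), None; split; last exact: critical_points_normal_form.
Qed.

End LocalForms.

(** * Reduction of a bicritical map to normal form *)

Section NormalForm.
Variable M : complex_model.
Local Notation R := (creal M).
Local Notation C := (cnum M).
Local Notation S := (sphere C).
Implicit Types (u v w a b c d k : C) (z : S) (p q g h : {poly C}) (f : S -> S).

Lemma wronskian_comb p q a b c d :
  wronskian (a *: p + b *: q) (c *: p + d *: q) = (a * d - b * c) *: wronskian p q.
Proof.
rewrite /wronskian !derivD !derivZ -!mul_polyC polyCB !polyCM; ring.
Qed.

(* If [l1^n] and [l2^n] are linear combinations of the numerator and the      *)
(* denominator of [f], then the coordinate [l1 / l2] puts [f] in normal form. *)
Lemma conjugate_of_powers n p q a b c d m11 m12 m21 m22 k1 k2 :
  (0 < n)%N -> (maxn (size p) (size q)).-1 = n ->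
  a * d - b * c != 0 -> m11 * m22 - m12 * m21 != 0 -> k1 != 0 -> k2 != 0 ->
  (forall z, a * hform n p (hx z) (hy z) + b * hform n q (hx z) (hy z) =
     k1 * (m11 * hx z + m12 * hy z) ^+ n) ->
  (forall z, c * hform n p (hx z) (hy z) + d * hform n q (hx z) (hy z) =
     k2 * (m21 * hx z + m22 * hy z) ^+ n) ->
  exists a' b' c' d', a' * d' - b' * c' != 0 /\
    conjugate (ratfun p q) (normal_form n a' b' c' d').
Proof.
move=> n0 sn D Dm k10 k20 e1 e2.
(* The matrix (mij) times the adjugate of (a b; c d), with columns scaled by k1 and k2: the adjugate
   recovers p and q from the two powers up to the determinant. *)
pose a' := (m11 * d - m12 * c) * k1; pose b' := (m12 * a - m11 * b) * k2.
pose c' := (m21 * d - m22 * c) * k1; pose d' := (m22 * a - m21 * b) * k2.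
have D' : a' * d' - b' * c' != 0.
  have -> : a' * d' - b' * c' = (a * d - b * c) * (m11 * m22 - m12 * m21) * (k1 * k2).
    by rewrite /a' /b' /c' /d'; ring.
  by rewrite !mulf_neq0.
exists a', b', c', d'; split=> //; apply: (conjugate_mob Dm).
apply/funext => z /=; rewrite (mobE z Dm) (ratfun_hpt z sn).
have l0 := det_neq0 Dm (hcoords_neq0 z).
rewrite normal_form_hpt //; move: (e1 z) (e2 z); set P := hform n p _ _; set Q := hform n q _ _.
move=> E1 E2; have PQ : (P != 0) || (Q != 0).
  have := expn_neq0 n l0; apply: contraTT; rewrite !negb_or !negbK => /andP[/eqP P0 /eqP Q0].
  rewrite P0 Q0 !mulr0 addr0 in E1 E2.
  move/esym/eqP: E1; rewrite mulf_eq0 (negbTE k10) /= => ->.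
  by move/esym/eqP: E2; rewrite mulf_eq0 (negbTE k20) /= => ->.
rewrite mob_hpt // -[RHS](@hptZ _ (a * d - b * c)) //.
congr hpt.
  transitivity ((m11 * d - m12 * c) * (a * P + b * Q) + (m12 * a - m11 * b) * (c * P + d * Q)).
    by rewrite E1 E2 /a' /b'; ring.
  ring.
transitivity ((m21 * d - m22 * c) * (a * P + b * Q) + (m22 * a - m21 * b) * (c * P + d * Q)).
  by rewrite E1 E2 /c' /d'; ring.
ring.
Qed.

Lemma hform_comb n p q a b u v :
  a * hform n p u v + b * hform n q u v = hform n (a *: p + b *: q) u v.
Proof.
rewrite /hform !mulr_sumr -big_split; apply: eq_bigr => i _ /=.
by rewrite coefD !coefZ; ring.
Qed.

Lemma hform_lin n a k z :
  hform n (k *: ('X - a%:P) ^+ n) (hx z) (hy z) = k * (1 * hx z + - a * hy z) ^+ n.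
Proof.
have sz : size (('X - a%:P) ^+ n) = n.+1 by rewrite size_exp_XsubC.
case: z => [w|] /=.
  rewrite hform_v1 ?(leq_trans (size_scale_leq _ _)) ?sz //.
  by rewrite hornerZ horner_exp !hornerE.
rewrite hform_v0 coefZ mulr1 mulr0 addr0 expr1n; congr (_ * _).
have : ('X - a%:P) ^+ n \is monic by rewrite monic_exp ?monicXsubC.
by move/monicP; rewrite lead_coefE sz.
Qed.

Lemma hform_const n k z : (0 < n)%N ->
  hform n k%:P (hx z) (hy z) = k * (0 * hx z + 1 * hy z) ^+ n.
Proof.
move=> n0; case: z => [w|] /=.
  rewrite hform_v1 ?(leq_trans (size_polyC_leq1 _)) // hornerC.
  by rewrite mul0r add0r mul1r expr1n mulr1.
by rewrite hform_v0 coefC gtn_eqF // mul0r mulr0 addr0 expr0n gtn_eqF // mulr0.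
Qed.

Section Wronskian.
Variables (n : nat) (p q : {poly C}).
Hypotheses (n0 : (0 < n)%N) (cpq : coprimep p q).
Hypothesis sn : (maxn (size p) (size q)).-1 = n.
Hypothesis W0 : wronskian p q != 0.

Let sp : (size p <= n.+1)%N. Proof. by rewrite -sn (leq_trans (leq_maxl _ _) (leqSpred _)). Qed.
Let sq : (size q <= n.+1)%N. Proof. by rewrite -sn (leq_trans (leq_maxr _ _) (leqSpred _)). Qed.

Lemma coprime_neq0 u : (p.[u] != 0) || (q.[u] != 0).
Proof.
have [_ /Bezout_eq1_coprimepP] := (I, cpq).
move=> [[r s] /= /(congr1 (fun g => g.[u]))]; rewrite hornerD !hornerM hornerC => e.
apply: contraTT (oner_neq0 C); rewrite negb_or !negbK => /andP[/eqP P0 /eqP Q0].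
by rewrite -e P0 Q0 !mulr0 addr0.
Qed.

(** With P and Q the values of p and q at a point, g vanishes there. Taking it as one member of a
    new basis of the span of p and q changes the Wronskian by a scalar only, and the other member
    does not vanish at the point. *)
Lemma wronskian_partner (P Q : C) g : (P != 0) || (Q != 0) -> g = Q *: p - P *: q ->
  exists h k, [/\ k != 0, wronskian g h = k *: wronskian p q &
    (h = q /\ Q != 0) \/ (h = p /\ P != 0)].
Proof.
move=> PQ ->; have [Q0|Q0] := eqVneq Q 0.
  exists p, P; rewrite Q0 eqxx orbF in PQ *; split=> //; last by right.
  have := wronskian_comb p q 0 (- P) 1 0; rewrite !scale1r !scale0r addr0 scaleNr.
  by move=> ->; congr (_ *: _); ring.
exists q, Q; split=> //; last by left.
have := wronskian_comb p q Q (- P) 0 1; rewrite !scale1r scale0r add0r scaleNr.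
by move=> ->; congr (_ *: _); ring.
Qed.

(** If g = q(u) p - p(u) q vanishes at u to order e, then e <= n and the Wronskian vanishes to order
    exactly e - 1, since e is nonzero in [C]. Order n - 1 forces e = n, and then g is a multiple of
    (X - u)^n. *)
Lemma wronskian_root u m : ('X - u%:P) ^+ m %| wronskian p q -> (m < n)%N /\
  (m.+1 = n -> exists2 k, k != 0 & q.[u] *: p + - p.[u] *: q = k *: ('X - u%:P) ^+ n).
Proof.
pose g := q.[u] *: p - p.[u] *: q.
have [h [k [k0 Wk hh]]] := wronskian_partner (coprime_neq0 u) (erefl g).
have hu : h.[u] != 0 by case: hh => [[-> //]|[-> //]].
have g0 : g != 0.
  apply: contraNneq W0 => g0; move: Wk; rewrite g0 /wronskian deriv0 !mul0r subrr.
  by move/esym/eqP; rewrite scaler_eq0 (negbTE k0).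
have gu : root g u by rewrite rootE /g !hornerE mulrC subrr.
have [e [g1 g1u ge]] := multiplicity_XsubC g u; rewrite (negbTE g0) /= in g1u.
have e0 : (0 < e)%N.
  rewrite lt0n; apply: contraTneq gu => e0.
  by move: g1u; rewrite ge e0 expr0 mulr1.
have g10 : g1 != 0 by apply: contraNneq g0 => g10; rewrite ge g10 mul0r.
have sg : (size g <= n.+1)%N.
  rewrite (leq_trans (size_polyD _ _)) // geq_max size_polyN.
  by rewrite !(leq_trans (size_scale_leq _ _)).
have sge : size g = (size g1 + e)%N.
  rewrite ge size_mul ?expf_neq0 ?polyXsubC_eq0 // size_exp_XsubC.
  by rewrite addnS.
have en : (e <= n)%N.
  have : (0 < size g1)%N by rewrite size_poly_gt0.
  by move: sg; rewrite sge => h1 h2; rewrite -ltnS (leq_trans _ h1) // -addn1 addnC leq_add2r.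
have We : wronskian g h = ('X - u%:P) ^+ e.-1 *
    (e%:R * g1 * h + ('X - u%:P) * (g1^`() * h - g1 * h^`())).
  rewrite /wronskian ge derivM deriv_exp derivXsubC mul1r -(mulr_natl (('X - u%:P) ^+ e.-1) e).
  by rewrite -[in X in _ ^+ X](prednK e0) exprS; ring.
have nr : ~~ root (e%:R * g1 * h + ('X - u%:P) * (g1^`() * h - g1 * h^`())) u.
  rewrite rootE !(hornerD, hornerM, hornerN, hornerX, hornerC) subrr mul0r addr0.
  rewrite -polyC_natr hornerC !mulf_neq0 // ?pnatr_eq0 -?lt0n //.
move=> mW; have : ('X - u%:P) ^+ m %| wronskian g h by rewrite Wk dvdpZr.
rewrite We => mW'.
have me : (m <= e.-1)%N.
  rewrite leqNgt; apply/negP => lt_em.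
  have : ('X - u%:P) ^+ e.-1.+1 %| ('X - u%:P) ^+ e.-1 *
    (e%:R * g1 * h + ('X - u%:P) * (g1^`() * h - g1 * h^`())).
    by apply: dvdp_trans mW'; apply: dvdp_exp2l.
  rewrite exprSr dvdp_mul2l ?expf_neq0 ?polyXsubC_eq0 // dvdp_XsubCl.
  by rewrite (negbTE nr).
have mlt : (m < e)%N by rewrite -(prednK e0) ltnS.
split; first exact: leq_trans mlt en.
move=> mn; have en' : e = n by apply/eqP; rewrite eqn_leq en -mn.
have sg1 : size g1 == 1%N.
  rewrite eqn_leq size_poly_gt0 g10 andbT -(leq_add2r n) add1n.
  by rewrite -{1}en' -sge.
have [k' k'0 g1k] := size_poly1P _ sg1.
by exists k'; rewrite // scaleNr -/g ge g1k -en' mul_polyC.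
Qed.

Lemma top_coef_neq0 : (p`_n != 0) || (q`_n != 0).
Proof.
apply: contraT; rewrite negb_or !negbK => /andP[/eqP pn /eqP qn].
have lt (r : {poly C}) : (size r <= n.+1)%N -> r`_n = 0 -> (size r <= n)%N.
  move=> sr rn; apply/leq_sizeP => j; rewrite leq_eqVlt => /orP[/eqP <- //|nj].
  by rewrite nth_default // (leq_trans sr).
have h : (maxn (size p) (size q) <= n)%N by rewrite geq_max !lt.
have : (n <= n.-1)%N by rewrite -[in leqLHS]sn -!subn1 leq_sub2r.
by rewrite leqNgt prednK // leqnn.
Qed.

End Wronskian.

Lemma coefM_top p q i j : (size p <= i.+1)%N -> (size q <= j.+1)%N ->
  (p * q)`_(i + j) = p`_i * q`_j.
Proof.
move=> sp sq; have lti : (i < (i + j).+1)%N by rewrite ltnS leq_addr.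
rewrite coefM (bigD1 (Ordinal lti)) //= addKn big1 ?addr0 // => k ki.
have [ltk|lek] := ltnP k i.
  by rewrite [q`_ _]nth_default ?mulr0 // (leq_trans sq) //; lia.
rewrite nth_default ?mul0r // (leq_trans sp) // ltn_neqAle lek andbT.
by apply: contra ki => /eqP ki; apply/eqP/val_inj.
Qed.

Lemma size_deriv_le p m : (size p <= m.+1)%N -> (size p^`() <= m)%N.
Proof.
move=> sp; apply/leq_sizeP => j mj; rewrite coef_deriv nth_default ?mul0rn //.
exact: leq_trans sp _.
Qed.

Lemma wronskian_top g h m n : (0 < m)%N -> (0 < n)%N ->
  (size g <= m.+1)%N -> (size h <= n.+1)%N ->
  (wronskian g h)`_(m + n).-1 = (m%:R - n%:R) * (g`_m * h`_n).
Proof.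
move=> m0 n0 sg sh; rewrite /wronskian coefB.
have e1 : (m + n).-1 = (m.-1 + n)%N by rewrite -[in LHS](prednK m0).
have e2 : (m + n).-1 = (m + n.-1)%N by rewrite -[in LHS](prednK n0) addnS.
rewrite {1}e1 {1}e2 !coefM_top ?size_deriv_le ?prednK //.
by rewrite !coef_deriv !prednK // mulrnAl mulrnAr mulrBl !mulr_natl.
Qed.

Section WronskianInfinity.
Variables (n : nat) (p q : {poly C}).
Hypotheses (n0 : (0 < n)%N) (sn : (maxn (size p) (size q)).-1 = n).
Hypothesis W0 : wronskian p q != 0.

Let g := q`_n *: p - p`_n *: q.

Let partner : exists h k, [/\ k != 0, wronskian g h = k *: wronskian p q,
  (size h <= n.+1)%N & h`_n != 0].
Proof.
have [h [k [k0 Wk hh]]] := wronskian_partner (top_coef_neq0 n0 sn) (erefl g).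
exists h, k; split=> //.
  by rewrite -sn; case: hh => [[-> _]|[-> _]];
    [exact: leq_trans (leq_maxr _ _) (leqSpred _)|exact: leq_trans (leq_maxl _ _) (leqSpred _)].
by case: hh => [[-> //]|[-> //]].
Qed.

Let g0 : g != 0.
Proof.
have [h [k [k0 Wk _ _]]] := partner.
apply: contraNneq W0 => g0; move: Wk; rewrite g0 /wronskian deriv0 !mul0r subrr.
by move/esym/eqP; rewrite scaler_eq0 (negbTE k0).
Qed.

Let sg : (size g <= n)%N.
Proof.
have le (r : {poly C}) : (size r <= maxn (size p) (size q))%N -> (size r <= n.+1)%N.
  by move=> h; rewrite -sn (leq_trans h) // leqSpred.
apply/leq_sizeP => j; rewrite leq_eqVlt => /orP[/eqP <-|nj].
  by rewrite /g coefB !coefZ mulrC subrr.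
have hp : p`_j = 0 by rewrite nth_default // (leq_trans (le p (leq_maxl _ _))).
have hq : q`_j = 0 by rewrite nth_default // (leq_trans (le q (leq_maxr _ _))).
by rewrite /g coefB !coefZ hp hq !mulr0 subrr.
Qed.

(** The counterpart of [wronskian_root] at infinity: g = q_n p - p_n q has degree m < n, and for m >
    0 the Wronskian has degree m + n - 1 >= n by [wronskian_top]. So g is constant, and the
    Wronskian is then a multiple of the derivative of a polynomial of degree n. *)
Lemma wronskian_infty : (size (wronskian p q) <= n)%N ->
  size (wronskian p q) = n /\ exists2 k, k != 0 & q`_n *: p + - p`_n *: q = k%:P.
Proof.
have [h [k [k0 Wk sh hn]]] := partner; have Wsz : size (wronskian g h) = size (wronskian p q).
  by rewrite Wk size_scale.
rewrite -Wsz => sW; pose m := (size g).-1.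
have sgm : size g = m.+1 by rewrite /m prednK // size_poly_gt0.
have gm : g`_m != 0 by rewrite -lead_coefE lead_coef_eq0.
have mn : (m < n)%N by rewrite -sgm.
have [m0|m0] := posnP m; last first.
  have : (wronskian g h)`_(m + n).-1 != 0.
    rewrite wronskian_top ?sgm // !mulf_neq0 // subr_eq0 eqr_nat.
    by rewrite ltn_eqF.
  by rewrite nth_default ?eqxx // (leq_trans sW) // -(prednK m0) addSn leq_addl.
have /size_poly1P[c c0 gc] : size g == 1%N by rewrite sgm m0.
split; last by exists c; rewrite // scaleNr.
apply/eqP; rewrite eqn_leq sW /= -(prednK n0) ltnNge; apply/negP => /leq_sizeP/(_ _ (leqnn _)).
rewrite /wronskian gc derivC mul0r sub0r coefN coefCM coef_deriv prednK // => /eqP.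
rewrite oppr_eq0 mulf_eq0 (negbTE c0) -mulr_natl mulf_eq0 (negbTE hn) pnatr_eq0 orbF /=.
by rewrite gtn_eqF.
Qed.

(** When infinity is not critical, g has degree n - 1 and the Wronskian reaches degree 2n - 2. *)
Lemma wronskian_infty_noncritical : (2 <= n)%N ->
  p`_n.-1 * q`_n - p`_n * q`_n.-1 != 0 -> ((n + n).-2 < size (wronskian p q))%N.
Proof.
move=> n2 h0; have [h [k [k0 Wk sh hn]]] := partner.
have Wsz : size (wronskian g h) = size (wronskian p q) by rewrite Wk size_scale.
have n10 : (0 < n.-1)%N by rewrite -ltnS prednK.
rewrite -Wsz ltnNge; apply/negP => /leq_sizeP/(_ _ (leqnn _)) => /eqP; apply/negP.
have -> : (n + n).-2 = (n.-1 + n).-1 by case: (n) n0.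
rewrite wronskian_top ?prednK // !mulf_neq0 //; first by rewrite subr_eq0 eqr_nat ltn_eqF // prednK.
by rewrite /g coefB !coefZ mulrC.
Qed.

End WronskianInfinity.

End NormalForm.

Section BicriticalNormalForm.
Variable M : complex_model.
Local Notation C := (cnum M).
Local Notation S := (sphere C).
Implicit Types (u v w a b c d k : C) (z : S) (p q : {poly C}) (f : S -> S).

Lemma rootfree_size1 p : (forall u, ~~ root p u) -> size p = 1%N.
Proof.
move=> h; apply/eqP; apply: contraT => /closed_rootP[u pu].
by have := h u; rewrite pu.
Qed.

Section RationalMap.
Variables (n : nat) (p q : {poly C}).
Hypotheses (n2 : (2 <= n)%N) (cpq : coprimep p q).
Hypothesis sn : (maxn (size p) (size q)).-1 = n.

Let n0 : (0 < n)%N. Proof. exact: ltnW. Qed.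
Let f := ratfun p q.
Let W := wronskian p q.

Lemma critical_finite u : root W u -> critical_points f (Some u).
Proof.
move=> /rootP Wu; apply/(local_deriv_hpt (ratfun_param_finite p q u)) => //.
exact: coprime_neq0.
Qed.

Lemma critical_infty : p`_n.-1 * q`_n - p`_n * q`_n.-1 = 0 -> critical_points f None.
Proof.
move=> h; apply/(local_deriv_hpt (fun w => ratfun_param_infty w sn)) => /=.
  by rewrite !horner_revpoly !hform_v0 top_coef_neq0.
rewrite horner_coef0 /wronskian coefB !coef0M !coef_deriv !coef_poly /= !subn0 !subn1.
by rewrite !ltnS n0 !mulr1n.
Qed.

(** The roots of the Wronskian are critical, with multiplicity at most n - 1. If c1 and c2 are
    finite, the degree is at least 2n - 2, so both multiplicities equal n - 1; if one is infinity,
    [wronskian_infty] gives multiplicity n - 1 at the other. Either way two independent combinations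
    of p and q are n-th powers of linear forms, and [conjugate_of_powers] applies. *)
Lemma bicritical_conjugate (c1 c2 : S) : c1 <> c2 -> critical_points f = [set c1; c2] ->
  exists a b c d, a * d - b * c != 0 /\ conjugate f (normal_form n a b c d).
Proof.
move=> c12 cf; have crit z : critical_points f z -> z = c1 \/ z = c2 by rewrite cf.
have W0 : W != 0.
  (* A vanishing Wronskian would make 0, 1 and 2 three distinct critical points. *)
  apply/eqP => W0; have h u : Some u = c1 \/ Some u = c2.
    by apply/crit/critical_finite; rewrite W0 root0.
  have N01 : (0 : C) <> 1 by apply/eqP; rewrite eq_sym oner_neq0.
  have N02 : (0 : C) <> 2 by apply/eqP; rewrite eq_sym pnatr_eq0.
  have N12 : (1 : C) <> 2 by apply/eqP; rewrite (eqr_nat C 1 2).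
  have inj (x y : C) (z : S) : Some x = z -> Some y = z -> x = y by move=> <- [].
  by case: (h 0) (h 1) (h 2) => [e0|e0] [e1|e1] [e2|e2];
    first [exact: N01 (inj _ _ _ e0 e1)|exact: N02 (inj _ _ _ e0 e2)|exact: N12 (inj _ _ _ e1 e2)].
have X0 u i : ('X - u%:P : {poly C}) ^+ i != 0 by rewrite expf_neq0 // polyXsubC_eq0.
have none_some a : (forall z, critical_points f z -> z = Some a \/ z = None) ->
    exists a' b' c' d', a' * d' - b' * c' != 0 /\ conjugate f (normal_form n a' b' c' d').
  move=> crita; have [i [W1 W1a We]] := multiplicity_XsubC W a; rewrite (negbTE W0) /= in W1a.
  have W10 : W1 != 0 by apply: contraNneq W0 => W10; rewrite We W10 mul0r.
  have sW1 : size W1 = 1%N.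
    apply: rootfree_size1 => u; apply/negP => ru.
    have /critical_finite/crita : root W u by rewrite We rootM ru.
    by move=> -[] // [eu]; move: W1a; rewrite -eu ru.
  have sW : size W = i.+1 by rewrite We size_mul ?X0 // sW1 size_exp_XsubC.
  have dv : ('X - a%:P) ^+ i %| W by rewrite We dvdp_mull.
  have [lt_in ha] := wronskian_root cpq sn W0 dv.
  have [sWn [k2 k20 h2]] := wronskian_infty n0 sn W0 (ltac:(by rewrite -/W sW) : (size W <= n)%N).
  have [k1 k10 h1] := ha (ltac:(by rewrite -sWn -/W sW)).
  have D1 : (1 : C) * 1 - (- a) * 0 != 0 by rewrite mulr0 subr0 mulr1 oner_neq0.
  apply: (conjugate_of_powers (a := q.[a]) (b := - p.[a]) (c := q`_n) (d := - p`_n)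
    n0 sn _ D1 k10 k20) => [|z|z].
  - have /(congr1 (fun r : {poly C} => r.[a])) := h2.
    rewrite !(hornerD, hornerZ, hornerN, hornerC) => e.
    have -> : q.[a] * - p`_n - - p.[a] * q`_n = k2 by rewrite -e; ring.
    exact: k20.
  - by rewrite hform_comb h1 hform_lin.
  - by rewrite hform_comb h2 hform_const.
case: c1 c2 {cf} c12 crit => [a|] [b|] // c12 crit; last first.
- by apply: (none_some b) => z /crit[]; [right|left].
- exact: (none_some a).
have ab : a != b by apply/eqP => ab; apply: c12; rewrite ab.
have [i [W1 W1a We1]] := multiplicity_XsubC W a; rewrite (negbTE W0) /= in W1a.
have W10 : W1 != 0 by apply: contraNneq W0 => W10; rewrite We1 W10 mul0r.
have [j [W2 W2b We2]] := multiplicity_XsubC W1 b; rewrite (negbTE W10) /= in W2b.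
have W20 : W2 != 0 by apply: contraNneq W10 => W20; rewrite We2 W20 mul0r.
have sW2 : size W2 = 1%N.
  apply: rootfree_size1 => u; apply/negP => ru.
  have r1 : root W1 u by rewrite We2 rootM ru.
  have /critical_finite/crit : root W u by rewrite We1 rootM r1.
  by move=> -[[eu]|[eu]]; [move: W1a; rewrite -eu r1|move: W2b; rewrite -eu ru].
have sW : size W = (i + j).+1.
  rewrite We1 size_mul ?X0 // We2 size_mul ?X0 // sW2 !size_exp_XsubC; lia.
have dva : ('X - a%:P) ^+ i %| W by rewrite We1 dvdp_mull.
have dvb : ('X - b%:P) ^+ j %| W by rewrite We1 We2 -mulrA mulrC -mulrA mulrC dvdp_mull.
have [lt_in ha] := wronskian_root cpq sn W0 dva.
have [lt_jn hb] := wronskian_root cpq sn W0 dvb.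
have big : ((n + n).-2 < size W)%N.
  apply: wronskian_infty_noncritical => //; apply/eqP => /critical_infty/crit.
  by case.
have [ei ej] : i.+1 = n /\ j.+1 = n by move: big lt_in lt_jn; rewrite sW; clear; lia.
have [k1 k10 h1] := ha ei; have [k2 k20 h2] := hb ej.
have D1 : (1 : C) * (- b) - (- a) * 1 != 0.
  by rewrite mul1r mulr1 opprK addrC subr_eq0.
apply: (conjugate_of_powers (a := q.[a]) (b := - p.[a]) (c := q.[b]) (d := - p.[b])
  n0 sn _ D1 k10 k20) => [|z|z].
- have /(congr1 (fun r : {poly C} => r.[b])) := h1.
  rewrite !(hornerD, hornerZ, hornerN, horner_exp, hornerX, hornerC) => e.
  have -> : q.[a] * - p.[b] - - p.[a] * q.[b] = - (k1 * (b - a) ^+ n) by rewrite -e; ring.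
  by rewrite oppr_eq0 mulf_neq0 // expf_neq0 // subr_eq0 eq_sym.
- by rewrite hform_comb h1 hform_lin.
- by rewrite hform_comb h2 hform_lin.
Qed.

End RationalMap.

Lemma bicritical_normal_form n f : (2 <= n)%N -> bicritical n f ->
  exists a b c d, a * d - b * c != 0 /\ conjugate f (normal_form n a b c d).
Proof.
move=> n2 [[p [q [cpq sn ->]]] [c1 [c2 [c12 cf]]]].
exact: bicritical_conjugate cf.
Qed.

End BicriticalNormalForm.

(** * The coordinates X and sigma_n *)

Section CriticalValues.
Variable M : complex_model.
Local Notation C := (cnum M).
Local Notation S := (sphere C).
Implicit Types (u v w a b c d k : C) (x y z : S) (f g phi : S -> S).

(** For maps in normal form this describes the critical points without derivatives, so that
    invariance under conjugacy is immediate. *)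
Definition lone f z := forall y, f y = f z -> y = z.

Lemma lone_conjugate f g phi z : injective phi -> (forall y, exists x, phi x = y) ->
  g \o phi = phi \o f -> lone f z -> lone g (phi z).
Proof.
move=> inj surj e lz y; have [x <-] := surj y.
have E t : g (phi t) = phi (f t) by exact: (congr1 (fun h => h t) e).
by rewrite !E => /inj /lz ->.
Qed.

(** Any other point u shares its fibre with (w2/w1) u, where w1 and w2 are distinct n-th roots of
    -1. *)
Lemma lone_normal_form n a b c d z : (2 <= n)%N -> a * d - b * c != 0 ->
  lone (normal_form n a b c d) z <-> z = Some 0 \/ z = None.
Proof.
move=> n2 D; have n0 : (0 < n)%N by exact: ltnW.
have E x y : normal_form n a b c d x = normal_form n a b c d y ->
    hx x ^+ n * hy y ^+ n = hx y ^+ n * hy x ^+ n.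
  rewrite !normal_formE // => /eq_hpt e.
  have /e {}e : (a * hx x ^+ n + b * hy x ^+ n != 0) || (c * hx x ^+ n + d * hy x ^+ n != 0).
    by rewrite det_neq0 // expn_neq0 // hcoords_neq0.
  have /e {}e : (a * hx y ^+ n + b * hy y ^+ n != 0) || (c * hx y ^+ n + d * hy y ^+ n != 0).
    by rewrite det_neq0 // expn_neq0 // hcoords_neq0.
  apply: (mulfI D); apply/eqP; rewrite -subr_eq0; apply/eqP.
  move/eqP: e; rewrite -subr_eq0 => /eqP <-; ring.
split=> [|[->|->]].
- case: z => [u|] l; last by right.
  left; congr Some; apply/eqP; apply: contraT => u0.
  have [w1 [w2 [e1 e2 w12]]] := two_roots M n2.
  have w10 : w1 != 0.
    apply/eqP => h; move: e1; rewrite h expr0n gtn_eqF //= => /esym/eqP.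
    by rewrite oppr_eq0 oner_eq0.
  have [] : Some (w2 / w1 * u) = Some u.
    apply: l; rewrite !normal_formE //= !exprMn exprVn e1 e2.
    by rewrite mulfV ?mul1r // oppr_eq0 oner_eq0.
  rewrite -[in RHS](mul1r u) => /(mulIf u0) /divr1_eq h.
  by move: w12; rewrite h eqxx.
- move=> y /E /=; rewrite expr0n gtn_eqF // mul0r expr1n mulr1 => /eqP.
  rewrite expf_eq0 n0 /=; case: y => [w|] /=; last by rewrite oner_eq0.
  by move=> /eqP ->.
- move=> y /E /=; rewrite expr0n gtn_eqF // mulr0 expr1n mul1r => /esym/eqP.
  by rewrite expf_eq0 n0 /=; case: y => [w|] //=; rewrite oner_eq0.
Qed.

Lemma hpt_eq0 u v : (u != 0) || (v != 0) -> hpt u v = Some 0 -> u = 0.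
Proof.
move=> _; rewrite /hpt; case: eqP => // /eqP v0 [] h.
by have : u / v * v = 0 * v; [rewrite h|rewrite divfK // mul0r].
Qed.

Lemma hpt_eq_infty u v : hpt u v = None -> v = 0.
Proof. by rewrite /hpt; case: eqP. Qed.

(* Up to sign [X] is the cross-ratio of the two critical points and the two   *)
(* critical values.                                                           *)
Lemma conjugate_invariantX n a b c d a' b' c' d' : (2 <= n)%N ->
  a * d - b * c != 0 -> a' * d' - b' * c' != 0 ->
  conjugate (normal_form n a b c d) (normal_form n a' b' c' d') ->
  b * c / (a * d - b * c) = b' * c' / (a' * d' - b' * c').
Proof.
move=> n2 D D' [_ /rational_map1P[p [q [r [s [Dm ->]]]]] e].
have n0 : (0 < n)%N by exact: ltnW.
have [Dm' K1 K2] := mobVK Dm.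
have k1 x : mob s (- q) (- r) p (mob p q r s x) = x by exact: (congr1 (fun F => F x) K1).
have k2 x : mob p q r s (mob s (- q) (- r) p x) = x by exact: (congr1 (fun F => F x) K2).
have inj : injective (mob p q r s) by exact: can_inj k1.
have surj y : exists x, mob p q r s x = y by exists (mob s (- q) (- r) p y).
have E t : normal_form n a' b' c' d' (mob p q r s t) = mob p q r s (normal_form n a b c d t).
  by exact: (congr1 (fun h => h t) e).
have P0 : mob p q r s (Some 0) = hpt q s.
  by rewrite mobE //= !mulr0 !mulr1 !add0r.
have Poo : mob p q r s None = hpt p r.
  by rewrite mobE //= !mulr0 !mulr1 !addr0.
have N0 (x1 x2 x3 x4 : C) : x1 * x4 - x2 * x3 != 0 -> normal_form n x1 x2 x3 x4 (Some 0) = hpt x2 x4.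
  by move=> Dx; rewrite normal_formE //= expr0n gtn_eqF // !mulr0 expr1n !mulr1 !add0r.
have Noo (x1 x2 x3 x4 : C) : x1 * x4 - x2 * x3 != 0 -> normal_form n x1 x2 x3 x4 None = hpt x1 x3.
  by move=> Dx; rewrite normal_formE //= expr0n gtn_eqF // !mulr0 expr1n !mulr1 !addr0.
have nz (x1 x2 x3 x4 : C) : x1 * x4 - x2 * x3 != 0 -> (x1 != 0) || (x3 != 0).
  by apply: contraNT; rewrite negb_or !negbK => /andP[/eqP -> /eqP ->]; rewrite mul0r mulr0 subrr.
have nz' (x1 x2 x3 x4 : C) : x1 * x4 - x2 * x3 != 0 -> (x2 != 0) || (x4 != 0).
  by apply: contraNT; rewrite negb_or !negbK => /andP[/eqP -> /eqP ->]; rewrite mul0r mulr0 subrr.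
have goal : b * c * (a' * d') = b' * c' * (a * d) ->
    b * c / (a * d - b * c) = b' * c' / (a' * d' - b' * c').
  move=> h; apply/eqP; rewrite eqr_div //; apply/eqP.
  by rewrite mulrBr h; ring.
have L0 : lone (normal_form n a' b' c' d') (mob p q r s (Some 0)).
  by apply: lone_conjugate inj surj e _; apply/(lone_normal_form _ n2 D); left.
have Loo : lone (normal_form n a' b' c' d') (mob p q r s None).
  by apply: lone_conjugate inj surj e _; apply/(lone_normal_form _ n2 D); right.
have := E (Some 0); have := E None.
move: L0 Loo => /(lone_normal_form _ n2 D') L0 /(lone_normal_form _ n2 D') Loo.
have ne : mob p q r s (Some 0) <> mob p q r s None by move=> /inj.
have U1 := det_neq0 Dm (nz _ _ _ _ D); have U2 := det_neq0 Dm (nz' _ _ _ _ D).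
have V1 := nz _ _ _ _ D'; have V2 := nz' _ _ _ _ D'.
(* The conjugating matrix is diagonal or antidiagonal, according to whether it fixes or exchanges 0
   and infinity. *)
case: L0 => h0; case: Loo => hoo; try by move: ne; rewrite h0 hoo.
- rewrite h0 hoo (N0 _ _ _ _ D) (Noo _ _ _ _ D) (N0 _ _ _ _ D') (Noo _ _ _ _ D').
  rewrite !mob_hpt ?(nz _ _ _ _ D) ?(nz' _ _ _ _ D) //.
  move=> /(eq_hpt V1 U1) h1 /(eq_hpt V2 U2) h2.
  have q0 : q = 0 by rewrite P0 in h0; exact: hpt_eq0 (nz' _ _ _ _ Dm) h0.
  have r0 : r = 0 by rewrite Poo in hoo; exact: hpt_eq_infty hoo.
  have ps : p * s != 0 by move: Dm; rewrite q0 mul0r subr0.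
  rewrite q0 r0 !mul0r !addr0 !add0r in h1 h2.
  apply: goal; apply: (mulfI ps).
  transitivity (a' * (s * c) * (p * b * d')); first by ring.
  by rewrite h1 -h2; ring.
- rewrite h0 hoo (N0 _ _ _ _ D) (Noo _ _ _ _ D) (N0 _ _ _ _ D') (Noo _ _ _ _ D').
  rewrite !mob_hpt ?(nz _ _ _ _ D) ?(nz' _ _ _ _ D) //.
  move=> /(eq_hpt V2 U1) h1 /(eq_hpt V1 U2) h2.
  have s0 : s = 0 by rewrite P0 in h0; exact: hpt_eq_infty h0.
  have p0 : p = 0 by rewrite Poo in hoo; exact: hpt_eq0 (nz _ _ _ _ Dm) hoo.
  have qr : q * r != 0 by move: Dm; rewrite p0 mul0r sub0r oppr_eq0.
  rewrite p0 s0 !mul0r !addr0 !add0r in h1 h2.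
  apply: goal; apply: (mulfI qr).
  transitivity (a' * (r * b) * (q * c * d')); first by ring.
  by rewrite h2 -h1; ring.
Qed.

End CriticalValues.

(** * Multipliers and fixed-point multiplicities under conjugacy *)

Section FixedPoints.
Variable M : complex_model.
Local Notation C := (cnum M).
Local Notation S := (sphere C).
Implicit Types (a b c d w l : C) (x y z : S) (f g phi : S -> S) (u v : {poly C}).

Definition homog a b c d w : C := (a * w + b) / (c * w + d).

(** In the local coordinates at z and at its image the map is again a homography, finite at the base
    point: if the image is infinity, the fraction is inverted. *)
Lemma mob_local a b c d z : a * d - b * c != 0 ->
  exists a' b' c' d', [/\ a' * d' - b' * c' != 0, c' * sphere_coord z z + d' != 0 &
    forall w, c' * w + d' != 0 ->
      mob a b c d (sphere_param z w) = sphere_param (mob a b c d z) (homog a' b' c' d' w)].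
Proof.
move=> D; have key p1 p0 q1 q0 : p1 * q0 - p0 * q1 != 0 ->
    (forall w, mob a b c d (sphere_param z w) = hpt (p1 * w + p0) (q1 * w + q0)) ->
    exists a' b' c' d', [/\ a' * d' - b' * c' != 0, c' * sphere_coord z z + d' != 0 &
    forall w, c' * w + d' != 0 ->
      mob a b c d (sphere_param z w) = sphere_param (mob a b c d z) (homog a' b' c' d' w)].
  move=> Dp E; have := E (sphere_coord z z); rewrite sphere_param_coord.
  have nz := det_neq0 Dp (_ : (sphere_coord z z != 0) || (1 != 0)).
  rewrite oner_neq0 orbT !mulr1 in nz; have {}nz := nz isT.
  have [q0' Ez|q0' Ez] := eqVneq (q1 * sphere_coord z z + q0) 0.
    rewrite q0' eqxx orbF in nz.
    exists q1, q0, p1, p0; split=> //; first by rewrite -oppr_eq0 opprB mulrC [q1 * p0]mulrC.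
    move=> w pw; rewrite E Ez q0' /hpt eqxx /homog /=.
    have [->|qw] := eqVneq (q1 * w + q0) 0; first by rewrite mul0r eqxx.
    by rewrite mulf_eq0 invr_eq0 (negbTE qw) (negbTE pw) /= invf_div.
  exists p1, p0, q1, q0; split=> // w qw.
  by rewrite E Ez /hpt (negbTE q0') (negbTE qw).
case: z => [z|] in key *.
  apply: (key a b c d D) => w; have -> : sphere_param (Some z) w = hpt w 1.
    by rewrite /hpt oner_eq0 divr1.
  by rewrite mob_hpt ?oner_neq0 ?orbT // !mulr1.
apply: (key b a d c) => [|w]; first by rewrite -oppr_eq0 opprB mulrC [d * a]mulrC.
have -> : sphere_param None w = hpt 1 w by rewrite /hpt div1r.
by rewrite mob_hpt ?oner_neq0 // !mulr1 ![_ + _ * w]addrC.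
Qed.

Section Homography.
Variables (a b c d z : C).
Hypotheses (D : a * d - b * c != 0) (hz : c * z + d != 0).

Local Notation k := (homog a b c d).

Lemma homogB w w' : c * w + d != 0 -> c * w' + d != 0 ->
  k w - k w' = (a * d - b * c) * (w - w') / ((c * w + d) * (c * w' + d)).
Proof. by move=> hw hw'; rewrite /homog; field; rewrite hw hw'. Qed.

Lemma cvg_affine a' b' (z' : C) : (fun w => a' * w + b') @ z' --> a' * z' + b'.
Proof.
apply: cvgCD; last exact: cvgC_cst.
by apply: cvgCM; [exact: cvgC_cst|].
Qed.

Lemma near_den : \forall w \near z, c * w + d != 0.
Proof. exact: (near_neq0 hz (@cvg_affine c d z)). Qed.

Lemma cvg_homog : k @ z --> k z.
Proof.
apply: cvgCM; first exact: cvg_affine.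
by apply: cvgCV => //; exact: cvg_affine.
Qed.

Lemma homog_dnbhs : k @ z^' --> (k z)^'.
Proof.
move=> A /dnbhs_cabsP[e e0 eA].
have : nbhs (k z) [set w | cabs (w - k z) < e] by apply/nbhs_cabsP; exists e.
move=> /cvg_homog /nbhs_cabsP[e1 e10 h1].
have /nbhs_cabsP[e2 e20 h2] := near_den.
apply/dnbhs_cabsP; exists (Num.min e1 e2); first by rewrite lt_min e10.
move=> w wz; rewrite lt_min => /andP[/h1 w1 /h2 w2]; apply: eA => //.
by rewrite -subr_eq0 homogB // !mulf_neq0 // ?invr_eq0 ?mulf_neq0 // subr_eq0.
Qed.

End Homography.

Lemma homogK a b c d w : a * d - b * c != 0 -> c * w + d != 0 ->
  - c * homog a b c d w + a != 0 /\ homog d (- b) (- c) a (homog a b c d w) = w.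
Proof.
move=> D hw; have E : - c * homog a b c d w + a = (a * d - b * c) / (c * w + d).
  by rewrite /homog; field.
split; first by rewrite E mulf_neq0 ?invr_eq0.
rewrite {1}/homog E /homog; field.
by rewrite hw D.
Qed.

(** Source and target use the same coordinate, as is appropriate at a fixed point, infinity
    included. *)
Definition local_frac g z u v :=
  v.[sphere_coord z z] != 0 /\
  forall w, v.[w] != 0 -> g (sphere_param z w) = sphere_param z (u.[w] / v.[w]).

Lemma local_frac_fix g z u v : local_frac g z u v -> g z = z ->
  u.[sphere_coord z z] / v.[sphere_coord z z] = sphere_coord z z.
Proof.
move=> [v0 h] gz; have := h _ v0; rewrite sphere_param_coord gz => e.
by rewrite -[LHS](sphere_paramK z) -e.
Qed.

(* [G] is the local form of the conjugate map at the corresponding point. *)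
Lemma local_rep_conjugate f g z u v a b c d : a * d - b * c != 0 ->
  f \o mob a b c d = mob a b c d \o g -> local_frac g z u v -> g z = z ->
  let z0 := sphere_coord z z in let F w := u.[w] / v.[w] in
  exists a' b' c' d', [/\ a' * d' - b' * c' != 0, c' * z0 + d' != 0,
    homog a' b' c' d' z0 = sphere_coord (mob a b c d z) (mob a b c d z) &
    \forall w \near z0, [/\ v.[w] != 0, c' * w + d' != 0, c' * F w + d' != 0 &
      local_rep f (mob a b c d z) (homog a' b' c' d' w) = homog a' b' c' d' (F w)]].
Proof.
move=> D e fr gz z0 F; have [v0 gE] := fr.
have F0 : F z0 = z0 := local_frac_fix fr gz.
have [a' [b' [c' [d' [D' h0 h]]]]] := mob_local z D.
have e' x : f (mob a b c d x) = mob a b c d (g x) by exact: (congr1 (fun k => k x) e).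
exists a', b', c', d'; split=> //.
  by rewrite -[LHS](sphere_paramK (mob a b c d z)) -h // sphere_param_coord.
have cF : F @ z0 --> F z0.
  apply: cvgCM; first exact: (@cvg_poly M u z0).
  by apply: cvgCV; [exact: v0|exact: (@cvg_poly M v z0)].
have cF' : (fun w => c' * F w + d') @ z0 --> c' * F z0 + d'.
  apply: cvgCD; last exact: cvgC_cst.
  by apply: cvgCM; [exact: cvgC_cst|exact: cF].
have nF : \forall w \near z0, c' * F w + d' != 0.
  by apply: (near_neq0 _ cF'); rewrite F0.
have /nbhs_cabsP[e1 e10 h1] := near_poly_neq0 v0.
have /nbhs_cabsP[e2 e20 h2] := near_den h0.
have /nbhs_cabsP[e3 e30 h3] := nF.
apply/nbhs_cabsP; exists (Num.min e1 (Num.min e2 e3)); first by rewrite !lt_min e10 e20.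
move=> w; rewrite !lt_min => /and3P[/h1 w1 /h2 w2 /h3 w3]; split=> //.
by rewrite /local_rep e' gz -(h _ w2) e' (gE _ w1) (h _ w3) sphere_paramK.
Qed.

(** For a homography k, the difference quotient of k o F o k^-1 at k(z0) is that of F at z0 times
    (c'w + d') / (c'F(w) + d'), which tends to 1. *)
Lemma multiplier_conjugate f g z u v a b c d : a * d - b * c != 0 ->
  f \o mob a b c d = mob a b c d \o g -> local_frac g z u v -> g z = z ->
  multiplier f (mob a b c d z) =
    (wronskian u v).[sphere_coord z z] / v.[sphere_coord z z] ^+ 2.
Proof.
move=> D e fr gz.
have [a' [b' [c' [d' [D' h0 hz nG]]]]] := local_rep_conjugate D e fr gz.
move: nG h0 hz; set z0 := sphere_coord z z; set F := fun w => u.[w] / v.[w] => nG h0 hz.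
have F0 : F z0 = z0 := local_frac_fix fr gz.
rewrite /multiplier /local_deriv -hz; set G := local_rep f _ in nG *.
apply: derive1_cvg; set k := homog a' b' c' d' in nG hz *.
have [v0 _] := fr.
have cF : F @ z0 --> z0.
  rewrite -{2}F0; apply: cvgCM; first exact: (@cvg_poly M u z0).
  by apply: cvgCV; [exact: v0|exact: (@cvg_poly M v z0)].
have dF : (F w - F z0) / (w - z0) @[w --> z0^'] --> (wronskian u v).[z0] / v.[z0] ^+ 2.
  have := frac_ratio_cvg v0 (fun w _ => erefl (F w)).
  by rewrite /wronskian !(hornerD, hornerM, hornerN).
have cA (p : C -> C) : p @ z0 --> z0 -> (fun w => c' * p w + d') @ z0 --> c' * z0 + d'.
  move=> cp; apply: cvgCD; last exact: cvgC_cst.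
  by apply: cvgCM; [exact: cvgC_cst|exact: cp].
pose H w := (F w - F z0) / (w - z0) * ((c' * w + d') / (c' * F w + d')).
have cH : H @ z0^' --> (wronskian u v).[z0] / v.[z0] ^+ 2.
  rewrite -[X in _ --> X]mulr1 -(divff h0); apply: cvgCM; first exact: dF.
  apply: cvg_dnbhs; apply: cvgCM; first exact: (cA id).
  by apply: cvgCV; [|exact: (cA F)].
have [hk kz] := homogK D' h0.
have Dk : d' * a' - (- b') * (- c') != 0 by rewrite mulrNN mulrC.
have cki : homog d' (- b') (- c') a' @ (k z0)^' --> z0^'.
  by rewrite -[z0 in X in _ --> X]kz; exact: homog_dnbhs Dk hk.
have cki' : homog d' (- b') (- c') a' @ (k z0) --> z0.
  by rewrite -[z0 in X in _ --> X]kz; exact: cvg_homog hk.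
have cHk : (H \o homog d' (- b') (- c') a') @ (k z0)^' --> (wronskian u v).[z0] / v.[z0] ^+ 2.
  exact: cvg_comp cki cH.
apply: (cvgC_near _ cHk).
have /nbhs_cabsP[e1 e10 h1] := cki' _ nG.
have /nbhs_cabsP[e2 e20 h2] := near_den hk.
exists (Num.min e1 e2); first by rewrite lt_min e10.
move=> y yz; rewrite lt_min => /andP[/h1 /= [vw w1 w2 Gw] /h2 y2].
have [_ ky] := homogK Dk y2; rewrite !opprK -/k in ky.
set w := homog d' (- b') (- c') a' y in vw w1 w2 Gw ky *.
have wz : w - z0 != 0.
  by rewrite subr_eq0; apply: contraNneq yz => wz0; rewrite -ky wz0.
have [_ _ _ Gz] := nbhs_singleton nG.
have w3 : c' * (u.[z0] / v.[z0]) + d' != 0 by rewrite -/(F z0) F0.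
rewrite /H -[in RHS]ky Gw Gz /k !homogB // ?F0 //.
by rewrite -/(F w) -/(F z0) F0 in w2 *; field; rewrite w1 w2 h0 D' wz.
Qed.

Lemma fixed_multiplicity_conjugate f g z u v (P : {poly C}) j m a b c d :
  a * d - b * c != 0 ->
  f \o mob a b c d = mob a b c d \o g -> local_frac g z u v -> g z = z ->
  u - 'X * v = P * ('X - (sphere_coord z z)%:P) ^+ j -> P.[sphere_coord z z] != 0 ->
  fixed_multiplicity f (mob a b c d z) m -> m = j.
Proof.
move=> D e fr gz uv P0.
have fz : f (mob a b c d z) = mob a b c d z.
  by rewrite -[LHS]/((f \o mob a b c d) z) e /= gz.
rewrite /fixed_multiplicity fz eqxx => -[l l0 hl].
have [a' [b' [c' [d' [D' h0 hz nG]]]]] := local_rep_conjugate D e fr gz.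
move: nG h0 hz P0 uv; set z0 := sphere_coord z z; set F := fun w => u.[w] / v.[w] => nG h0 hz P0 uv.
have F0 : F z0 = z0 := local_frac_fix fr gz.
rewrite -hz in hl; set G := local_rep f _ in nG hl.
set k := homog a' b' c' d' in nG hz hl.
have [v0 _] := fr; rewrite -/z0 in v0.
have hlk : (fun w => (G (k w) - k w) / (k w - k z0) ^+ m) @ z0^' --> l.
  by move=> A /hl; exact: homog_dnbhs.
(* The inverse of the factor by which the quotient in [hlk] differs from (w - z0)^(j - m); it has a
   finite nonzero value at z0. *)
pose X w := (v.[w] * (c' * F w + d') * (c' * w + d')) / (P.[w] * (a' * d' - b' * c')) *
   ((a' * d' - b' * c') / ((c' * w + d') * (c' * z0 + d'))) ^+ m.
have cF : F @ z0 --> z0.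
  rewrite -{2}F0; apply: cvgCM; first exact: (@cvg_poly M u z0).
  by apply: cvgCV; [exact: v0|exact: (@cvg_poly M v z0)].
have cA (p : C -> C) : p @ z0 --> z0 -> (fun w => c' * p w + d') @ z0 --> c' * z0 + d'.
  move=> cp; apply: cvgCD; last exact: cvgC_cst.
  by apply: cvgCM; [exact: cvgC_cst|exact: cp].
have cX : X @ z0^' --> X z0.
  apply: cvg_dnbhs; rewrite /X F0; apply: cvgCM.
    apply: cvgCM.
      apply: cvgCM; last exact: (cA id).
      by apply: cvgCM; [exact: (@cvg_poly M v z0)|exact: (cA F)].
    apply: cvgCV; first by rewrite mulf_neq0.
    by apply: cvgCM; [exact: (@cvg_poly M P z0)|exact: cvgC_cst].
  apply: cvgCX; apply: cvgCM; first exact: cvgC_cst.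
  apply: cvgCV; first by rewrite mulf_neq0.
  by apply: cvgCM; [exact: (cA id)|exact: cvgC_cst].
have X0 : X z0 != 0.
  by rewrite /X F0 !(mulf_neq0, expf_neq0, invr_eq0).
suff hr : (w - z0) ^+ j / (w - z0) ^+ m @[w --> z0^'] --> l * X z0.
  by apply/esym; apply: pow_ratio_cvg hr; rewrite mulf_neq0.
apply: (cvgC_near _ (cvgCM hlk cX)).
have /nbhs_cabsP[e1 e10 h1] := nG.
have /nbhs_cabsP[e2 e20 h2] := near_poly_neq0 P0.
exists (Num.min e1 e2); first by rewrite lt_min e10.
move=> w wz; rewrite lt_min => /andP[/h1 [vw w1 w2 Gw] /h2 Pw].
have wz0 : w - z0 != 0 by rewrite subr_eq0.
have Fw : F w - w = P.[w] * (w - z0) ^+ j / v.[w].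
  have /(congr1 (fun q => q.[w])) := uv.
  rewrite !(hornerD, hornerM, hornerN, horner_exp, hornerX, hornerC) => <-.
  by rewrite /F; field.
rewrite /= Gw /X -/(F w) /k !homogB // Fw !expr_div_n !exprMn.
rewrite -/(F w) in w2 *.
field; rewrite !(expf_neq0, mulf_neq0) //.
by rewrite D' Pw w1 w2 vw.
Qed.

Lemma fixed_multiplicity_frac g z u v (P : {poly C}) j :
  local_frac g z u v -> g z = z ->
  u - 'X * v = P * ('X - (sphere_coord z z)%:P) ^+ j -> P.[sphere_coord z z] != 0 ->
  fixed_multiplicity g z j.
Proof.
move=> [v0 gE] gz uv P0; rewrite /fixed_multiplicity gz eqxx.
move: v0 uv P0; set z0 := sphere_coord z z => v0 uv P0.
exists (P.[z0] / v.[z0]); first by rewrite mulf_neq0 ?invr_eq0.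
have h : P.[w] / v.[w] @[w --> z0^'] --> P.[z0] / v.[z0].
  apply: cvg_dnbhs; apply: cvgCM; first exact: (@cvg_poly M P z0).
  by apply: cvgCV; [|exact: (@cvg_poly M v z0)].
apply: (cvgC_near _ h); have /nbhs_cabsP[e e0 he] := near_poly_neq0 v0.
exists e => // w wz /he vw; rewrite /local_rep gz gE // sphere_paramK.
have wz0 : w - z0 != 0 by rewrite subr_eq0.
have /(congr1 (fun q => q.[w])) := uv.
rewrite !(hornerD, hornerM, hornerN, horner_exp, hornerX, hornerC) => E.
have -> : u.[w] / v.[w] - w = (u.[w] - w * v.[w]) / v.[w] by field.
by rewrite E mulrAC mulfK // expf_neq0.
Qed.

End FixedPoints.

(** * Power sums of the roots of x^(n+1) - a x^n + d x - b *)

Section PowerSums.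
Variable F : fieldType.
Implicit Types (a b d x : F) (r : seq F) (P Q : {poly F}).

(** The logarithmic derivative. Comparison of coefficients in this identity gives Newton's
    identities. *)
Lemma deriv_prod_XsubC r :
  (\prod_(x <- r) ('X - x%:P))^`() =
  \sum_(x <- r) (\prod_(y <- r) ('X - y%:P)) %/ ('X - x%:P).
Proof.
elim: r => [|y r IH]; first by rewrite !big_nil -polyC1 derivC.
rewrite [in LHS]big_cons derivM derivXsubC mul1r IH [in RHS]big_cons big_cons.
rewrite mulKp ?polyXsubC_eq0 //; congr (_ + _); rewrite mulr_sumr.
rewrite [LHS]big_seq [RHS]big_seq; apply: eq_bigr => x xr; rewrite divp_mulA // dvdp_XsubCl.
by rewrite root_prod_XsubC.
Qed.

Section Trinomial.
Variables (n : nat) (a d b : F) (r : seq F).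
Hypothesis n2 : (2 <= n)%N.
Hypothesis rE : \prod_(x <- r) ('X - x%:P) = 'X^(n.+1) - a *: 'X^n + d *: 'X - b%:P.

Let n0 : (0 < n)%N. Proof. exact: ltnW. Qed.
Let Phi : {poly F} := 'X^(n.+1) - a *: 'X^n + d *: 'X - b%:P.

Let coefPhi k : Phi`_k = (k == n.+1)%:R - a * (k == n)%:R + d * (k == 1%N)%:R - (if k == 0%N then b else 0).
Proof. by rewrite !(coefB, coefD, coefZ, coefXn, coefX, coefC). Qed.

Let n11 : (n == 1%N) = false. Proof. by rewrite gtn_eqF. Qed.
Let nn1 : (n == n.+1) = false. Proof. by rewrite ltn_eqF. Qed.
Let n01 : (n == 0%N) = false. Proof. by rewrite gtn_eqF. Qed.

Lemma trinomial_size : size r = n.+1.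
Proof.
have : size (\prod_(x <- r) ('X - x%:P)) = (size r).+1 by rewrite size_prod_XsubC.
rewrite rE -/Phi => e; apply/eqP; rewrite eqn_leq; apply/andP; split.
  rewrite -ltnS -e; apply/leq_sizeP => j nj; rewrite coefPhi.
  by rewrite !gtn_eqF ?(leq_trans _ nj) // !mulr0 subr0 addr0 subr0.
rewrite -ltnS -e ltnNge; apply/negP => /leq_sizeP/(_ _ (leqnn _)); rewrite coefPhi eqxx.
rewrite (gtn_eqF (ltnSn n)) eqSS n01 /= !mulr0 !subr0 addr0 => /eqP.
by rewrite oner_eq0.
Qed.

Let q x := Phi %/ ('X - x%:P).

(** Synthetic division by X - x, from the top coefficient down. *)
Let q_rec x k : x \in r -> (q x)`_k = Phi`_k.+1 + x * (q x)`_k.+1.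
Proof.
move=> xr; have e : Phi = q x * ('X - x%:P).
  by rewrite /q divpK // dvdp_XsubCl /Phi -rE root_prod_XsubC.
by rewrite [in RHS]e mulrBr coefB coefMX coefMC /=; ring.
Qed.

Let q_high x k : x \in r -> (n < k)%N -> (q x)`_k = 0.
Proof.
move=> xr nk; rewrite nth_default // size_divp ?polyXsubC_eq0 // size_XsubC /=.
by rewrite /Phi -rE size_prod_XsubC trinomial_size subn1.
Qed.

Let q_top x : x \in r -> (q x)`_n = 1.
Proof.
move=> xr; rewrite q_rec // q_high // mulr0 addr0 coefPhi eqxx.
by rewrite (gtn_eqF (ltnSn n)) eqSS n01 /= !mulr0 !subr0 addr0.
Qed.

Let q_mid x m : x \in r -> (m < n.-1)%N -> (q x)`_(n.-1 - m) = x ^+ m.+1 - a * x ^+ m.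
Proof.
move=> xr; elim: m => [|m IH] mn.
  rewrite subn0 q_rec // prednK // q_top // coefPhi nn1 eqxx n11 n01 /= expr1 ?expr0; ring.
rewrite q_rec //.
have -> : ((n.-1 - m.+1).+1 = n.-1 - m)%N by rewrite subnSK // ltnW.
rewrite IH ?(ltnW mn) // coefPhi.
have h1 : (n.-1 - m != n.+1)%N by rewrite ltn_eqF // ltnS (leq_trans (leq_subr _ _)) // leq_pred.
have h2 : (n.-1 - m != n)%N by rewrite ltn_eqF // (leq_ltn_trans (leq_subr _ _)) // prednK.
have h3 : (n.-1 - m != 1)%N by rewrite gtn_eqF // ltn_subRL addn1.
have h4 : (n.-1 - m != 0)%N by rewrite gtn_eqF // subn_gt0 ltnW.
by rewrite (negbTE h1) (negbTE h2) (negbTE h3) (negbTE h4) /= !exprS; ring.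
Qed.

Let q_bot x : x \in r -> (q x)`_0 = x ^+ n - a * x ^+ n.-1 + d.
Proof.
move=> xr; rewrite q_rec //.
have -> : (q x)`_1 = x ^+ n.-1 - a * x ^+ n.-2.
  have n10 : (0 < n.-1)%N by rewrite -ltnS prednK.
  have := @q_mid x n.-2 xr; rewrite prednK //.
  have -> : (n.-1 - n.-2 = 1)%N by rewrite -{1}(prednK n10) subSnn.
  by apply; rewrite ?ltn_predL.
have e : x * (x ^+ n.-1 - a * x ^+ n.-2) = x ^+ n - a * x ^+ n.-1.
  have n10 : (0 < n.-1)%N by rewrite -ltnS prednK.
  rewrite -[in x ^+ n](prednK n0) -[in X in _ = _ - a * x ^+ X](prednK n10) !exprS; ring.
by rewrite e coefPhi eqxx eqSS (eq_sym 0%N) (eq_sym 1%N) n01 n11 /=; ring.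
Qed.

Let sum_q k : \sum_(x <- r) (q x)`_k = Phi`_k.+1 *+ k.+1.
Proof.
by rewrite -coef_sum -coef_deriv /q /Phi -rE deriv_prod_XsubC.
Qed.

Let sum1 (c : F) : \sum_(x <- r) c = n.+1%:R * c.
Proof. by rewrite big_const_seq count_predT trinomial_size iter_addr addr0 mulr_natl. Qed.

(** The coefficients of [Phi] strictly between degrees 1 and n vanish, so each power sum is a times
    the previous one; the term d x first enters at exponent n. *)
Lemma trinomial_power_sum m : (m < n)%N -> (0 < m)%N -> \sum_(x <- r) x ^+ m = a ^+ m.
Proof.
case: m => // m; rewrite ltnS => mn _.
elim: m mn => [|m IH] mn.
  have := sum_q n.-1; rewrite prednK // coefPhi nn1 eqxx n11 n01 /=.
  have -> : \sum_(x <- r) (q x)`_n.-1 = \sum_(x <- r) (x ^+ 1 - a * 1).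
    rewrite [LHS]big_seq [RHS]big_seq; apply: eq_bigr => x xr.
    by have := @q_mid x 0 xr; rewrite subn0 expr0 => -> //; rewrite -ltnS prednK.
  rewrite sumrB sum1 -natr1 => e; apply: (addIr (- (n%:R + 1) * a)).
  transitivity ((0 - a * 1 + d * 0 - 0) *+ n); last by rewrite expr1 -mulr_natl; ring.
  by rewrite -e; ring.
have mn1 : (m.+1 < n.-1)%N by rewrite -ltnS prednK.
have := sum_q (n.-1 - m.+1)%N.
have -> : \sum_(x <- r) (q x)`_(n.-1 - m.+1) = \sum_(x <- r) (x ^+ m.+2 - a * x ^+ m.+1).
  by rewrite [LHS]big_seq [RHS]big_seq; apply: eq_bigr => x xr; rewrite q_mid.
rewrite sumrB -mulr_sumr IH ?(ltnW mn) // coefPhi -subSS prednK //.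
have -> : ((n - m.+2).+1 = n - m.+1)%N by rewrite subnSK // ltnW.
have h1 : (n - m.+1 != n.+1)%N by rewrite ltn_eqF // ltnS leq_subr.
have h2 : (n - m.+1 != n)%N by rewrite ltn_eqF // ltn_subrL n0.
have h3 : (n - m.+1 != 1)%N by rewrite gtn_eqF // ltn_subRL addn1.
have h4 : (n - m.+1 != 0)%N by rewrite gtn_eqF // subn_gt0 ltnW.
rewrite (negbTE h1) (negbTE h2) (negbTE h3) (negbTE h4) /= !mulr0 !subr0 addr0 mul0rn.
by move=> /eqP; rewrite subr_eq0 => /eqP ->; rewrite [RHS]exprS.
Qed.

Lemma trinomial_power_sum_n : \sum_(x <- r) x ^+ n = a ^+ n - n%:R * d.
Proof.
have := sum_q 0; rewrite coefPhi eqxx eqSS (eq_sym 0%N) (eq_sym 1%N) n01 n11 /= mulr1n.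
have -> : \sum_(x <- r) (q x)`_0 = \sum_(x <- r) (x ^+ n - a * x ^+ n.-1 + d * 1).
  by rewrite [LHS]big_seq [RHS]big_seq; apply: eq_bigr => x xr; rewrite q_bot // mulr1.
rewrite big_split /= sum1 sumrB -mulr_sumr trinomial_power_sum ?prednK //; last first.
  by rewrite -ltnS prednK.
have -> : a * a ^+ n.-1 = a ^+ n by rewrite -exprS prednK.
rewrite -natr1 => e; transitivity (0 - a * 0 + d * 1 - 0 + a ^+ n - (n%:R + 1) * (d * 1)).
  by rewrite -e; ring.
ring.
Qed.

(** Write S_m and T_j for the sums of x^m and x^-j. Division of the root equation by x^j gives b T_j
    = S_(n+1-j) - a S_(n-j) + d T_(j-1). The S terms cancel for 1 < j < n, so T_j = (d/b)^j up to n
    - 1, and the term -n a/b appears at j = n because S_0 = n + 1. *)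
Lemma trinomial_inv_power_sum_n : b != 0 ->
  \sum_(x <- r) x^-1 ^+ n = (d / b) ^+ n - n%:R * (a / b).
Proof.
move=> b0; pose T j := \sum_(x <- r) x^-1 ^+ j.
have rec j : (0 < j)%N -> (j <= n)%N ->
    b * T j = \sum_(x <- r) x ^+ (n.+1 - j) - a * (\sum_(x <- r) x ^+ (n - j)) + d * T j.-1.
  move=> j0 jn; rewrite /T !mulr_sumr -sumrB -big_split /= [LHS]big_seq [RHS]big_seq.
  apply: eq_bigr => x xr.
  have : root Phi x by rewrite /Phi -rE root_prod_XsubC.
  rewrite rootE /Phi !(hornerD, hornerN, hornerZ, hornerXn, hornerX, hornerC) => /eqP e.
  have x0 : x != 0.
    apply: contraNneq b0 => x0; move: e; rewrite x0 !expr0n /= n01 !mulr0 subr0 addr0 sub0r.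
    by move/eqP; rewrite oppr_eq0.
  have xj : x ^+ j != 0 by rewrite expf_neq0.
  apply: (mulIf xj).
  have E1 : x ^+ (n.+1 - j) * x ^+ j = x ^+ n.+1 by rewrite -exprD subnK // (leq_trans jn).
  have E2 : x ^+ (n - j) * x ^+ j = x ^+ n by rewrite -exprD subnK.
  have E3 : x^-1 ^+ j * x ^+ j = 1 by rewrite -exprMn mulVf // expr1n.
  have E4 : x^-1 ^+ j.-1 * x ^+ j = x.
    by rewrite -[in x ^+ j](prednK j0) exprS mulrCA -exprMn mulVf // expr1n mulr1.
  rewrite !mulrDl !mulNr -!mulrA E1 E2 E3 E4 mulr1.
  by apply/eqP; rewrite -subr_eq0 -oppr_eq0 -{}e; apply/eqP; ring.
have T0 : T 0%N = n.+1%:R by rewrite /T; under eq_bigr do rewrite expr0; rewrite sum1 mulr1.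
have mid j : (j < n)%N -> (0 < j)%N -> T j = (d / b) ^+ j.
  case: j => // j; rewrite ltnS => jn _.
  elim: j jn => [|j IH] jn.
    apply: (mulfI b0); rewrite rec // T0 subSS subn0 trinomial_power_sum_n subn1.
    rewrite trinomial_power_sum ?prednK //; last by rewrite -ltnS prednK.
    have -> : a * a ^+ n.-1 = a ^+ n by rewrite -exprS prednK.
    by rewrite expr1 -natr1; field.
  apply: (mulfI b0); rewrite rec ?(ltnW jn) // IH ?(ltnW jn) // subSS.
  have e : (n - j.+1 = (n - j.+2).+1)%N by rewrite subnSK // ltnW.
  rewrite trinomial_power_sum ?ltn_subrL ?n0 ?subn_gt0 ?(ltnW jn) //.
  rewrite trinomial_power_sum ?ltn_subrL ?n0 ?subn_gt0 // e [a ^+ _.+1]exprS subrr add0r.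
  by rewrite [in RHS]exprS mulrA [b * _]mulrC divfK.
have S0 : \sum_(x <- r) x ^+ 0 = n.+1%:R.
  by under eq_bigr do rewrite expr0; rewrite sum1 mulr1.
apply: (mulfI b0); rewrite -/(T n) rec // subSnn subnn S0 trinomial_power_sum // expr1.
rewrite mid ?ltn_predL // ?(prednK, ltn_predL) //; last by rewrite -ltnS prednK.
have -> : (d / b) ^+ n = d / b * (d / b) ^+ n.-1 by rewrite -exprS prednK.
by rewrite -natr1; field.
Qed.

End Trinomial.
End PowerSums.

(** * Elementary symmetric functions as coefficients *)

Section ElemSym.
Variable C : numClosedFieldType.
Implicit Types (s t : seq C) (x : C).

Lemma elem_symE k s : (k <= size s)%N ->
  elem_sym k s = (\prod_(x <- s) (x%:P + 'X))`_(size s - k).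
Proof.
move=> ks; rewrite (big_nth 0) big_mkord bigA_distr coef_sum /elem_sym big_mkcond /=.
apply: eq_bigr => A _.
have -> : \prod_(i < size s) (if i \in A then (s`_i)%:P else 'X : {poly C}) =
          (\prod_(i in A) s`_i)%:P * 'X^(#|~: A|).
  rewrite (bigID (mem A)) /=; congr (_ * _).
    by rewrite rmorph_prod; apply: eq_bigr => i ->.
  rewrite (eq_bigr (fun=> 'X)) => [|i /negbTE -> //].
  rewrite prodr_const; congr ('X ^+ _); apply: eq_card => i.
  by rewrite !inE.
rewrite coefCM coefXn cardsCs finset.setCK card_ord.
have Ak : (#|A| <= size s)%N by rewrite -[X in (_ <= X)%N](card_ord (size s)) max_card.
case: eqP => [->|h]; first by rewrite eqxx mulr1.
case: eqP => [e|_]; last by rewrite mulr0.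
by exfalso; apply: h; rewrite -(subKn Ak) -e subKn.
Qed.

Lemma elem_sym_perm k s t : (k <= size s)%N -> perm_eq s t -> elem_sym k s = elem_sym k t.
Proof.
move=> ks st; have e := perm_size st; rewrite !elem_symE -?e //.
by rewrite (perm_big _ st).
Qed.

Lemma coef0_prod_addX s : (\prod_(x <- s) (x%:P + 'X))`_0 = \prod_(x <- s) x.
Proof.
elim: s => [|x s IH]; first by rewrite !big_nil coef1.
by rewrite !big_cons mulrDl coefD coefCM coefXM addr0 IH.
Qed.

Lemma coef1_prod_addX x s :
  (\prod_(y <- x :: s) (y%:P + 'X))`_1 = x * (\prod_(y <- s) (y%:P + 'X))`_1 + \prod_(y <- s) y.
Proof. by rewrite big_cons mulrDl coefD coefCM coefXM /= coef0_prod_addX. Qed.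

Lemma elem_sym_sub1 n s : size s = n.+1 ->
  elem_sym n s = (\prod_(x <- s) (x%:P + 'X))`_1.
Proof. by move=> e; rewrite elem_symE e // subSnn. Qed.

Lemma elem_sym_inv n s : size s = n.+1 -> all (fun x => x != 0) s ->
  elem_sym n s = (\prod_(x <- s) x) * \sum_(x <- s) x^-1.
Proof.
move=> e; rewrite (elem_sym_sub1 e) => {n e}.
elim: s => [|x s IH] /=; first by rewrite !big_nil mulr0 coef1.
move=> /andP[x0 /IH h]; rewrite coef1_prod_addX h !big_cons.
by rewrite mulrDr [_ * x^-1]mulrAC divff //; ring.
Qed.

End ElemSym.

(** * Lists of fixed points and their multipliers *)

Section FixedLists.
Variable M : complex_model.
Local Notation C := (cnum M).
Local Notation S := (sphere C).
Implicit Types (a b c d w : C) (z : S) (f g : S -> S) (s t : seq S) (r : seq C).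

Lemma perm_eq_count s t : (forall z, count_mem z s = count_mem z t) -> perm_eq s t.
Proof. by move=> h; apply/allP => z _ /=; rewrite h. Qed.

(* [t] lists the fixed points of [g] with multiplicity, read off local forms. *)
Definition fixed_data g t := forall z,
  (g z != z -> count_mem z t = 0%N) /\
  (g z = z -> exists u v P : {poly C}, [/\ local_frac g z u v,
     u - 'X * v = P * ('X - (sphere_coord z z)%:P) ^+ count_mem z t &
     P.[sphere_coord z z] != 0]).

Lemma fixed_data_list g t : fixed_data g t -> fixed_point_list g t.
Proof.
move=> h z; have [h1 h2] := h z; have [gz|gz] := eqVneq (g z) z.
  have [u [v [P [fr uv P0]]]] := h2 gz.
  exact: fixed_multiplicity_frac fr gz uv P0.
by rewrite /fixed_multiplicity (negbTE gz) h1.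
Qed.

(** The conjugacy pulls s back to a list with the same multiplicities as t, and multipliers are
    preserved. Hence [sigma] does not depend on the representative or on the list. *)
Lemma fixed_list_multipliers f g s t : conjugate g f -> fixed_data g t ->
  fixed_point_list f s ->
  perm_eq [seq multiplier f z | z <- s] [seq multiplier g z | z <- t].
Proof.
move=> [_ /rational_map1P[a [b [c [d [D ->]]]]] e] h hs.
have [D' K1 K2] := mobVK D.
have k1 x : mob d (- b) (- c) a (mob a b c d x) = x by exact: (congr1 (fun F => F x) K1).
have k2 x : mob a b c d (mob d (- b) (- c) a x) = x by exact: (congr1 (fun F => F x) K2).
have e' x : f (mob a b c d x) = mob a b c d (g x) by exact: (congr1 (fun k => k x) e).
pose s' := [seq mob d (- b) (- c) a z | z <- s].
have sE : s = [seq mob a b c d z | z <- s'].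
  by rewrite -map_comp -[LHS]map_id; apply: eq_map => z /=; rewrite k2.
have cnt z : count_mem z s' = count_mem z t.
  have c1 : count_mem z s' = count_mem (mob a b c d z) s.
    rewrite count_map; apply: eq_count => x /=.
    by apply/eqP/eqP => [<-|->]; rewrite ?k1 ?k2.
  have := hs (mob a b c d z); rewrite -c1; have [h1 h2] := h z.
  have [gz|gz] := eqVneq (g z) z.
    have [u [v [P [fr uv P0]]]] := h2 gz.
    exact: (fixed_multiplicity_conjugate D e fr gz uv P0).
  rewrite /fixed_multiplicity e' (inj_eq (can_inj k1)) (negbTE gz) => ->.
  by rewrite h1.
have pst := perm_eq_count cnt.
have mE z : z \in t -> multiplier f (mob a b c d z) = multiplier g z.
  move=> zt; have [h1 h2] := h z.
  have gz : g z = z.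
    by apply/eqP; apply: contraTT zt => /h1 /eqP; rewrite -leqn0 leqNgt -has_count has_pred1.
  have [u [v [P [fr uv P0]]]] := h2 gz.
  rewrite (multiplier_conjugate D e fr gz).
  have D1 : (1 : C) * 1 - 0 * 0 != 0 by rewrite mulr1 mul0r subr0 oner_neq0.
  have := multiplier_conjugate D1 (_ : g \o mob 1 0 0 1 = mob 1 0 0 1 \o g) fr gz.
  by rewrite mob_id => ->.
rewrite {1}sE -map_comp; apply: (perm_trans (perm_map _ pst)).
by rewrite (_ : map _ t = [seq multiplier g z | z <- t]) //; apply/eq_in_map => z /mE.
Qed.

Lemma prod_XsubC_split r w : exists2 P : {poly C},
  \prod_(x <- r) ('X - x%:P) = P * ('X - w%:P) ^+ count_mem w r & P.[w] != 0.
Proof.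
elim: r => [|x r [P e P0]].
  by exists 1; rewrite ?big_nil ?mulr1 ?hornerC ?oner_neq0.
rewrite big_cons e /=; have [->|xw] := eqVneq x w.
  by exists P; rewrite // add1n exprS; ring.
exists (('X - x%:P) * P); first by rewrite add0n; ring.
by rewrite hornerM !hornerE mulf_neq0 // subr_eq0 eq_sym.
Qed.

(** Numerator minus X times denominator is minus the trinomial. With leading denominator coefficient
    1, infinity goes to a and is not fixed. *)
Lemma fixed_data_normal_form n a b d r : (2 <= n)%N -> a * d - b * 1 != 0 ->
  \prod_(x <- r) ('X - x%:P) = 'X^(n.+1) - a *: 'X^n + d *: 'X - b%:P ->
  fixed_data (normal_form n a b 1 d) [seq Some x | x <- r].
Proof.
move=> n2 D rE; have n0 : (0 < n)%N by exact: ltnW.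
have uvE : (a *: 'X^n + b%:P) - 'X * (1 *: 'X^n + d%:P) = - \prod_(x <- r) ('X - x%:P).
  by rewrite rE exprS scale1r -!mul_polyC; ring.
case=> [w|]; last first.
  have N : normal_form n a b 1 d None = Some a.
    rewrite normal_formE //= expr0n gtn_eqF //= !mulr0 !addr0 expr1n !mulr1.
    by rewrite /hpt oner_eq0 divr1.
  rewrite N; split=> // _; rewrite count_map; apply/eqP.
  by rewrite -leqn0 leqNgt -has_count; apply/hasPn.
have cE : count_mem (Some w) [seq Some x | x <- r] = count_mem w r.
  rewrite count_map. by apply: eq_count => x /=; apply/eqP/eqP => [[->]|->].
rewrite cE; have [v0|v0] := eqVneq (1 *: 'X^n + d%:P : {poly C}).[w] 0.
  have -> : normal_form n a b 1 d (Some w) = None.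
    by rewrite /normal_form /ratfun v0 eqxx.
  split=> // _; apply/eqP; rewrite -leqn0 leqNgt -has_count has_pred1.
  have := horner_XnC_neq0 n w D; rewrite v0 eqxx orbF; apply: contra.
  rewrite -root_prod_XsubC => /rootP r0.
  have /(congr1 (fun q : {poly C} => q.[w])) := uvE.
  rewrite hornerD !hornerN hornerM v0 r0 mulr0 !oppr0 addr0 => ->.
  by [].
have gw : normal_form n a b 1 d (Some w) = Some ((a *: 'X^n + b%:P).[w] / (1 *: 'X^n + d%:P).[w]).
  by rewrite /normal_form /ratfun (negbTE v0).
have [P Pe P0] := prod_XsubC_split r w.
split=> [|_].
  rewrite gw => nw; apply/eqP; rewrite -leqn0 leqNgt -has_count has_pred1.
  apply: contra nw; rewrite -root_prod_XsubC => /rootP r0.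
  have /(congr1 (fun q : {poly C} => q.[w])) := uvE.
  rewrite hornerD !hornerN hornerM r0 oppr0 hornerX => /eqP; rewrite subr_eq0 => /eqP ->.
  by rewrite mulfK.
exists (a *: 'X^n + b%:P), (1 *: 'X^n + d%:P), (- P); split.
- split=> // x vx /=; by rewrite /normal_form /ratfun (negbTE vx).
- by rewrite uvE Pe mulNr.
- by rewrite hornerN oppr_eq0.
Qed.

Lemma multiplier_normal_form n a b d w : (2 <= n)%N -> a * d - b * 1 != 0 ->
  normal_form n a b 1 d (Some w) = Some w ->
  w ^+ n + d != 0 /\ multiplier (normal_form n a b 1 d) (Some w) =
    n%:R * w ^+ n.-1 * (a * d - b) / (w ^+ n + d) ^+ 2.
Proof.
move=> n2 D gw.
have vE : (1 *: 'X^n + d%:P : {poly C}).[w] = w ^+ n + d.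
  by rewrite !(hornerD, hornerZ, hornerXn, hornerC) mul1r.
have v0 : (1 *: 'X^n + d%:P : {poly C}).[w] != 0.
  by apply/eqP => v0; move: gw; rewrite /normal_form /ratfun v0 eqxx.
split; first by rewrite -vE.
have fr : local_frac (normal_form n a b 1 d) (Some w) (a *: 'X^n + b%:P) (1 *: 'X^n + d%:P).
  by split=> // x vx /=; rewrite /normal_form /ratfun (negbTE vx).
have D1 : (1 : C) * 1 - 0 * 0 != 0 by rewrite mulr1 mul0r subr0 oner_neq0.
have := multiplier_conjugate D1
  (_ : normal_form n a b 1 d \o mob 1 0 0 1 = mob 1 0 0 1 \o normal_form n a b 1 d) fr gw.
rewrite mob_id => -> //; rewrite wronskian_XnC hornerZ hornerXn /= vE mulr1.
by congr (_ / _); ring.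
Qed.

End FixedLists.

(** * Evaluation of sigma_n when c = 1 *)

Section SigmaValue.
Variable M : complex_model.
Local Notation C := (cnum M).
Implicit Types (a b c d w x : C) (r : seq C).

Definition trinomial n a d b : {poly C} := 'X^(n.+1) - a *: 'X^n + d *: 'X - b%:P.

Lemma horner_trinomial n a d b x :
  (trinomial n a d b).[x] = x ^+ n.+1 - a * x ^+ n + d * x - b.
Proof. by rewrite /trinomial !(hornerD, hornerN, hornerZ, hornerXn, hornerX, hornerC). Qed.

Lemma monic_split (p : {poly C}) : p \is monic -> exists r, \prod_(x <- r) ('X - x%:P) = p.
Proof.
move=> /monicP p1; have [r e] := closed_field_poly_normal p.
by exists r; rewrite [RHS]e p1 scale1r.
Qed.

Lemma trinomial_monic n a d b : (2 <= n)%N -> trinomial n a d b \is monic.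
Proof.
move=> n2; rewrite /trinomial -!addrA monicE lead_coefDl ?lead_coefXn //.
rewrite size_polyXn ltnS (leq_trans (size_polyD _ _)) // geq_max size_polyN.
rewrite (leq_trans (size_scale_leq _ _)) ?size_polyXn //=.
rewrite (leq_trans (size_polyD _ _)) // geq_max size_polyN.
have n11 : (1 < n.+1)%N by rewrite ltnS ltnW.
rewrite (leq_trans (size_scale_leq _ _)) ?size_polyX //=.
exact: leq_trans (size_polyC_leq1 _) _.
Qed.

Lemma prod_shift r (p : {poly C}) c : \prod_(x <- r) ('X - x%:P) = p ->
  \prod_(x <- r) (x - c) = (-1) ^+ size r * p.[c].
Proof.
move=> <-; rewrite horner_prod; elim: r => [|x r IH]; first by rewrite !big_nil mulr1.
by rewrite !big_cons IH /= hornerXsubC exprS; ring.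
Qed.

Lemma prod_const_seq r c : \prod_(x <- r) c = c ^+ size r.
Proof. by rewrite big_const_seq count_predT; elim: (size r) => //= k ->; rewrite exprS. Qed.

Lemma sign_even n : ((-1) ^+ n) ^+ n.-1 = 1 :> C.
Proof.
case: n => [|n]; first by rewrite expr1n.
by rewrite -exprM -signr_odd oddM /= andbC; case: (odd n).
Qed.

Section Value.
Variables (n : nat) (a b d : C) (r : seq C).
Hypotheses (n2 : (2 <= n)%N) (D0 : a * d - b != 0).
Hypothesis rE : \prod_(x <- r) ('X - x%:P) = trinomial n a d b.

Let n0 : (0 < n)%N. Proof. exact: ltnW. Qed.
Let g := normal_form n a b 1 d.
Local Notation D := (a * d - b).
Let D1 : a * d - b * 1 != 0. Proof. by rewrite mulr1. Qed.

Let root_eq x : x \in r -> x ^+ n.+1 - a * x ^+ n + d * x - b = 0.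
Proof. by move=> xr; apply/eqP; rewrite -horner_trinomial -rE -rootE root_prod_XsubC. Qed.

Let root_rel x : x \in r -> (x ^+ n + d) * (x - a) = - D.
Proof.
move=> /root_eq; rewrite exprS => e.
by apply/eqP; rewrite -subr_eq0 -{}e; apply/eqP; ring.
Qed.

Let den_neq0 x : x \in r -> x ^+ n + d != 0.
Proof.
move=> /root_rel e; apply: contraNneq D0 => v0.
by rewrite -oppr_eq0 -e v0 mul0r.
Qed.

Let shift_neq0 x : x \in r -> x - a != 0.
Proof.
move=> /root_rel e; apply: contraNneq D0 => v0.
by rewrite -oppr_eq0 -e v0 mulr0.
Qed.

Let fixed x : x \in r -> g (Some x) = Some x.
Proof.
move=> xr; have v0 := den_neq0 xr.
rewrite /g /normal_form /ratfun !(hornerD, hornerZ, hornerXn, hornerC) mul1r (negbTE v0).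
congr Some; apply: (mulIf v0); rewrite divfK //; apply/eqP; rewrite -subr_eq0 -oppr_eq0.
by rewrite -(root_eq xr) exprS; apply/eqP; ring.
Qed.

(** The multiplier n x^(n-1) D / (x^n + d)^2 with its denominator cleared by [root_rel]. *)
Let lam x := n%:R * x ^+ n.-1 * (x - a) ^+ 2 / D.

Let multE x : x \in r -> multiplier g (Some x) = lam x.
Proof.
move=> xr; have [v0 ->] := multiplier_normal_form n2 D1 (fixed xr).
rewrite /lam; have := root_rel xr; set v := _ + d => e.
have a0 := shift_neq0 xr.
have -> : D = - (v * (x - a)) by rewrite e opprK.
by field; rewrite a0 v0.
Qed.

Let sr : size r = n.+1. Proof. exact: trinomial_size n2 rE. Qed.

(** Here x, y, z stand for a, b, d with c = 1. In terms of the invariants this is n^n (Y + (2X + 1 -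
    n) X^(n-1)). *)
Definition sigma_value m x y z : C :=
  m%:R ^+ m * (x ^+ m.+1 * y ^+ m.-1 + z ^+ m.+1 +
    y ^+ m.-1 * ((m%:R + 1) * y - (m%:R - 1) * (x * z))) / (x * z - y) ^+ m.

(** The root equation turns 1 / lam x into a combination of x^n, 1 and x^-n, whose sums are
    known. *)
Let sum_inv : b != 0 -> \sum_(x <- r) (lam x)^-1 =
  (a * (a ^+ n - n%:R * d) + (n%:R + 1) * (a * d + b) +
    b * d * ((d / b) ^+ n - n%:R * (a / b))) / (n%:R * D).
Proof.
move=> b0; have nz : n%:R != 0 :> C by rewrite pnatr_eq0 -lt0n.
have E x : x \in r -> (lam x)^-1 =
    (a * x ^+ n + (a * d + b) + b * d * x^-1 ^+ n) / (n%:R * D).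
  move=> xr; have x0 : x != 0.
    apply: contraNneq b0 => x0; have := root_eq xr.
    by rewrite x0 !expr0n /= gtn_eqF // !mulr0 subr0 addr0 sub0r => /eqP; rewrite oppr_eq0.
  have a0 := shift_neq0 xr; have v0 := den_neq0 xr.
  have e2 := root_eq xr; rewrite /lam exprVn; move: e2 v0.
  rewrite exprS -[in x ^+ n](prednK n0) [x ^+ n.-1.+1]exprS.
  have p0 : x ^+ n.-1 != 0 by rewrite expf_neq0.
  move: (x ^+ n.-1) p0 => p p0 e2 v0.
  have bE : b = x * (x * p + d) - a * (x * p).
    by apply/eqP; rewrite eq_sym -subr_eq0 -e2; apply/eqP; ring.
  have DE : D = (x * p + d) * (a - x) by rewrite bE; ring.
  have a0' : a - x != 0 by rewrite -oppr_eq0 opprB.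
  rewrite DE bE; field.
  by rewrite v0 a0' x0 p0 nz a0.
rewrite big_seq (eq_bigr _ E) -big_seq -mulr_suml 2!big_split /= -!mulr_sumr.
rewrite (trinomial_power_sum_n n2 rE) (trinomial_inv_power_sum_n n2 rE b0).
have -> : \sum_(x <- r) (a * d + b) = (n%:R + 1) * (a * d + b).
  rewrite big_const_seq count_predT sr iter_addr addr0 mulrS -(mulr_natl (a * d + b) n); ring.
by congr (_ / _); ring.
Qed.

Let prod_lam : \prod_(x <- r) lam x =
  n%:R ^+ n.+1 * b ^+ n.-1 * D ^+ 2 / D ^+ n.+1.
Proof.
have -> : \prod_(x <- r) lam x =
    (\prod_(x <- r) n%:R) * (\prod_(x <- r) x) ^+ n.-1 *
    (\prod_(x <- r) (x - a)) ^+ 2 * (\prod_(x <- r) D^-1).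
  by rewrite -!prodrXl -!big_split.
rewrite !prod_const_seq sr (prod_shift a rE).
have -> : \prod_(x <- r) x = (-1) ^+ n * b.
  have := prod_shift 0 rE; under eq_bigr do rewrite subr0.
  move=> ->; rewrite sr horner_trinomial !expr0n /= gtn_eqF // !mulr0 subr0 addr0 sub0r exprS.
  by ring.
rewrite horner_trinomial exprMn sign_even mul1r sr exprVn; congr (_ / _).
congr (_ * _); rewrite exprMn -exprM mulnC exprM sqrrN expr1n expr1n mul1r.
by rewrite [a ^+ n.+1]exprS; congr (_ ^+ 2); ring.
Qed.

Let size_lam : size [seq multiplier g z | z <- [seq Some x | x <- r]] = n.+1.
Proof. by rewrite !size_map. Qed.

Let map_lam : [seq multiplier g z | z <- [seq Some x | x <- r]] = [seq lam x | x <- r].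
Proof. by rewrite -map_comp; apply/eq_in_map => x xr /=; exact: multE. Qed.

Let sigma_generic : b != 0 ->
  elem_sym n [seq multiplier g z | z <- [seq Some x | x <- r]] = sigma_value n a b d.
Proof.
move=> b0; have nz : n%:R != 0 :> C by rewrite pnatr_eq0 -lt0n.
rewrite elem_sym_inv // map_lam.
  rewrite !big_map sum_inv // prod_lam /sigma_value !exprS.
  have -> : (d / b) ^+ n = d ^+ n / (b * b ^+ n.-1) by rewrite expr_div_n -exprS prednK.
  have be : b ^+ n.-1 != 0 by rewrite expf_neq0.
  have De : D ^+ n != 0 by rewrite expf_neq0.
  by field; rewrite D0 De be nz b0.
apply/allP => _ /mapP[x xr ->]; rewrite /lam !mulf_neq0 ?invr_eq0 ?expf_neq0 ?shift_neq0 //.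
apply: contraNneq b0 => x0; have := root_eq xr.
by rewrite x0 !expr0n /= gtn_eqF // !mulr0 subr0 addr0 sub0r => /eqP; rewrite oppr_eq0.
Qed.

(** For b nonzero, sigma_n is the product of the multipliers times the sum of their inverses. For b
    = 0 the fixed point 0 has multiplier 0, and only the product over the other roots survives. *)
Lemma sigma_normal_form :
  elem_sym n [seq multiplier g z | z <- [seq Some x | x <- r]] = sigma_value n a b d.
Proof.
have [b0|] := eqVneq b 0; last exact: sigma_generic.
have n10 : (0 < n.-1)%N by rewrite -ltnS prednK.
have r0 : 0 \in r.
  rewrite -root_prod_XsubC rE rootE horner_trinomial b0 !expr0n /= gtn_eqF //.
  by rewrite !mulr0 subr0 addr0 subr0.
have pr := perm_to_rem r0; set r' := rem 0 r in pr.
have sr' : size r' = n by rewrite size_rem // sr.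
have rE' : \prod_(x <- r') ('X - x%:P) = 'X^n - a *: 'X^(n.-1) + d%:P.
  apply: (mulfI (_ : 'X != 0)); first by rewrite polyX_eq0.
  have := rE; rewrite (perm_big _ pr) big_cons subr0 => ->.
  rewrite /trinomial b0 subr0 mulrDr mulrBr -exprS -!mul_polyC mulrCA -exprS prednK //.
  by rewrite [d%:P * _]mulrC.
have hE c : ('X^n - a *: 'X^(n.-1) + d%:P).[c] = c ^+ n - a * c ^+ n.-1 + d.
  by rewrite !(hornerD, hornerN, hornerZ, hornerXn, hornerC).
rewrite elem_sym_sub1 // map_lam big_map (perm_big _ pr) /=.
have -> : \prod_(x <- 0 :: r') ((lam x)%:P + 'X) = \prod_(y <- [seq lam x | x <- 0 :: r']) (y%:P + 'X).
  by rewrite big_map.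
rewrite /= coef1_prod_addX {1}/lam expr0n gtn_eqF // mulr0 !mul0r add0r big_map.
have -> : \prod_(x <- r') lam x =
    (\prod_(x <- r') n%:R) * (\prod_(x <- r') x) ^+ n.-1 *
    (\prod_(x <- r') (x - a)) ^+ 2 * (\prod_(x <- r') D^-1).
  by rewrite -!prodrXl -!big_split.
rewrite !prod_const_seq sr' (prod_shift a rE').
have -> : \prod_(x <- r') x = (-1) ^+ n * d.
  have := prod_shift 0 rE'; under eq_bigr do rewrite subr0.
  by move=> ->; rewrite sr' hE !expr0n !gtn_eqF // mulr0 subr0 add0r.
rewrite hE exprMn sign_even mul1r sr' exprVn /sigma_value b0 expr0n gtn_eqF //.
rewrite mulr0 add0r !mul0r addr0; congr (_ / _); rewrite -mulrA; congr (_ * _).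
have -> : a ^+ n - a * a ^+ n.-1 + d = d by rewrite -exprS prednK // subrr add0r.
rewrite exprMn -exprM mulnC exprM sqrrN expr1n expr1n mul1r -exprD addn2 prednK //.
Qed.

End Value.
End SigmaValue.

(** * The map z^n, and the invariants of a class computed on representatives *)

Section PowerMap.
Variable M : complex_model.
Local Notation C := (cnum M).
Local Notation S := (sphere C).
Implicit Types (a b c d w x : C) (r : seq C) (z : S).

Section Power.
Variables (n : nat) (r : seq C).
Hypothesis n2 : (2 <= n)%N.
Hypothesis rE : \prod_(x <- r) ('X - x%:P) = 'X^n - 'X :> {poly C}.

Let n0 : (0 < n)%N. Proof. exact: ltnW. Qed.
Let n10 : (0 < n.-1)%N. Proof. by rewrite -ltnS prednK. Qed.
Let D : (1 : C) * 1 - 0 * 0 != 0. Proof. by rewrite mulr1 mul0r subr0 oner_neq0. Qed.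
Let g := normal_form n (1 : C) 0 0 1.

Let g_finite w : g (Some w) = Some (w ^+ n).
Proof.
rewrite /g /normal_form /ratfun !(hornerD, hornerZ, hornerXn, hornerC).
by rewrite mul0r add0r oner_eq0 mul1r addr0 divr1.
Qed.

Let g_infty w : g (sphere_param None w) = sphere_param None (w ^+ n).
Proof.
rewrite /g normal_form_param_infty // !(hornerD, hornerZ, hornerXn, hornerC).
by rewrite mul0r add0r mul1r addr0 /hpt /= div1r.
Qed.

Let frac z : local_frac g z 'X^n 1.
Proof.
split=> [|w _]; first by rewrite hornerC oner_neq0.
rewrite hornerXn hornerC divr1; case: z => [z|]; last exact: g_infty.
exact: g_finite.
Qed.

Lemma fixed_data_power : fixed_data g (None :: [seq Some x | x <- r]).
Proof.
case=> [w|].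
  have cE : count_mem (Some w) (None :: [seq Some x | x <- r]) = count_mem w r.
    by rewrite /= add0n count_map; apply: eq_count => x /=; apply/eqP/eqP => [[->]|->].
  rewrite cE g_finite; split=> [h|_].
    apply/eqP; rewrite -leqn0 leqNgt -has_count has_pred1; apply: contra h.
    rewrite -root_prod_XsubC rE rootE !(hornerD, hornerN, hornerXn, hornerX) subr_eq0.
    by move=> /eqP ->.
  have [P Pe P0] := prod_XsubC_split r w.
  by exists 'X^n, 1, P; split; [exact: (frac (Some w))|rewrite mulr1 -rE Pe|].
have gN : g None = None by have := g_infty 0; rewrite expr0n gtn_eqF //= eqxx.
rewrite gN eqxx; split=> // _; exists 'X^n, 1, ('X^(n.-1) - 1); split.
- exact: (frac None).
- rewrite /= (_ : count_mem None _ = 0%N) ?addn0 ?expr1 ?polyC0 ?subr0; last first.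
    by rewrite count_map; apply/eqP; rewrite -leqn0 leqNgt -has_count; apply/hasPn.
  by rewrite mulrBl mul1r mulr1 -exprSr prednK.
- by rewrite /= !(hornerD, hornerN, hornerXn, hornerC) expr0n gtn_eqF // sub0r oppr_eq0 oner_neq0.
Qed.

Let mult z : g z = z -> multiplier g z = n%:R * sphere_coord z z ^+ n.-1.
Proof.
move=> gz; have := multiplier_conjugate D (_ : g \o mob 1 0 0 1 = mob 1 0 0 1 \o g) (frac z) gz.
rewrite mob_id => -> //; rewrite /wronskian hornerC expr1n divr1 -polyC1 derivC mulr0 subr0.
by rewrite mulr1 derivXn hornerMn hornerXn mulr_natl.
Qed.

(** Both 0 and infinity are fixed with multiplier 0, and every product of n of the n + 1 multipliers
    contains one of them. *)
Lemma sigma_power :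
  elem_sym n [seq multiplier g z | z <- None :: [seq Some x | x <- r]] = 0.
Proof.
have sr : size r = n.
  apply: succn_inj; rewrite -(size_prod_XsubC r id) rE size_polyDl size_polyXn //.
  by rewrite size_polyN size_polyX.
have gN : g None = None by have := g_infty 0; rewrite expr0n gtn_eqF //= eqxx.
rewrite elem_sym_sub1 /= ?size_map ?sr // coef1_prod_addX mult //= expr0n gtn_eqF //.
rewrite mulr0 mul0r add0r !big_map.
have r0 : 0 \in r.
  rewrite -root_prod_XsubC rE rootE !(hornerD, hornerN, hornerXn, hornerX) expr0n gtn_eqF //.
  by rewrite subr0.
have m0 : multiplier g (Some 0) = 0.
  by rewrite mult ?g_finite /= expr0n gtn_eqF // mulr0.
by rewrite (perm_big _ (perm_to_rem r0)) big_cons m0 /= mul0r.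
Qed.

End Power.

Section Classes.
Variable n : nat.
Hypothesis n2 : (2 <= n)%N.
Implicit Types (m : moduli C n) (f g : S -> S).

Let n0 : (0 < n)%N. Proof. exact: ltnW. Qed.

Lemma conj_class_conjugate m f g : conj_class m f -> conj_class m g -> conjugate f g.
Proof.
have [h _ ->] := conj_classP m => hf hg.
exact: conjugate_trans (conjugate_sym hf) hg.
Qed.

Lemma conj_class_closed m f g : conj_class m f -> conjugate f g -> conj_class m g.
Proof. by have [h _ ->] := conj_classP m; exact: conjugate_trans. Qed.

Lemma moduli_of_normal_form a b c d : a * d - b * c != 0 ->
  exists m, conj_class m (normal_form n a b c d).
Proof.
move=> D; have P : exists2 f, bicritical n f & conjugate (normal_form n a b c d) = conjugate f.
  by exists (normal_form n a b c d) => //; exact: normal_form_bicritical.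
by exists (Moduli P); exact: conjugate_refl.
Qed.

Lemma normal_form_of_moduli m :
  exists a b c d, a * d - b * c != 0 /\ conj_class m (normal_form n a b c d).
Proof.
have [f bf e] := conj_classP m.
have [a [b [c [d [D cf]]]]] := bicritical_normal_form n2 bf.
by exists a, b, c, d; rewrite e.
Qed.

Lemma moduliXE m a b c d : a * d - b * c != 0 -> conj_class m (normal_form n a b c d) ->
  moduliX m = b * c / (a * d - b * c).
Proof.
move=> D mf; rewrite /moduliX; set P := (X in xget _ X).
have : P (xget 0 P) by apply: xgetPex; exists (b * c / (a * d - b * c)), a, b, c, d.
move=> [a' [b' [c' [d' [D' mf' ->]]]]].
exact: conjugate_invariantX n2 D' D (conj_class_conjugate mf' mf).
Qed.

Lemma sigmaE m g t : conj_class m g -> fixed_data g t -> (n <= size t)%N ->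
  sigma n m = elem_sym n [seq multiplier g z | z <- t].
Proof.
move=> mg gt nt; rewrite /sigma; set P := (X in xget _ X).
have : P (xget 0 P).
  apply: xgetPex; exists (elem_sym n [seq multiplier g z | z <- t]), g, t.
  by split=> //; exact: fixed_data_list.
move=> [f [s [mf fs ->]]].
have ps := fixed_list_multipliers (conj_class_conjugate mg mf) gt fs.
apply: (elem_sym_perm _ ps); rewrite (perm_size ps) ?size_map //.
Qed.

Lemma sigma_normal_formE m a b d : a * d - b != 0 ->
  conj_class m (normal_form n a b 1 d) -> sigma n m = sigma_value n a b d.
Proof.
move=> D mf; have [r rE] := monic_split (trinomial_monic a d b n2).
rewrite (sigmaE mf (fixed_data_normal_form n2 _ rE)) ?mulr1 //.
  exact: sigma_normal_form.
by rewrite size_map (trinomial_size n2 rE).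
Qed.

Lemma sigma_powerE m : conj_class m (normal_form n 1 0 0 1) -> sigma n m = 0.
Proof.
move=> mf; have mon : 'X^n - 'X \is @monic C.
  by rewrite monicE lead_coefDl ?lead_coefXn // size_polyN size_polyX size_polyXn.
have [r rE] := monic_split mon.
rewrite (sigmaE mf (fixed_data_power n2 rE)); first exact: sigma_power.
rewrite /= size_map -(size_prod_XsubC r id) rE size_polyDl size_polyXn //.
by rewrite size_polyN size_polyX.
Qed.

End Classes.
End PowerMap.

(** * Representatives of the classes *)

Section Representatives.
Variable M : complex_model.
Local Notation R := (creal M).
Local Notation C := (cnum M).
Local Notation S := (sphere C).
Variable n : nat.
Hypothesis n2 : (2 <= n)%N.
Implicit Types (a b c d k e x s : C) (m : moduli C n) (z : S).

Let n0 : (0 < n)%N. Proof. exact: ltnW. Qed.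

Lemma conjugate_scale a b c d k : a * d - b * c != 0 -> k != 0 ->
  conjugate (normal_form n a b c d) (normal_form n (a * k ^+ n) b (c * k ^+ n.+1) (d * k)).
Proof.
move=> D k0; have Dk : 1 * k - 0 * 0 != 0 by rewrite mul1r mul0r subr0.
have D' : a * k ^+ n * (d * k) - b * (c * k ^+ n.+1) != 0.
  have -> : a * k ^+ n * (d * k) - b * (c * k ^+ n.+1) = k ^+ n.+1 * (a * d - b * c).
    by rewrite exprS; ring.
  by rewrite mulf_neq0 ?expf_neq0.
apply: (conjugate_mob Dk); apply/funext => z /=.
rewrite (mobE _ Dk) normal_form_hpt ?det_neq0 ?hcoords_neq0 //.
rewrite (normal_formE _ n0 D) mob_hpt ?det_neq0 ?expn_neq0 ?hcoords_neq0 //.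
rewrite -[RHS](@hptZ _ (k ^+ n)) ?expf_neq0 // !mul1r !mul0r !addr0 !add0r exprMn exprS.
by congr hpt; ring.
Qed.

Lemma conjugate_swap a b c d : a * d - b * c != 0 ->
  conjugate (normal_form n a b c d) (normal_form n d c b a).
Proof.
move=> D; have Dk : (0 : C) * 0 - 1 * 1 != 0 by rewrite mul0r mul1r sub0r oppr_eq0 oner_neq0.
have D' : d * a - c * b != 0 by rewrite mulrC [c * b]mulrC.
apply: (conjugate_mob Dk); apply/funext => z /=.
rewrite (mobE _ Dk) normal_form_hpt ?det_neq0 ?hcoords_neq0 //.
rewrite (normal_formE _ n0 D) mob_hpt ?det_neq0 ?expn_neq0 ?hcoords_neq0 //.
by rewrite !mul1r !mul0r !addr0 !add0r; congr hpt; ring.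
Qed.

(** Rescaling by k with k^n = d/c makes the two denominator coefficients equal. The critical values
    e and b' then satisfy e^(n+1) b'^(n-1) = a^(n+1) b^(n-1) / (c^(n-1) d^(n+1)), the ratio of the
    two terms of Y. *)
Lemma cv_map_representative a b c d : a * d - b * c != 0 ->
  c != 0 -> d != 0 -> cabs (a ^+ n.+1 * b ^+ n.-1) <= cabs (c ^+ n.-1 * d ^+ n.+1) ->
  exists e k, [/\ k != 0, cabs e ^+ n.+1 * cabs (e - k) ^+ n.-1 <= 1 &
    conjugate (normal_form n a b c d) (cv_map n e k)].
Proof.
move=> D c0 d0 AB; pose k := n.-root (d / c); have kn : k ^+ n = d / c by exact: rootCK.
have k0 : k != 0.
  apply/eqP => k0; move: kn; rewrite k0 expr0n gtn_eqF //= => /esym/eqP.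
  by rewrite mulf_eq0 invr_eq0 (negbTE c0) (negbTE d0).
have dk0 : d * k != 0 by rewrite mulf_neq0.
pose e := a * k ^+ n / (d * k); pose b' := b / (d * k).
exists e, (e - b'); have eb : e - (e - b') = b' by ring.
have E : e - b' = (a * d - b * c) / (c * (d * k)).
  by rewrite /e /b' kn; field; rewrite c0 d0 k0.
split.
- by rewrite E mulf_neq0 ?invr_eq0 ?mulf_neq0.
- rewrite eb -!cabsX -cabsM.
  have e1 : e = a * k ^+ n.-1 / d.
    by rewrite /e -[in k ^+ n](prednK n0) exprS; field; rewrite d0 k0.
  have -> : e ^+ n.+1 * b' ^+ n.-1 = (a ^+ n.+1 * b ^+ n.-1) / (c ^+ n.-1 * d ^+ n.+1).
    rewrite e1 /b' !expr_div_n !exprMn -exprM mulnC exprM.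
    have -> : (k ^+ n.+1) ^+ n.-1 = (k ^+ n) ^+ n.-1 * k ^+ n.-1 by rewrite -exprMn -exprSr.
    rewrite kn expr_div_n.
    have p0 : k ^+ n.-1 != 0 by rewrite expf_neq0.
    have q0 : c ^+ n.-1 != 0 by rewrite expf_neq0.
    have r0 : d ^+ n.-1 != 0 by rewrite expf_neq0.
    have s0 : d ^+ n.+1 != 0 by rewrite expf_neq0.
    by field; rewrite p0 q0 r0 s0.
  rewrite cabsM cabsV ler_pdivrMr ?mul1r // cabs_gt0.
  by rewrite mulf_neq0 ?expf_neq0.
- have h : c * k ^+ n.+1 = d * k by rewrite exprS mulrCA kn; field.
  have := conjugate_scale D k0; rewrite h.
  have -> : normal_form n (a * k ^+ n) b (d * k) (d * k) = cv_map n e (e - b').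
    rewrite /cv_map eb -(@normal_formZ _ n (d * k) e b' 1 1) //.
      by congr normal_form; rewrite ?mulr1 // /e /b' [RHS]mulrC divfK.
    by rewrite !mulr1 E mulf_neq0 ?invr_eq0 ?mulf_neq0.
  by [].
Qed.

(** Exchanging 0 and infinity swaps the two terms of Y, so the first may be assumed the smaller. If
    cd = 0 then both vanish, and the determinant leaves only a = d = 0 or b = c = 0. *)
Lemma representative_cases m :
  [\/ conj_class m (normal_form n 1 0 0 1),
      exists2 b, b != 0 & conj_class m (normal_form n 0 b 1 0) |
      exists e k, [/\ k != 0, cabs e ^+ n.+1 * cabs (e - k) ^+ n.-1 <= 1 &
        conj_class m (cv_map n e k)]].
Proof.
have [a [b [c [d [D mf]]]]] := normal_form_of_moduli n2 m.
have n10 : (0 < n.-1)%N by rewrite -ltnS prednK.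
wlog AB : a b c d D mf / cabs (a ^+ n.+1 * b ^+ n.-1) <= cabs (c ^+ n.-1 * d ^+ n.+1).
  move=> hw; have [|/ltW AB] := lerP (cabs (a ^+ n.+1 * b ^+ n.-1)) (cabs (c ^+ n.-1 * d ^+ n.+1)).
    exact: hw.
  apply: (hw d c b a); first by rewrite mulrC [c * b]mulrC.
    exact: conj_class_closed mf (conjugate_swap D).
  by rewrite mulrC [b ^+ _ * _]mulrC.
have [cd|cd] := eqVneq (c * d) 0; last first.
  have /andP[c0 d0] : (c != 0) && (d != 0) by rewrite -negb_or -mulf_eq0.
  have [e [k [k0 ek ck]]] := cv_map_representative D c0 d0 AB.
  apply: Or33; exists e, k; split=> //; exact: conj_class_closed mf ck.
have : cabs (a ^+ n.+1 * b ^+ n.-1) <= 0.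
  apply: le_trans AB _; rewrite (_ : _ * _ = 0) ?cabs0 //.
  move/eqP: cd; rewrite mulf_eq0 => /orP[/eqP ->|/eqP ->].
    by rewrite expr0n gtn_eqF // mul0r.
  by rewrite expr0n mulr0.
rewrite le_eqVlt ltNge cabs_ge0 orbF cabs_eq0 mulf_eq0 !expf_eq0 n10 /=.
move/eqP: cd; rewrite mulf_eq0 => cd /orP[/eqP a0|/eqP b0].
  have bc : b * c != 0 by move: D; rewrite a0 mul0r sub0r oppr_eq0.
  have [b0 c0] : b != 0 /\ c != 0 by apply/andP; rewrite -negb_or -mulf_eq0.
  have d0 : d = 0 by apply/eqP; move: cd; rewrite (negbTE c0).
  apply: Or32; exists (b / c); first by rewrite mulf_neq0 ?invr_eq0.
  move: mf; rewrite a0 d0 -(@normal_formZ _ n c^-1 0 b c 0) ?invr_eq0 //; last first.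
    by rewrite mul0r sub0r oppr_eq0.
  by rewrite !mulr0 mulVf // [c^-1 * b]mulrC.
have ad : a * d != 0 by move: D; rewrite b0 mul0r subr0.
have [a0 d0] : a != 0 /\ d != 0 by apply/andP; rewrite -negb_or -mulf_eq0.
have c0 : c = 0 by apply/eqP; move: cd; rewrite (negbTE d0) orbF.
pose k := n.-1.-root (d / a); have kn : k ^+ n.-1 = d / a by exact: rootCK.
have k0 : k != 0.
  apply/eqP => k0; move: kn; rewrite k0 expr0n gtn_eqF //= => /esym/eqP.
  by rewrite mulf_eq0 invr_eq0 (negbTE a0) (negbTE d0).
apply: Or31; have := conj_class_closed mf (conjugate_scale D k0).
have -> : a * k ^+ n = d * k by rewrite -(prednK n0) exprS kn; field.
rewrite b0 c0 mul0r -(@normal_formZ _ n (d * k)^-1) ?invr_eq0 ?mulf_neq0 //.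
  by rewrite !mulr0 mulVf // mulf_neq0.
by rewrite mul0r subr0 !mulf_neq0.
Qed.

Lemma moduliX_cv m e k : k != 0 -> conj_class m (cv_map n e k) -> moduliX m = (e - k) / k.
Proof.
move=> k0 mf; have D : e * 1 - (e - k) * 1 != 0 by rewrite det_cv_map.
by rewrite (moduliXE n2 D mf) det_cv_map mulr1.
Qed.

Lemma sigma_cv m e k : k != 0 -> conj_class m (cv_map n e k) ->
  sigma n m = sigma_value n e (e - k) 1.
Proof.
move=> k0 mf; apply: sigma_normal_formE => //.
by have := det_cv_map e k; rewrite !mulr1 => ->.
Qed.

Lemma moduliX_inv m b : b != 0 -> conj_class m (normal_form n 0 b 1 0) -> moduliX m = -1.
Proof.
move=> b0 mf; have D : 0 * 0 - b * 1 != 0 by rewrite mul0r sub0r mulr1 oppr_eq0.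
by rewrite (moduliXE n2 D mf) mul0r sub0r mulr1 invrN mulrN divff.
Qed.

Lemma sigma_inv m b : b != 0 -> conj_class m (normal_form n 0 b 1 0) ->
  sigma n m = n%:R ^+ n * (n%:R + 1) * (-1) ^+ n.
Proof.
move=> b0 mf; rewrite (sigma_normal_formE n2 _ mf) ?mul0r ?sub0r ?oppr_eq0 //.
rewrite /sigma_value !expr0n /= !mul0r !add0r mulr0 subr0.
have -> : b ^+ n.-1 * ((n%:R + 1) * b) = (n%:R + 1) * b ^+ n.
  by rewrite mulrCA -exprSr prednK.
have bn : b ^+ n != 0 by rewrite expf_neq0.
have sg : (-1) ^+ n * (-1) ^+ n = 1 :> C by rewrite -exprMn mulrNN mulr1 expr1n.
rewrite [(- b) ^+ n]exprNn; have s0 : (-1) ^+ n != 0 :> C by rewrite signr_eq0.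
apply: (mulIf (mulf_neq0 s0 bn)); rewrite divfK ?mulf_neq0 //.
transitivity (n%:R ^+ n * (n%:R + 1) * ((-1) ^+ n * (-1) ^+ n) * b ^+ n); last by ring.
by rewrite sg; ring.
Qed.

Lemma moduliX_power m : conj_class m (normal_form n 1 0 0 1) -> moduliX m = 0.
Proof.
move=> mf; have D : (1 : C) * 1 - 0 * 0 != 0 by rewrite mulr1 mul0r subr0 oner_neq0.
by rewrite (moduliXE n2 D mf) !mul0r.
Qed.

(** With critical values k(x+1) and kx one has X = x, and k enters sigma_n only through k^n. *)
Lemma sigma_value_cv x k : k != 0 ->
  sigma_value n (k * (x + 1)) (k * x) 1 =
  n%:R ^+ n * (k ^+ n * ((x + 1) ^+ n.+1 * x ^+ n.-1) + (k ^+ n)^-1 +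
    (x + x + 1 - n%:R) * x ^+ n.-1).
Proof.
move=> k0; rewrite /sigma_value expr1n mulr1.
have -> : k * (x + 1) - k * x = k by ring.
rewrite !exprMn [k ^+ n.+1]exprS.
have kn : k ^+ n = k * k ^+ n.-1 by rewrite -exprS prednK.
have p0 : k ^+ n.-1 != 0 by rewrite expf_neq0.
rewrite kn; field; rewrite ?p0 ?k0 //.
Qed.

(** For given X = x the value s prescribes Y, and a [cv_map] with k^n = 1/B realises it when B +
    c0/B = Y. This quadratic equation has a nonzero solution unless c0 = Y = 0; then x = -1 or x =
    0, and the classes of z^-n and z^n fill the gap. *)
Lemma chart1_surjective x s : exists m, moduliX m = x /\ sigma n m = s.
Proof.
have n10 : (0 < n.-1)%N by rewrite -ltnS prednK.
have nz : n%:R ^+ n != 0 :> C by rewrite expf_neq0 // pnatr_eq0 -lt0n.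
pose Y := s / n%:R ^+ n - (x + x + 1 - n%:R) * x ^+ n.-1.
pose c0 := (x + 1) ^+ n.+1 * x ^+ n.-1.
have sE : s = n%:R ^+ n * (Y + (x + x + 1 - n%:R) * x ^+ n.-1).
  by rewrite /Y subrK mulrC divfK.
have [B0|nB] := pselect (exists2 B, B != 0 & B + c0 / B = Y).
  have [B B0' BY] := B0; pose k := n.-root B^-1; have kn : k ^+ n = B^-1 by exact: rootCK.
  have k0 : k != 0.
    apply/eqP => k0; move: kn; rewrite k0 expr0n gtn_eqF //= => /esym/eqP.
    by rewrite invr_eq0 (negbTE B0').
  have D : k * (x + 1) * 1 - (k * (x + 1) - k) * 1 != 0 by rewrite det_cv_map.
  have [m mf] := moduli_of_normal_form n2 D.
  exists m; split.
    rewrite (moduliX_cv k0 mf); have -> : k * (x + 1) - k = k * x by ring.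
    by rewrite mulrAC divff // mul1r.
  rewrite (sigma_cv k0 mf); have -> : k * (x + 1) - k = k * x by ring.
  by rewrite sigma_value_cv // kn invrK -/c0 sE -BY; congr (_ * _); ring.
have [c00 Y0] : c0 = 0 /\ Y = 0.
  have c00 : c0 = 0.
    apply/eqP; apply: contra_notT nB => c00; pose S := sqrtC (Y ^+ 2 - 4 * c0).
    have SS : S ^+ 2 = Y ^+ 2 - 4 * c0 by exact: sqrtCK.
    pose B := (Y + S) / 2.
    have BB : B * (Y - B) = c0.
      have -> : B * (Y - B) = (Y ^+ 2 - S ^+ 2) / 4 by rewrite /B; field.
      by rewrite SS; field.
    have B0 : B != 0 by apply: contraNneq c00 => B0; rewrite -BB B0 mul0r.
    by exists B; rewrite // -BB mulrAC divff // mul1r addrC subrK.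
  split=> //; apply/eqP; apply: contra_notT nB => Y0.
  by exists Y; rewrite // c00 mul0r addr0.
move/eqP: c00; rewrite mulf_eq0 !expf_eq0 n10 /= => /orP[x1|/eqP x0].
  have {x1}x1 : x = -1 by apply/eqP; rewrite -addr_eq0.
  have D : (0 : C) * 0 - 1 * 1 != 0 by rewrite mul0r sub0r mulr1 oppr_eq0 oner_neq0.
  have [m mf] := moduli_of_normal_form n2 D.
  exists m; split; first by rewrite (moduliX_inv _ mf) ?oner_neq0.
  rewrite (sigma_inv _ mf) ?oner_neq0 // sE Y0 add0r x1.
  have -> : (-1) ^+ n = - (-1) ^+ n.-1 :> C by rewrite -[in LHS](prednK n0) exprS mulN1r.
  by ring.
have D : (1 : C) * 1 - 0 * 0 != 0 by rewrite mulr1 mul0r subr0 oner_neq0.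
have [m mf] := moduli_of_normal_form n2 D.
exists m; split; first by rewrite (moduliX_power mf).
by rewrite (sigma_powerE n2 mf) sE Y0 x0 expr0n gtn_eqF // mulr0 addr0 mulr0.
Qed.

End Representatives.

(** * The topology of the extended moduli space *)

Section ExtendedModuli.
Variable M : complex_model.
Local Notation R := (creal M).
Local Notation C := (cnum M).
Variable n : nat.
Hypothesis n2 : (2 <= n)%N.
Implicit Types (x s : C) (m : moduli C n) (B : R) (p : C * C).

Let n0 : (0 < n)%N. Proof. exact: ltnW. Qed.

(** A filter on the set is pushed forward by the chart and clusters at a point of Q. A preimage of
    that point is a cluster point, since traces of open sets are preimages of open sets. *)
Lemma compact_chart (T : topologicalType) (D : set T) (chart : T -> C * C) (Q : set (C * C)) :
  (forall U, open U -> exists2 V, open V & D `&` U = D `&` chart @^-1` V) ->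
  (forall p, exists2 t, D t & chart t = p) ->
  compact Q -> compact (D `&` chart @^-1` Q).
Proof.
move=> chart_open chart_surj cQ F FF FD.
have [|p [Qp clp]] := cQ (chart @ F) (fmap_proper_filter _ FF).
  by apply: (@filterS _ F _ (D `&` chart @^-1` Q)) => // t [].
have [t Dt tp] := chart_surj p.
exists t; split; first by split=> //=; rewrite tp.
move=> A W FA; rewrite nbhsE => -[U [oU Ut] UW].
have [V oV DUV] := chart_open U oU.
have Vp : V p by have : (D `&` U) t by []; rewrite DUV => -[_ /=]; rewrite tp.
have [|q [[a [Aa Da] <-] Va]] := clp (chart @` (A `&` D)) V _ (open_nbhs_nbhs (conj oV Vp)).
  by apply: (@filterS _ F _ (A `&` (D `&` chart @^-1` Q))) (filterI FA FD) => a [Aa [Da _]]; exists a.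
exists a; split=> //; apply: UW.
by have : (D `&` chart @^-1` V) a by []; rewrite -DUV => -[].
Qed.

Definition polydisc B : set (C * C) := [set u | cabs (u - 0) <= 1] `*` [set u | cabs (u - 0) <= B].

Lemma compact_polydisc B : compact (polydisc B).
Proof. by apply: compact_setX; exact: compact_disc. Qed.

Lemma chart2_surjective p : exists2 t : ext_moduli C n, chart2_dom t & chart2 t = p.
Proof.
case: p => x s; have [->|x0] := eqVneq x 0; first by exists (inr s).
have nz : n%:R ^+ n.+1 != 0 :> C by rewrite expf_neq0 // pnatr_eq0 -lt0n.
have [m [mx ms]] := chart1_surjective n2 x^-1 (s * (n%:R ^+ n.+1 * x^-1 ^+ n.-1)).
exists (inl m); rewrite /chart2_dom /= ?/moduli_L0 /= ?mx ?ms.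
  by move/eqP; rewrite invr_eq0 (negbTE x0).
by rewrite invrK mulfK // mulf_neq0 // expf_neq0 // invr_eq0.
Qed.

Definition growth_set k B : set (C * C) := [set p | B * (1 + cabs p.1 ^+ k) < cabs p.2].

Lemma open_growth_set k B : open (growth_set k B).
Proof.
pose g p := cabs p.2 - B * (1 + cabs p.1 ^+ k).
have -> : growth_set k B = g @^-1` [set r | r > 0].
  by apply/seteqP; split=> p; rewrite /growth_set /g /= subr_gt0.
apply: open_comp; last exact: open_gt.
move=> p _; apply: cvgB.
  by apply: continuous_comp; [exact: cvg_snd|exact: cabs_continuous].
apply: cvgM; first exact: cvg_cst.
apply: cvgD; first exact: cvg_cst.
apply: (@continuous_comp _ _ _ (fun p => cabs p.1) (fun r : R => r ^+ k)); last exact: exprn_continuous.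
by apply: continuous_comp; [exact: cvg_fst|exact: cabs_continuous].
Qed.

(** On the line at infinity the condition is the one that the estimate becomes in the second chart
    at hat X = 0. *)
Definition ext_bounded B : set (ext_moduli C n) :=
  [set t | match t with
           | inl m => cabs (sigma n m) <= B * (1 + cabs (moduliX m) ^+ n.-1)
           | inr s => n%:R ^+ n.+1 * cabs s <= B
           end].

(** Division by |X|^(n-1) turns 1 + |X|^(n-1) into 1 + |1/X|^(n-1). *)
Lemma ext_bounded_inl B m : moduliX m != 0 ->
  (cabs (sigma n m) <= B * (1 + cabs (moduliX m) ^+ n.-1)) =
  (n%:R ^+ n.+1 * cabs (sigma n m / (n%:R ^+ n.+1 * moduliX m ^+ n.-1)) <=
    B * (1 + cabs (moduliX m)^-1 ^+ n.-1)).
Proof.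
move=> X0; have Xp : 0 < cabs (moduliX m) ^+ n.-1 by rewrite exprn_gt0 // cabs_gt0.
have nz : (n%:R : R) ^+ n.+1 != 0 by rewrite expf_neq0 // pnatr_eq0 -lt0n.
rewrite cabsM cabsV cabsM !cabsX cabs_nat cabsV.
rewrite -[RHS](ler_pM2r Xp); congr (_ <= _).
  by field; rewrite nz lt0r_neq0.
rewrite exprVn -mulrA mulrDl mul1r mulVf ?lt0r_neq0 //.
by rewrite addrC.
Qed.

(** In each chart the complement is a strict inequality between continuous functions, with constant
    B in the first and B / n^(n+1) in the second. *)
Lemma closed_ext_bounded B : closed (ext_bounded B).
Proof.
have nz : 0 < (n%:R : R) ^+ n.+1 by rewrite exprn_gt0 // ltr0n.
rewrite -[ext_bounded B]setCK; apply: open_closedC; split.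
  exists (growth_set n.-1 B); first exact: open_growth_set.
  by apply/seteqP; split=> m /=; rewrite /growth_set /= ltNge => /negP.
exists (growth_set n.-1 (B / n%:R ^+ n.+1)); first exact: open_growth_set.
have E x s : growth_set n.-1 (B / n%:R ^+ n.+1) (x, s) <->
    ~ (n%:R ^+ n.+1 * cabs s <= B * (1 + cabs x ^+ n.-1)).
  by rewrite /growth_set /= mulrAC ltr_pdivrMr // [cabs s * _]mulrC ltNge; split=> /negP.
have n10 : (0 < n.-1)%N by rewrite -ltnS prednK.
apply/seteqP; split=> -[m|s] [D h]; (split; first by []).
- have X0 : moduliX m != 0 by apply/eqP.
  by apply/E; rewrite -ext_bounded_inl.
(* At hat X = 0 the power of exponent n - 1 > 0 vanishes and the weight is 1. *)
- by apply/E; rewrite cabs0 expr0n gtn_eqF // addr0 mulr1.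
- have X0 : moduliX m != 0 by apply/eqP.
  by move: h => /E; rewrite -ext_bounded_inl.
- by move: h => /E; rewrite cabs0 expr0n gtn_eqF // addr0 mulr1.
Qed.

(** A total function for [compact_chart]; the value on the line at infinity is a default outside the
    domain [range inl]. *)
Definition chart1_ext (t : ext_moduli C n) : C * C := if t is inl m then chart1 m else (0, 0).

(** Where |X| <= 1 the estimate gives |sigma_n| <= 2B; elsewhere |1/X| <= 1 and |hat sigma_1| <= 2B
    / n^(n+1). The set is closed in a union of two compact polydiscs. *)
Lemma compact_ext_bounded B : compact (ext_bounded B).
Proof.
have nz : 0 < (n%:R : R) ^+ n.+1 by rewrite exprn_gt0 // ltr0n.
pose K1 : set (ext_moduli C n) := range inl `&` chart1_ext @^-1` polydisc (B * 2).
pose K2 : set (ext_moduli C n) := @chart2_dom C n `&` (@chart2 C n) @^-1` polydisc (B * 2 / n%:R ^+ n.+1).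
apply: (@subclosed_compact _ (ext_bounded B) (K1 `|` K2)); first exact: closed_ext_bounded.
  apply: compactU; apply: compact_chart; try exact: compact_polydisc.
  - move=> U [[V oV UV] _]; exists V => //; apply/seteqP; split=> t [[m _ <-]] h.
      by split; [exists m|have : (inl @^-1` U) m by []; rewrite UV].
    by split; [exists m|have : ((@chart1 C n) @^-1` V) m by []; rewrite -UV].
  - move=> [x s]; have [m [mx ms]] := chart1_surjective n2 x s.
    by exists (inl m); [exists m|rewrite /= /chart1 mx ms].
  - by move=> U [_ [V oV UV]]; exists V.
  - exact: chart2_surjective.
have E (a b : R) : 0 <= B -> b <= 1 -> a <= B * (1 + b) -> a <= B * 2.
  by move=> B0 b1 h; apply: le_trans h _; apply: ler_wpM2l => //; lra.
have B0 (a b : R) : 0 <= a -> 0 <= b -> a <= B * (1 + b) -> 0 <= B.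
  move=> a0 b0 h; have b1 : 0 < 1 + b by lra.
  by rewrite -(pmulr_lge0 _ b1); exact: le_trans h.
case=> [m /= h|s /= h].
  have Bp := B0 _ _ (cabs_ge0 _) (exprn_ge0 _ (cabs_ge0 _)) h.
  have [X1|X1] := lerP (cabs (moduliX m)) 1.
    left; split; first by exists m.
    rewrite /polydisc /= !subr0; split=> //; apply: E h => //.
    by apply: exprn_ile1 => //; exact: cabs_ge0.
  have X0 : moduliX m != 0 by rewrite -cabs_gt0 (lt_trans ltr01).
  right; split; first by move/eqP; rewrite (negbTE X0).
  have V1 : cabs (moduliX m)^-1 <= 1 by rewrite cabsV invf_le1 ?(ltW X1) // (lt_trans ltr01).
  rewrite /polydisc /= !subr0; split=> //.
  rewrite ler_pdivlMr // mulrC; move: h; rewrite ext_bounded_inl //; apply: E => //.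
  by apply: exprn_ile1 => //; exact: cabs_ge0.
right; split=> //; rewrite /polydisc /= !subr0 cabs0 ler01; split=> //.
rewrite ler_pdivlMr // mulrC; apply: (E _ 0) => //; last by rewrite addr0 mulr1.
by apply: le_trans h; rewrite mulr_ge0 ?cabs_ge0 // ltW.
Qed.

End ExtendedModuli.

(** * Bounds on the connectedness locus *)

Section Estimates.
Variable M : complex_model.
Local Notation R := (creal M).
Local Notation C := (cnum M).
Variable n : nat.
Hypothesis n2 : (2 <= n)%N.
Implicit Types (e k : C) (m : moduli C n).

Let n0 : (0 < n)%N. Proof. exact: ltnW. Qed.
Let n10 : (0 < n.-1)%N. Proof. by rewrite -ltnS prednK. Qed.

(** The part of k^n sigma_n / n^n without an evident factor k. *)
Definition cv_numerator e k : C := 1 + e ^+ n.+1 * (e - k) ^+ n.-1 + 2 * e * (e - k) ^+ n.-1.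

(** At k = 0 only the square of 1 + e^n remains, the quantity controlled by [cv_map_disconnected];
    the correction has a factor k. *)
Lemma cv_numeratorE e k : cv_numerator e k =
  (1 + e ^+ n) ^+ 2 - (e ^+ n.-1 - (e - k) ^+ n.-1) * (e ^+ n.+1 + 2 * e).
Proof. by rewrite /cv_numerator -[in e ^+ n](prednK n0) exprSr -(prednK n0) !exprSr; ring. Qed.

Lemma cv_numerator_crude e k (E : R) : cabs e ^+ n.+1 * cabs (e - k) ^+ n.-1 <= 1 ->
  cabs e * cabs (e - k) ^+ n.-1 <= E -> cabs (cv_numerator e k) <= 2 + 2 * E.
Proof.
move=> h1 h2; apply: le_trans (cabsD _ _) _; apply: lerD.
  apply: le_trans (cabsD _ _) _; rewrite cabs1 cabsM !cabsX; lra.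
by rewrite !cabsM !cabsX (cabs_nat M 2) -mulrA; lra.
Qed.

(** The normalisation gives |e| |b|^(n-1) <= 1, hence |b| <= 1 and |k| >= 1. The numerator is then
    at most 4 and the right-hand side at least 4. *)
Lemma cv_numerator_large e k : 2 < cabs e -> cabs e ^+ n.+1 * cabs (e - k) ^+ n.-1 <= 1 ->
  cabs (cv_numerator e k) <= 4 * (cabs k * (cabs k ^+ n.-1 + cabs (e - k) ^+ n.-1)).
Proof.
move=> e2 h; have e1 : 1 <= cabs e by lra.
have e0 : 0 < cabs e by lra.
have b0 := cabs_ge0 (e - k); have bn0 : 0 <= cabs (e - k) ^+ n.-1 by exact: exprn_ge0.
have ebn : cabs e * cabs (e - k) ^+ n.-1 <= 1.
  by apply: le_trans h; apply: ler_wpM2r => //; apply: ler_eXnr.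
have b1 : cabs (e - k) <= 1.
  rewrite -(expr_le1 n10 b0); apply: le_trans ebn; rewrite -[leLHS]mul1r.
  exact: ler_wpM2r.
have k1 : 1 <= cabs k.
  have -> : k = e - (e - k) by rewrite opprB addrC subrK.
  by have := cabs_sub_ge e (e - k); lra.
apply: le_trans (cv_numerator_crude h ebn) _.
have := expr_ge1 n10 (le_trans ler01 k1); rewrite k1 => kn.
have : 1 * 1 <= cabs k * (cabs k ^+ n.-1 + cabs (e - k) ^+ n.-1).
  by apply: ler_pM => //; apply: le_trans kn _; rewrite lerDl.
lra.
Qed.

Lemma cv_numerator_far e k : cabs e <= 2 -> 1 <= cabs k ->
  cabs e ^+ n.+1 * cabs (e - k) ^+ n.-1 <= 1 ->
  cabs (cv_numerator e k) <= 4 * (cabs k * (cabs k ^+ n.-1 + cabs (e - k) ^+ n.-1)).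
Proof.
move=> e2 k1 h; have bn0 : 0 <= cabs (e - k) ^+ n.-1 by rewrite exprn_ge0 ?cabs_ge0.
have kn : 1 <= cabs k ^+ n.-1 by rewrite exprn_ege1.
apply: le_trans (cv_numerator_crude h (ler_wpM2r bn0 e2)) _.
have : 1 * (1 + cabs (e - k) ^+ n.-1) <= cabs k * (cabs k ^+ n.-1 + cabs (e - k) ^+ n.-1).
  by apply: ler_pM => //; lra.
lra.
Qed.

(** The two summands bound the two terms of [cv_numeratorE], divided by |k|, when |e| <= 2 and |e -
    k| <= 3. *)
Definition near_const : R := `|cv_const M n| + n.-1%:R * 3 ^+ n.-2 * (2 ^+ n.+1 + 4).
(** Small enough that |k| below it forces |1 + e^n|^2 <= 1/4. *)
Definition near_radius : R := (4 * (`|cv_const M n| + 1))^-1.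

Lemma cv_numerator_near e k : cabs e <= 2 -> cabs k <= 1 ->
  cabs (1 + e ^+ n) ^+ 2 <= cv_const M n * cabs k ->
  cabs (cv_numerator e k) <= near_const * cabs k.
Proof.
move=> e2 k1 h; rewrite /near_const mulrDl cv_numeratorE.
apply: le_trans (cabsD _ _) _; rewrite cabsN cabsX; apply: lerD.
  by apply: le_trans h _; rewrite ler_wpM2r ?cabs_ge0 // ler_norm.
rewrite cabsM mulrAC; apply: ler_pM; rewrite ?cabs_ge0 //.
  have := cabsB e k; have b3 : cabs (e - k) <= 3.
    by apply: le_trans (cabsD _ _) _; rewrite cabsN; lra.
  have e3 : cabs e <= 3 by lra.
  move=> _; have := cabs_powB n.-1 e3 b3.
  have -> : e - (e - k) = k by ring.
  by rewrite mulrC mulrA.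
apply: le_trans (cabsD _ _) _; rewrite cabsX cabsM (cabs_nat M 2); apply: lerD; last lra.
by rewrite lerXn2r ?nnegrE ?cabs_ge0.
Qed.

Lemma near_radius_gt0 : 0 < near_radius.
Proof. by rewrite invr_gt0 mulr_gt0 // ltr_wpDl. Qed.

Lemma near_radius_le : near_radius <= 4^-1.
Proof.
rewrite lef_pV2 ?posrE // ?mulr_gt0 ?ltr_wpDl //.
by have := normr_ge0 (cv_const M n); lra.
Qed.

(** The critical value b and k are not both small: if |k| < [near_radius] <= 1/4, then |1 + e^n| <=
    1/2, so |e| >= 1/2 and |b| >= 1/4. *)
Lemma cv_denominator_lower e k : cabs (1 + e ^+ n) ^+ 2 <= cv_const M n * cabs k ->
  near_radius ^+ n.-1 <= cabs k ^+ n.-1 + cabs (e - k) ^+ n.-1.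
Proof.
move=> h; have r0 := near_radius_gt0; have r4 := near_radius_le.
have kn0 : 0 <= cabs k ^+ n.-1 by rewrite exprn_ge0 ?cabs_ge0.
have bn0 : 0 <= cabs (e - k) ^+ n.-1 by rewrite exprn_ge0 ?cabs_ge0.
have mono t : near_radius <= t -> near_radius ^+ n.-1 <= t ^+ n.-1.
  by move=> rt; rewrite lerXn2r ?nnegrE ?(ltW r0) // (le_trans (ltW r0)).
have [kr|kr] := lerP near_radius (cabs k); first by have := mono _ kr; lra.
suff : near_radius <= cabs (e - k) by move=> /mono; lra.
have s2 : cabs (1 + e ^+ n) ^+ 2 <= 2^-1 ^+ 2.
  apply: le_trans h _; have K1 : 0 < `|cv_const M n| + 1 by rewrite ltr_wpDl.
  apply: (@le_trans _ _ ((`|cv_const M n| + 1) * near_radius)).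
    apply: le_trans (ler_wpM2r (cabs_ge0 _) (_ : _ <= `|cv_const M n| + 1)) _.
      by rewrite (le_trans (ler_norm _)) // lerDl.
    by rewrite ler_pM2l // ltW.
  rewrite /near_radius invfM mulrCA divff ?lt0r_neq0 //; lra.
have s1 : cabs (1 + e ^+ n) <= 2^-1.
  by rewrite -(@ler_pXn2r _ 2) ?nnegrE ?cabs_ge0 // invr_ge0.
have en : 2^-1 <= cabs e ^+ n.
  have := cabs_sub_ge 1 (1 + e ^+ n); rewrite cabs1 opprD addrA subrr sub0r cabsN cabsX; lra.
have e1 : 2^-1 <= cabs e.
  have [c1|c1] := lerP (cabs e) 1; last lra.
  by apply: le_trans en _; apply: ler_iXnr => //; exact: cabs_ge0.
have := cabs_sub_ge e k; lra.
Qed.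

(** Three ranges: |e| > 2, then |k| >= 1, then both small. Only the last uses the second hypothesis,
    which is what a connected Julia set provides. *)
Lemma cv_numerator_bound : exists K : R, forall e k,
  cabs e ^+ n.+1 * cabs (e - k) ^+ n.-1 <= 1 ->
  (cabs e <= 2 -> cabs (1 + e ^+ n) ^+ 2 <= cv_const M n * cabs k) ->
  cabs (cv_numerator e k) <= K * (cabs k * (cabs k ^+ n.-1 + cabs (e - k) ^+ n.-1)).
Proof.
have r0 : 0 < near_radius ^+ n.-1 by rewrite exprn_gt0 ?near_radius_gt0.
have c0 : 0 <= near_const.
  by rewrite addr_ge0 // !mulr_ge0 ?ler0n ?exprn_ge0 // addr_ge0 ?exprn_ge0.
exists (4 + near_const / near_radius ^+ n.-1) => e k h1 h2.
have kn0 : 0 <= cabs k ^+ n.-1 by rewrite exprn_ge0 ?cabs_ge0.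
have bn0 : 0 <= cabs (e - k) ^+ n.-1 by rewrite exprn_ge0 ?cabs_ge0.
set Q := cabs k * _; have Q0 : 0 <= Q by rewrite mulr_ge0 ?cabs_ge0 // addr_ge0.
have q0 : 0 <= near_const / near_radius ^+ n.-1 by rewrite divr_ge0 // ltW.
rewrite mulrDl; have Q1 : 0 <= 4 * Q by rewrite mulr_ge0.
have Q2 : 0 <= near_const / near_radius ^+ n.-1 * Q by rewrite mulr_ge0.
have [e2|e2] := lerP (cabs e) 2; last by have := cv_numerator_large e2 h1; rewrite -/Q; lra.
have [k1|k1] := lerP 1 (cabs k); first by have := cv_numerator_far e2 k1 h1; rewrite -/Q; lra.
have := cv_numerator_near e2 (ltW k1) (h2 e2).
suff : near_const * cabs k <= near_const / near_radius ^+ n.-1 * Q by lra.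
rewrite -mulrA; apply: ler_wpM2l => //; rewrite mulrC ler_pdivlMr //.
by apply: ler_wpM2l; [exact: cabs_ge0|exact: cv_denominator_lower (h2 e2)].
Qed.

Lemma sigma_value_numerator e k : k != 0 -> sigma_value n e (e - k) 1 =
  n%:R ^+ n * (cv_numerator e k - (n%:R + 1) * k * (e - k) ^+ n.-1) / k ^+ n.
Proof.
move=> k0; rewrite /sigma_value /cv_numerator expr1n mulr1.
have -> : e - (e - k) = k by ring.
by congr (_ * _ / _); ring.
Qed.

(** Connectedness passes to the representative, so [cv_map_disconnected] yields the hypothesis of
    [cv_numerator_bound]. As X = b/k, the product |k|^n (1 + |X|^(n-1)) is |k| (|k|^(n-1) +
    |b|^(n-1)), and the leftover term (n+1) k b^(n-1) is bounded by it directly. *)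
Lemma sigma_bound : exists B : R, forall m, connectedness_locus C n m ->
  cabs (sigma n m) <= B * (1 + cabs (moduliX m) ^+ n.-1).
Proof.
have [K hK] := cv_numerator_bound.
pose A : R := n%:R ^+ n; have A0 : 0 <= A by rewrite exprn_ge0.
exists (A * (`|K| + (n%:R + 1))) => m [f mf cf].
have cg g : conj_class m g -> connected (julia_set g).
  by move=> mg; exact: julia_connected_conjugate (conj_class_conjugate mf mg) cf.
have S0 : 0 <= `|K| + (n%:R + 1) by rewrite !addr_ge0.
have X0 : 0 <= cabs (moduliX m) ^+ n.-1 by rewrite exprn_ge0 ?cabs_ge0.
have [mp|[b b0 mb]|[e [k [k0 ek mk]]]] := representative_cases n2 m.
- by rewrite (sigma_powerE n2 mp) cabs0; apply: mulr_ge0; [exact: mulr_ge0|exact: addr_ge0].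
- rewrite (sigma_inv n2 b0 mb) !cabsM !cabsX cabsN cabs1 expr1n mulr1 cabs_nat -/A -mulrA.
  apply: ler_wpM2l => //; apply: le_trans (_ : n%:R + 1 <= _).
    by apply: le_trans (cabsD _ _) _; rewrite cabs_nat cabs1.
  rewrite -[leLHS]mulr1; apply: ler_pM; rewrite ?addr_ge0 ?ler01 ?ler0n //.
    by rewrite lerDr.
  by rewrite lerDl.
have kp : 0 < cabs k by rewrite cabs_gt0.
have nd : cabs e <= 2 -> cabs (1 + e ^+ n) ^+ 2 <= cv_const M n * cabs k.
  move=> e2; have [//|/ltW le] := lerP (cabs (1 + e ^+ n) ^+ 2) (cv_const M n * cabs k).
  by case: (cv_map_disconnected n2 k0 e2 le); exact: cg.
rewrite (sigma_cv n2 k0 mk) (moduliX_cv n2 k0 mk) sigma_value_numerator //.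
rewrite !cabsM !cabsV !cabsX cabs_nat -/A -!mulrA; apply: ler_wpM2l => //.
rewrite ler_pdivrMr ?exprn_gt0 //.
have -> : (`|K| + (n%:R + 1)) * (1 + (cabs (e - k) / cabs k) ^+ n.-1) * cabs k ^+ n =
    (`|K| + (n%:R + 1)) * (cabs k * (cabs k ^+ n.-1 + cabs (e - k) ^+ n.-1)).
  rewrite -[in cabs k ^+ n](prednK n0) exprS expr_div_n; field.
  by rewrite expf_neq0 ?lt0r_neq0.
set Q := cabs k * _; have Q0 : 0 <= Q.
  by rewrite mulr_ge0 ?cabs_ge0 // addr_ge0 ?exprn_ge0 ?cabs_ge0.
apply: le_trans (cabsD _ _) _; rewrite [leRHS]mulrDl cabsN; apply: lerD.
  by apply: le_trans (hK _ _ ek nd) _; apply: ler_wpM2r => //; exact: ler_norm.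
rewrite !cabsM cabsX; apply: ler_pM; rewrite ?cabs_ge0 ?mulr_ge0 ?exprn_ge0 ?cabs_ge0 //.
  by apply: le_trans (cabsD _ _) _; rewrite cabs_nat cabs1.
by apply: ler_wpM2l; rewrite ?cabs_ge0 // lerDr exprn_ge0 ?cabs_ge0.
Qed.

End Estimates.

(** * Specialisation to the complex numbers over a real field *)

Lemma ler_real_complex (R : realType) (r s : R) : (real_complex R r <= real_complex R s) = (r <= s).
Proof. exact: lecR. Qed.

Lemma real_real_complex (R : realType) (z : R[i]) : z \is Num.real -> exists r, z = real_complex R r.
Proof. by move=> /complex_realP[r ->]; exists r. Qed.

Definition complex_R (R : realType) : complex_model :=
  @ComplexModel R R[i] (real_complex R) (@ler_real_complex R) (@real_real_complex R).

Theorem theorem7p1 (R : realType) (n : nat) (hn : (2 <= n)%N) :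
  (exists K : set (ext_moduli R[i] n),
     compact K /\ ext_connectedness_locus R[i] n `<=` K) /\
  compact (closure (ext_connectedness_locus R[i] n)).
Proof.
have [B locus_bound] := sigma_bound (complex_R R) hn.
have cK := @compact_ext_bounded (complex_R R) n hn B.
have sub : ext_connectedness_locus R[i] n `<=` ext_bounded (M := complex_R R) B.
  by move=> _ [m Cm <-]; exact: locus_bound.
split; first by exists (ext_bounded (M := complex_R R) B).
apply: subclosed_compact cK _; first exact: closed_closure.
move=> t; rewrite [X in _ -> X t](closure_id _).1; last exact: closed_ext_bounded.
exact: closure_subset.
Qed.
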